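(* Let $\phi_1,\phi_2$ be inner functions in the bidisc algebra $\mathcal{A}(\mathbb{D}^2)$. Then $[P_{\phi_1},P_{\phi_2}]$ has finite rank if and only if $[P_{\phi_1},P_{\phi_2}]=0$.
   Context: $\mathcal{A}(\mathbb{D}^2)$ is the algebra of functions holomorphic on the bidisc $\mathbb{D}^2$ that are continuous on $\overline{\mathbb{D}^2}$ (i.e. extend continuously). An inner function on $\mathbb{D}^2$ is a bounded analytic function $\phi$ with $|\phi|=1$ a.e. on $\mathbb{T}^2$. $H^2(\mathbb{D}^2)$ is the Hardy space of the bidisc, $P_\phi$ is the orthogonal projection of $H^2(\mathbb{D}^2)$ onto the closed subspace $\phi H^2(\mathbb{D}^2)$, and $[P,Q]=PQ-QP$. *)

(* Defs.v *)
From HB Require Import structures.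
From mathcomp Require Import all_boot all_order all_algebra.
From mathcomp Require Import complex ring.
From mathcomp Require Import all_classical all_reals all_analysis.

Set Implicit Arguments.
Unset Strict Implicit.
Unset Printing Implicit Defensive.

Import Order.TTheory GRing.Theory Num.Theory.
Import numFieldNormedType.Exports.

Local Open Scope complex_scope.
Local Open Scope classical_set_scope.
Local Open Scope ring_scope.

(* The alias [^o] is what carries the topology, norm and vector space structure
   of the complex field over itself; in particular [differentiable] below is
   differentiability over the complex numbers. *)
Notation CC R := (R[i]^o).

Section Bidisc.
Variable R : realType.
Local Notation C := (CC R).

Definition bidisc : set (C * C) := [set z | `|z.1| < 1 /\ `|z.2| < 1].

Definition closed_bidisc : set (C * C) := [set z | `|z.1| <= 1 /\ `|z.2| <= 1].

(* Functions on the bidisc that have to be differentiated are total functions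
   whose values outside the bidisc are irrelevant. *)
Definition holomorphic (phi : C * C -> C) : Prop :=
  forall z, bidisc z -> differentiable phi z.

Definition bidisc_algebra (phi : C * C -> C) : Prop :=
  holomorphic phi /\
  exists g : C * C -> C,
    {within closed_bidisc, continuous g} /\ {in bidisc, g =1 phi}.

Definition cis (t : R) : C := cos t +i* sin t.

(* The torus is parametrized by the square [0, 2 pi]^2, and the boundary values
   of a bounded analytic function are its radial limits. *)
Definition inner (phi : C * C -> C) : Prop :=
  [/\ holomorphic phi,
      exists M : R, forall z, bidisc z -> `|phi z| <= M%:C
    & {ae (lebesgue_measure \x lebesgue_measure)%E, forall t : R * R,
        (t.1 \in `[0, 2 * pi] /\ t.2 \in `[0, 2 * pi]) ->
        exists l : C,
          phi (r%:C * cis t.1, r%:C * cis t.2) @[r --> (1 : R)^'-] --> l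
          /\ `|l| = 1}].

End Bidisc.

Arguments bidisc R : clear implicits.

Section Hardy.
Variable R : realType.
Local Notation C := (CC R).

Definition square_summable (a : nat * nat -> C) : Prop :=
  (\esum_(p in [set: nat * nat]) (Normc.normc (a p) ^+ 2)%:E < +oo)%E.

(* For square summable coefficients the double power series converges
   absolutely on the bidisc, so summing along squares is no restriction. *)
Definition taylor_expansion (f : bidisc R -> C) (a : nat * nat -> C) : Prop :=
  forall z : bidisc R,
    (\sum_(m < N) \sum_(n < N)
      a (val m, val n) * (val z).1 ^+ m * (val z).2 ^+ n)
      @[N --> \oo] --> f z.

Definition hardy : {pred bidisc R -> C} :=
  [pred f | `[< exists a, square_summable a /\ taylor_expansion f a >]].

Lemma square_summableD a b :
  square_summable a -> square_summable b -> square_summable (a \+ b).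
Proof.
rewrite /square_summable => ha hb.
pose A p := (Normc.normc (a p) ^+ 2)%:E; pose B p := (Normc.normc (b p) ^+ 2)%:E.
have A0 p : (0 <= A p)%E by rewrite lee_fin sqr_ge0.
have B0 p : (0 <= B p)%E by rewrite lee_fin sqr_ge0.
apply: (@le_lt_trans _ _
  (\esum_(p in [set: nat * nat]) ((A p + B p) + (A p + B p)))%E).
  apply: le_esum => p _; rewrite -!EFinD lee_fin /=.
  have := le_normcD (a p) (b p).
  have h0 (x : R[i]) : 0 <= Normc.normc x by case: x => ? ?; exact: sqrtr_ge0.
  set x := Normc.normc (a p); set y := Normc.normc (b p) => h.
  apply: (@le_trans _ _ ((x + y) ^+ 2)).
    by rewrite lerXn2r ?nnegrE ?h0 ?addr_ge0 ?h0.
  rewrite -subr_ge0 (_ : _ - _ = (x - y) ^+ 2) ?sqr_ge0//.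
  by ring.
have hAB : (\esum_(p in [set: nat * nat]) (A p + B p) < +oo)%E.
  by rewrite esumD// lte_add_pinfty.
by rewrite esumD ?lte_add_pinfty// => p _; exact: adde_ge0.
Qed.

Lemma square_summableZ c a :
  square_summable a -> square_summable (fun p => c * a p).
Proof.
rewrite /square_summable => ha.
have c0 : 0 <= Normc.normc c ^+ 2 by exact: sqr_ge0.
apply: (@le_lt_trans _ _ ((Normc.normc c ^+ 2)%:E *
  \esum_(p in [set: nat * nat]) (Normc.normc (a p) ^+ 2)%:E)%E); last first.
  by rewrite lte_mul_pinfty// esum_ge0// => p _; rewrite lee_fin sqr_ge0.
apply: ge_ereal_sup => /= _ [F [finF _] <-].
under eq_fsbigr do rewrite Normc.normcM exprMn EFinM.
rewrite -ge0_mule_fsumr; last by move=> p; rewrite lee_fin sqr_ge0.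
by apply: lee_pmul => //; [apply: fsume_ge0 => p _; rewrite lee_fin sqr_ge0
  | apply: ereal_sup_ubound; exists F].
Qed.

Lemma square_summable0 : square_summable (fun=> 0).
Proof.
by rewrite /square_summable esum1 ?ltry// => p _; rewrite Normc.normc0 expr0n.
Qed.

Lemma hardy_submod_closed : submod_closed hardy.
Proof.
split.
  apply/asboolP; exists (fun=> 0); split; first exact: square_summable0.
  move=> z; rewrite (_ : (fun _ => _) = fun=> 0); first exact: cvg_cst.
  by apply/funext => N; rewrite big1// => m _; rewrite big1// => n _; rewrite !mul0r.
move=> c f g /asboolP[a [ha hf]] /asboolP[b [hb hg]]; apply/asboolP.
exists ((fun p => c * a p) \+ b); split.
  by apply: square_summableD => //; exact: square_summableZ.
move=> z; rewrite [X in X @ _ --> _](_ : _ =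
   (fun N : nat => c * (\sum_(m < N) \sum_(n < N)
     a (val m, val n) * (val z).1 ^+ m * (val z).2 ^+ n)) \+
   (fun N : nat => \sum_(m < N) \sum_(n < N)
     b (val m, val n) * (val z).1 ^+ m * (val z).2 ^+ n)).
  by apply: cvgD; [apply: cvgMr; exact: hf | exact: hg].
apply/funext => N /=; rewrite mulr_sumr -big_split; apply: eq_bigr => m _ /=.
rewrite mulr_sumr -big_split; apply: eq_bigr => n _ /=.
by rewrite !mulrDl !mulrA.
Qed.

HB.instance Definition _ :=
  GRing.isSubmodClosed.Build _ _ hardy hardy_submod_closed.

Record hardyType := HardyFun {
  hardy_val :> bidisc R -> C;
  hardy_valP : hardy_val \in hardy }.

HB.instance Definition _ := [isSub for hardy_val].
HB.instance Definition _ := [Choice of hardyType by <:].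
HB.instance Definition _ := [SubChoice_isSubLmodule of hardyType by <:].

(* The coefficients of [f] are unique, hence independent of the choice made by
   [xget]. *)
Definition taylor (f : hardyType) : nat * nat -> C :=
  xget (fun=> 0) [set a | square_summable a /\ taylor_expansion f a].

(* The partial sums converge absolutely by the Cauchy-Schwarz inequality. *)
Definition hardy_dot (f g : hardyType) : C :=
  limn (fun N => \sum_(m < N) \sum_(n < N)
    taylor f (val m, val n) * (taylor g (val m, val n))^*%C : C).

Definition mul_hardy (phi : C * C -> C) : set hardyType :=
  [set g | exists h : hardyType, forall z : bidisc R, g z = phi (val z) * h z].

(* When [M] is a closed subspace there is exactly one such [g]; [phi H^2] is
   closed for inner [phi]. *)
Definition orth_proj (M : set hardyType) (f : hardyType) : hardyType :=
  xget 0 [set g | M g /\ forall h, M h -> hardy_dot (f - g) h = 0].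

Definition P_ (phi : C * C -> C) : hardyType -> hardyType :=
  orth_proj (mul_hardy phi).

Definition commutator (S T : hardyType -> hardyType) : hardyType -> hardyType :=
  (S \o T) \- (T \o S).

Definition finite_rank (T : hardyType -> hardyType) : Prop :=
  exists (n : nat) (e : 'I_n -> hardyType),
    range T = [set \sum_(i < n) c i *: e i | c in [set: 'I_n -> R[i]]].

End Hardy.

(* Main.v *)
(* Write K = [P_phi1, P_phi2], k_w for the Szego kernel and u = phi2 conj(phi1)
   on the torus. Since P_phi k_w = conj(phi(w)) phi k_w,
     (K k_w)(z) = phi1(z) conj(phi2(w)) U(z,w) - phi2(z) conj(phi1(w)) conj(U(w,z)),
   where U(z,w) is the mean of u k_w conj(k_z). If K has finite rank, its kernel
   is a finite sum of products e(z) conj(e'(w)) with e, e' in H^2, so that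
   (1 - r^2) K((b, r c), (a, r c)) tends to 0 as r -> 1 for |c| = 1. The limit of
   the formula above is an identity between the slices of phi1 and phi2 at height
   c, which forces the slice of u to be analytic or antianalytic. By connectedness
   of the circle the alternative is the same for all c, in each variable.
   If u is analytic in both variables, phi2 is a multiple of phi1 and K = 0.
   If it is analytic in the first variable and antianalytic in the second one,
   a linear relation between finitely many columns of the kernel gives, on the
   torus, u(x,y) N_y(x) = q(x) with polynomials N_y of bounded degree whose modulus
   on the circle does not depend on y; up to scalars there are only finitely many
   of them, so N_y is locally constant, u(x,y) = b(x) c(y), and again K = 0. *)

Require Import Defs.
From mathcomp Require Import all_boot all_order all_algebra.
From mathcomp Require Import complex ring lra.
From mathcomp Require Import all_classical all_reals all_analysis.

Set Implicit Arguments.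
Unset Strict Implicit.
Unset Printing Implicit Defensive.

Import Order.TTheory GRing.Theory Num.Theory.
Import numFieldNormedType.Exports.

Local Open Scope complex_scope.
Local Open Scope classical_set_scope.
Local Open Scope ring_scope.

(** * Values of Hardy functions *)

Section HardyValues.
Variable R : realType.
Implicit Types f g : hardyType R.

(** Both symbols lie in the bidisc algebra, so every integral that occurs is the mean of a uniformly
    continuous function and can be taken as a limit of dyadic sums; the a.e. condition in [inner]
    serves to show that the continuous boundary values are unimodular everywhere. Elements of H^2
    have no boundary function here: they are square summable arrays, evaluated by pairing with the
    coefficients of the Szego kernel, and multiplication by phi is extended to them from polynomials
    by isometry. Then P_phi = M M^* for the multiplication operator M, and M^* k_w = conj(phi(w))
    k_w gives the formula for P_phi k_w. The factor 1 - r^2 turns |k_(rc)|^2 into the Poisson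
    kernel, so that the mean in that variable converges to the slice at height c. It also beats the
    growth of H^2 functions, for which |e(b, rc)|^2 = o(1 / (1 - r^2)). The remaining cases
    (antianalytic in both variables, and the other mixed one) reduce to the treated ones by
    exchanging phi1 and phi2, which conjugates u and changes the sign of K. *)

Lemma hardy_valB f g z : (f - g) z = f z - g z.
Proof.
have E : val (f - g) = val f - val g by rewrite raddfB.
exact: (congr1 (fun F => F z) E).
Qed.

Lemma hardy_valD f g z : (f + g) z = f z + g z.
Proof.
have E : val (f + g) = val f + val g by rewrite raddfD.
exact: (congr1 (fun F => F z) E).
Qed.

(* Checking the last lemma of this group in one step makes the conversion test
   diverge, hence the intermediate statements. *)
Lemma scale_fct (T : Type) (g h : T -> R[i]^o) (c : R[i]) : g = c *: h -> forall z, g z = c * h z.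
Proof. by move=> -> z. Qed.

Lemma val_hardyZ f (c : R[i]) : val (c *: f) = c *: val f.
Proof. exact: linearZ. Qed.

Lemma val_hardyZE f (c : R[i]) z : (val (c *: f)) z = c * val f z.
Proof. exact: (scale_fct (val_hardyZ f c) z). Qed.

Lemma val_hardyE f z : val f z = f z.
Proof. by []. Qed.

Lemma hardy_valZ f (c : R[i]) z : (c *: f) z = c * f z.
Proof. exact: (etrans (esym (val_hardyE (c *: f) z)) (val_hardyZE f c z)). Qed.

Lemma hardy_val_sum n (c : 'I_n -> R[i]) (e : 'I_n -> hardyType R) z :
  (\sum_(i < n) c i *: e i) z = \sum_(i < n) c i * e i z.
Proof.
elim/big_ind2: _ => [|x x' y y' h h'|i _]; last exact: hardy_valZ.
  by rewrite -(subrr (0 : hardyType R)) hardy_valB subrr.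
by rewrite hardy_valD h h'.
Qed.

End HardyValues.

(** * Modulus and limits of complex sequences *)

Notation nm := Normc.normc.
Notation cj := conjc.

Section Modulus.
Variable R : realType.
Local Notation C := R[i].
Implicit Types (x y z : C) (r s e : R).

Lemma normE x : `|x| = (nm x)%:C. Proof. by case: x. Qed.

Lemma nmE (a b : R) : nm (a +i* b) = Num.sqrt (a ^+ 2 + b ^+ 2). Proof. by []. Qed.

Lemma nm_i : nm ('i : C) = 1.
Proof. by rewrite nmE expr0n add0r expr1n sqrtr1. Qed.

Lemma nm_ge0 x : 0 <= nm x. Proof. by case: x => a b; exact: sqrtr_ge0. Qed.

Lemma nmD x y : nm (x + y) <= nm x + nm y. Proof. exact: le_normcD. Qed.

Lemma nmN x : nm (- x) = nm x. Proof. exact: normcN. Qed.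

Lemma nmM x y : nm (x * y) = nm x * nm y. Proof. exact: Normc.normcM. Qed.

Lemma nm0 : nm (0 : C) = 0. Proof. exact: Normc.normc0. Qed.

Lemma nm1 : nm (1 : C) = 1. Proof. exact: Normc.normc1. Qed.

Lemma nmB x y : nm (x - y) <= nm x + nm y.
Proof. by rewrite -(nmN y); exact: nmD. Qed.

Lemma nm_sym x y : nm (x - y) = nm (y - x).
Proof. by rewrite -nmN opprB. Qed.

Lemma nm_tri y x z : nm (x - z) <= nm (x - y) + nm (y - z).
Proof. by rewrite (le_trans _ (nmD _ _))// addrA subrK. Qed.

Lemma nm_triB x y : nm x - nm y <= nm (x - y).
Proof. by rewrite lerBlDr (le_trans _ (nmD _ _))// subrK. Qed.

Lemma nm_eq0 x : (nm x == 0) = (x == 0).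
Proof.
by apply/eqP/eqP => [|->]; [exact: Normc.eq0_normc|exact: nm0].
Qed.

Lemma nm_gt0 x : (0 < nm x) = (x != 0).
Proof. by rewrite lt_def nm_ge0 andbT nm_eq0. Qed.

Lemma nm_real r : nm r%:C = `|r|.
Proof. by rewrite /= expr0n addr0 sqrtr_sqr. Qed.

Lemma nmV x : nm x^-1 = (nm x)^-1. Proof. exact: Normc.normcV. Qed.

Lemma nmX x n : nm (x ^+ n) = nm x ^+ n.
Proof. by elim: n => [|n IH]; rewrite ?expr0 ?nm1// !exprS nmM IH. Qed.

Lemma nmJ x : nm (cj x) = nm x.
Proof. by case: x => a b /=; rewrite sqrrN. Qed.

Lemma mulJ x : x * cj x = (nm x ^+ 2)%:C.
Proof. by rewrite -sqr_normc normE rmorphXn. Qed.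

Lemma nm_sum (I : Type) (s : seq I) (P : pred I) (F : I -> C) :
  nm (\sum_(i <- s | P i) F i) <= \sum_(i <- s | P i) nm (F i).
Proof.
elim/big_rec2: _ => [|i y x _ h]; first by rewrite nm0.
by rewrite (le_trans (nmD _ _))// lerD2l.
Qed.

Lemma nm_Re x : `|complex.Re x| <= nm x.
Proof. by rewrite -lecR -normE normc_ge_Re. Qed.

Lemma nm_Im x : `|complex.Im x| <= nm x.
Proof.
case: x => a b /=; rewrite -sqrtr_sqr ler_wsqrtr// lerDr sqr_ge0//.
Qed.

Lemma nm_ReIm x : nm x <= `|complex.Re x| + `|complex.Im x|.
Proof.
case: x => a b; rewrite -(nm_real a) -(nm_real b).
have -> : a +i* b = a%:C + 'i * b%:C by simpc.
by rewrite (le_trans (nmD _ _))// nmM nm_i mul1r.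
Qed.

Lemma nm_sq_sum x y : nm (x * y) <= 2^-1 * (nm x ^+ 2 + nm y ^+ 2).
Proof. rewrite nmM; have := sqr_ge0 (nm x - nm y); nra. Qed.

Lemma nm1_neq0 x : nm x = 1 -> x != 0.
Proof. by move=> h; rewrite -nm_gt0 h. Qed.

Lemma nm1_mulJ x : nm x = 1 -> x * cj x = 1.
Proof. by move=> h; rewrite mulJ h expr1n. Qed.

Lemma nm_lt1_neq x y : nm x * nm y < 1 -> 1 - x * y != 0.
Proof.
rewrite -nmM => h; rewrite subr_eq0; apply/eqP => e.
by move: h; rewrite -e nm1 ltxx.
Qed.

Lemma nm_small0 x : (forall e, 0 < e -> nm x <= e) -> x = 0.
Proof.
move=> h; apply/eqP; rewrite -nm_eq0 eq_le nm_ge0 andbT.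
by apply/ler_addgt0Pl => e e0; rewrite addr0 h.
Qed.

End Modulus.

(* Keeps conversion tests from unfolding square roots. *)
#[global] Opaque Normc.normc.
Arguments conjc : simpl never.

Section Limits.
Variable R : realType.
Local Notation C := R[i].

(** Real epsilons and weak inequalities on the modulus keep the estimates within reach of linear
    arithmetic; [climE] is the bridge to filter convergence. *)
Definition clim (x : nat -> C) (l : C) : Prop :=
  forall e : R, 0 < e -> exists n0, forall n, (n0 <= n)%N -> nm (x n - l) <= e.

Lemma clim_unique x l l' : clim x l -> clim x l' -> l = l'.
Proof.
move=> h h'; apply/eqP; rewrite -subr_eq0; apply/eqP; apply: nm_small0 => e e0.
have e2 : 0 < e / 2 by rewrite divr_gt0.
have [n hn] := h _ e2; have [m hm] := h' _ e2.
have := nm_tri (x (maxn n m)) l l'.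
have := hn _ (leq_maxl n m); have := hm _ (leq_maxr n m).
rewrite (nm_sym l (x _)); lra.
Qed.

Lemma clim_le x l r n0 : clim x l ->
  (forall n, (n0 <= n)%N -> nm (x n) <= r) -> nm l <= r.
Proof.
move=> h hr; apply/ler_addgt0Pl => e e0.
have [n hn] := h _ e0.
have := hn _ (leq_maxl n n0); have := hr _ (leq_maxr n n0).
have := nm_triB l (x (maxn n n0)); rewrite nm_sym; lra.
Qed.

Lemma climD x y l l' : clim x l -> clim y l' -> clim (fun n => x n + y n) (l + l').
Proof.
move=> h h' e e0; have e2 : 0 < e / 2 by rewrite divr_gt0.
have [n hn] := h _ e2; have [m hm] := h' _ e2.
exists (maxn n m) => k; rewrite geq_max => /andP[nk mk].
rewrite [X in nm X](_ : _ = (x k - l) + (y k - l')); last by ring.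
rewrite (le_trans (nmD _ _))//; have := hn _ nk; have := hm _ mk; lra.
Qed.

Lemma climMl c x l : clim x l -> clim (fun n => c * x n) (c * l).
Proof.
move=> h e e0; have c0 : 0 < nm c + 1 by rewrite ltr_wpDl ?nm_ge0.
have [n hn] := h _ (divr_gt0 e0 c0); exists n => k /hn.
rewrite -mulrBr nmM ler_pdivlMr// => h1; rewrite mulrC.
by apply: le_trans h1; rewrite ler_wpM2l ?nm_ge0// lerDl.
Qed.

Lemma climB x y l l' : clim x l -> clim y l' -> clim (fun n => x n - y n) (l - l').
Proof.
move=> h h'; rewrite -mulN1r.
have := climD h (climMl (-1) h'); congr clim; apply/funext => n.
by rewrite mulN1r.
Qed.

Lemma climJ x l : clim x l -> clim (fun n => cj (x n)) (cj l).
Proof.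
by move=> h e /h[n hn]; exists n => k /hn; rewrite -rmorphB nmJ.
Qed.

Lemma clim_cst c : clim (fun=> c) c.
Proof. by move=> e e0; exists 0%N => n _; rewrite subrr nm0 ltW. Qed.

Lemma clim_eq x y l : (forall n, x n = y n) -> clim x l -> clim y l.
Proof. by move=> /funext ->. Qed.

Lemma climE x (l : R[i]^o) : clim x l <-> (x : nat -> R[i]^o) @ \oo --> l.
Proof.
split=> [h|/cvgrPdist_le h e e0].
  apply/cvgrPdist_le => e; case: e => a b; rewrite ltcE/= => /andP[/eqP -> a0].
  have [n hn] := h _ a0; exists n => // k /= nk.
  by rewrite distrC normE lecR hn.
have [] := h e%:C; first by rewrite ltcR.
move=> n _ hn; exists n => k nk; rewrite -lecR -normE distrC; exact: hn.
Qed.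

Lemma real_cauchy_cvg (x : nat -> R) :
  (forall e, 0 < e -> exists n0, forall n, (n0 <= n)%N -> `|x n - x n0| <= e) ->
  cvgn x.
Proof.
move=> h; apply/cauchy_cvgP/cauchy_exP => e e0.
have [n hn] := h _ (divr_gt0 e0 (ltr0n R 2)).
exists (x n); exists n => // k /= nk; rewrite /ball/= distrC.
by apply: le_lt_trans (hn _ nk) _; lra.
Qed.

(* The total limit operator of the complex field: real and imaginary parts are
   taken apart because completeness is only available for the real line. *)
Definition Clim (x : nat -> C) : C :=
  limn (fun n => complex.Re (x n)) +i* limn (fun n => complex.Im (x n)).

Arguments Clim : simpl never.

Lemma ReB (x y : C) : complex.Re (x - y) = complex.Re x - complex.Re y.
Proof. by case: x y => a b []. Qed.

Lemma ImB (x y : C) : complex.Im (x - y) = complex.Im x - complex.Im y.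
Proof. by case: x y => a b []. Qed.

Lemma clim_Clim (x : nat -> C) :
  (forall e, 0 < e -> exists n0, forall n, (n0 <= n)%N -> nm (x n - x n0) <= e) ->
  clim x (Clim x).
Proof.
move=> h.
have cR : cvgn (fun n => complex.Re (x n)).
  apply: real_cauchy_cvg => e /h[n hn]; exists n => k /hn.
  by rewrite -ReB; exact/le_trans/nm_Re.
have cI : cvgn (fun n => complex.Im (x n)).
  apply: real_cauchy_cvg => e /h[n hn]; exists n => k /hn.
  by rewrite -ImB; exact/le_trans/nm_Im.
move=> e e0; have e2 : 0 < e / 2 by rewrite divr_gt0.
have /cvgrPdist_le/(_ _ e2)[n _ hn] := cR.
have /cvgrPdist_le/(_ _ e2)[m _ hm] := cI.
exists (maxn n m) => k; rewrite geq_max => /andP[nk mk].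
rewrite (le_trans (nm_ReIm _))// ReB ImB/=.
have := hn _ nk; have := hm _ mk; rewrite /= distrC (distrC (limn _)); lra.
Qed.

Lemma ClimE x l : clim x l -> Clim x = l.
Proof.
move=> h; have e2 e : 0 < e -> 0 < e / 2 :> R by move=> ?; rewrite divr_gt0.
apply: (@clim_unique x) => //; apply: clim_Clim => e /e2/h[n hn].
exists n => k /hn hk; rewrite (le_trans (nm_tri l _ _))//.
by have := hn _ (leqnn n); rewrite (nm_sym l); lra.
Qed.

Lemma expn_small (q M e : R) : 0 <= q -> q < 1 -> 0 < e ->
  exists n0, forall n, (n0 <= n)%N -> M * q ^+ n <= e.
Proof.
move=> q0 q1 e0.
have [M0|M0] := leP M 0.
  by exists 0%N => n _; rewrite (le_trans _ (ltW e0))// mulr_le0_ge0// exprn_ge0.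
have nq1 : `|q| < 1 by rewrite ger0_norm.
have /cvgrPdist_le/(_ _ (divr_gt0 e0 M0))[n0 _ h] := cvg_expr nq1.
exists n0 => n /h; rewrite /= sub0r normrN ger0_norm ?exprn_ge0//.
by rewrite ler_pdivlMr// mulrC.
Qed.

End Limits.

#[global] Opaque Clim.

(** * Dyadic integrals of uniformly continuous functions *)

Section UniformContinuity.
Variable R : realType.
Local Notation C := R[i].
Variables (T : Type) (d : T -> T -> R) (A : set T).
Implicit Types f g : T -> C.

(** Boundedness is built in because products need it. The set [A] and the distance [d] are
    parameters, so that the same closure rules serve the unit interval, the circle, the torus,
    rectangles and the closed bidisc. *)
Definition ucont f : Prop :=
  (exists M, forall x, A x -> nm (f x) <= M) /\
  forall e : R, 0 < e -> exists2 del : R, 0 < del &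
    forall x y, A x -> A y -> d x y <= del -> nm (f x - f y) <= e.

Lemma ucont_pos f : ucont f -> exists2 M, 0 < M & forall x, A x -> nm (f x) <= M.
Proof.
move=> [[M hM] _]; exists (`|M| + 1); first by rewrite ltr_wpDl.
by move=> x /hM h; rewrite (le_trans h)// (le_trans (ler_norm _))// lerDl.
Qed.

Lemma ucont_cst c : ucont (fun=> c).
Proof.
split; first by exists (nm c).
by move=> e e0; exists 1 => // x y _ _ _; rewrite subrr nm0 ltW.
Qed.

Lemma ucontD f g : ucont f -> ucont g -> ucont (fun x => f x + g x).
Proof.
move=> [[M hM] hf] [[M' hM'] hg]; split.
  exists (M + M') => x Ax; rewrite (le_trans (nmD _ _))// lerD ?hM ?hM'//.
move=> e e0; have e2 : 0 < e / 2 by rewrite divr_gt0.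
have [a a0 ha] := hf _ e2; have [b b0 hb] := hg _ e2.
exists (Num.min a b) => [|x y Ax Ay]; first by rewrite lt_min a0.
rewrite le_min => /andP[xa xb].
rewrite [X in nm X](_ : _ = (f x - f y) + (g x - g y)); last by ring.
by rewrite (le_trans (nmD _ _))//; have := ha _ _ Ax Ay xa; have := hb _ _ Ax Ay xb; lra.
Qed.

Lemma ucontM f g : ucont f -> ucont g -> ucont (fun x => f x * g x).
Proof.
move=> uf ug; have [M M0 hM] := ucont_pos uf; have [M' M0' hM'] := ucont_pos ug.
case: uf ug => _ hf [_ hg]; split.
  by exists (M * M') => x Ax; rewrite nmM ler_pM ?nm_ge0 ?hM ?hM'.
move=> e e0.
have ea : 0 < e / 2 / M' by rewrite !divr_gt0.
have eb : 0 < e / 2 / M by rewrite !divr_gt0.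
have [a a0 ha] := hf _ ea; have [b b0 hb] := hg _ eb.
exists (Num.min a b) => [|x y Ax Ay]; first by rewrite lt_min a0.
rewrite le_min => /andP[xa xb].
rewrite [X in nm X](_ : _ = (f x - f y) * g x + f y * (g x - g y)); last by ring.
rewrite (le_trans (nmD _ _))// !nmM.
have h1 : nm (f x - f y) * nm (g x) <= e / 2 / M' * M'.
  by rewrite ler_pM ?nm_ge0// ?ha ?hM'.
have h2 : nm (f y) * nm (g x - g y) <= M * (e / 2 / M).
  by rewrite ler_pM ?nm_ge0// ?hb ?hM.
rewrite mulfVK ?gt_eqF// in h1; rewrite [M * _]mulrC mulfVK ?gt_eqF// in h2; lra.
Qed.

Lemma ucontJ f : ucont f -> ucont (fun x => cj (f x)).
Proof.
move=> [[M hM] hf]; split; first by exists M => x /hM; rewrite nmJ.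
move=> e /hf[a a0 h]; exists a => // x y Ax Ay dxy.
by rewrite -rmorphB nmJ h.
Qed.

Lemma ucontN f : ucont f -> ucont (fun x => - f x).
Proof.
move=> [[M hM] hf]; split; first by exists M => x /hM; rewrite nmN.
move=> e /hf[a a0 h]; exists a => // x y Ax Ay dxy.
by rewrite -opprD nmN h.
Qed.

Lemma ucontB f g : ucont f -> ucont g -> ucont (fun x => f x - g x).
Proof. by move=> hf hg; exact: (ucontD hf (ucontN hg)). Qed.

Lemma ucontX f n : ucont f -> ucont (fun x => f x ^+ n).
Proof.
move=> hf; elim: n => [|n IH].
  by rewrite (_ : (fun _ => _) = fun=> 1); [exact: ucont_cst|apply/funext].
rewrite (_ : (fun _ => _) = fun x => f x * f x ^+ n); first exact: ucontM.
by apply/funext => x; rewrite exprS.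
Qed.

Lemma ucont_sum n (F : nat -> T -> C) : (forall i, (i < n)%N -> ucont (F i)) ->
  ucont (fun x => \sum_(i < n) F i x).
Proof.
elim: n => [|n IH] h.
  rewrite (_ : (fun _ => _) = fun=> 0); first exact: ucont_cst.
  by apply/funext => x; rewrite big_ord0.
rewrite (_ : (fun _ => _) = fun x => \sum_(i < n) F i x + F n x).
  by apply: ucontD; [apply: IH => i ni; exact/h/ltnW|exact: h].
by apply/funext => x; rewrite big_ord_recr.
Qed.

Lemma ucontV f (c : R) : 0 < c -> (forall x, A x -> c <= nm (f x)) -> ucont f ->
  ucont (fun x => (f x)^-1).
Proof.
move=> c0 hc [_ hf].
have f0 x : A x -> f x != 0 by move=> /hc h; rewrite -nm_gt0 (lt_le_trans c0).
split.
  by exists c^-1 => x Ax; rewrite nmV lef_pV2 ?posrE ?hc// (lt_le_trans c0 (hc _ Ax)).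
move=> e e0; have ec : 0 < e * (c * c) by rewrite !mulr_gt0.
have [a a0 h] := hf _ ec; exists a => // x y Ax Ay dxy.
rewrite [X in nm X](_ : _ = (f y - f x) / (f x * f y)); last first.
  by field; rewrite !f0.
rewrite nmM nmV nmM ler_pdivrMr ?mulr_gt0 ?nm_gt0 ?f0// nm_sym.
rewrite (le_trans (h _ _ Ax Ay dxy))// ler_wpM2l ?(ltW e0)//.
by rewrite ler_pM ?(ltW c0) ?hc.
Qed.

Lemma ucont_eq f g : (forall x, A x -> f x = g x) -> ucont f -> ucont g.
Proof.
move=> fg [[M hM] hf]; split; first by exists M => x Ax; rewrite -fg ?hM.
move=> e /hf[a a0 h]; exists a => // x y Ax Ay dxy.
by rewrite -!fg ?h.
Qed.

Lemma ucont_unif f : (forall e : R, 0 < e -> exists2 g, ucont g &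
    forall x, A x -> nm (f x - g x) <= e) -> ucont f.
Proof.
move=> h; split.
  have [g [[M hM] _] hg] := h _ (@ltr01 R); exists (M + 1) => x Ax.
  by have := nm_triB (f x) (g x); have := hM _ Ax; have := hg _ Ax; lra.
move=> e e0; have e3 : 0 < e / 3 by rewrite divr_gt0.
have [g [_ ug] hg] := h _ e3; have [a a0 ha] := ug _ e3.
exists a => // x y Ax Ay dxy.
rewrite [X in nm X](_ : _ = (f x - g x) + (g x - g y) - (f y - g y)); last by ring.
rewrite (le_trans (nmB _ _))// (le_trans (lerD (nmD _ _) (lexx _)))//.
by have := ha _ _ Ax Ay dxy; have := hg _ Ax; have := hg _ Ay; lra.
Qed.

End UniformContinuity.

(** The changes of variable used later (slices, dilations, the parametrization of the circle, the
    exponential) are all Lipschitz, so this one transfer rule covers them. *)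
Lemma ucont_lip (R : realType) (T U : Type) (dT : T -> T -> R) (dU : U -> U -> R)
    (A : set T) (B : set U) (m : T -> U) (L : R) (f : U -> R[i]) :
  (forall x, A x -> B (m x)) ->
  (forall x y, A x -> A y -> dU (m x) (m y) <= L * dT x y) ->
  (forall x y, A x -> A y -> 0 <= dT x y) ->
  ucont dU B f -> ucont dT A (fun x => f (m x)).
Proof.
move=> mAB mL d0 [[M hM] hf]; split; first by exists M => x /mAB/hM.
move=> e /hf[a a0 h].
have L0 : 0 < `|L| + 1 by rewrite ltr_wpDl.
exists (a / (`|L| + 1)) => [|x y Ax Ay dxy]; first by rewrite divr_gt0.
apply: h; [exact: mAB|exact: mAB|].
rewrite ler_pdivlMr// in dxy; have := mL _ _ Ax Ay; have := d0 _ _ Ax Ay.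
have := ler_norm L; nra.
Qed.

Section Integral.
Variable R : realType.
Local Notation C := R[i].
Implicit Types h : R -> C.

Definition unitI : set R := [set t | 0 <= t <= 1].
Definition dR (x y : R) := `|x - y|.

(* The mean of [h] over the points [j / 2 ^ k], in a form in which the additivity
   under halving of the interval holds by conversion. *)
Fixpoint dsum h k : C :=
  if k is k'.+1 then
    2^-1 * (dsum (fun x => h (x / 2)) k' + dsum (fun x => h ((x + 1) / 2)) k')
  else h 0.

Definition dint h : C := Clim (dsum h).

Arguments dint : simpl never.

Lemma unitI0 : unitI 0. Proof. by rewrite /unitI/= lexx ler01. Qed.

Lemma unitI_half x : unitI x -> unitI (x / 2).
Proof. by rewrite /unitI/= => /andP[? ?]; apply/andP; split; lra. Qed.

Lemma unitI_half1 x : unitI x -> unitI ((x + 1) / 2).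
Proof. by rewrite /unitI/= => /andP[? ?]; apply/andP; split; lra. Qed.
Hint Resolve unitI0 unitI_half unitI_half1 : core.

Lemma halfC : 2^-1 = (2^-1 : R)%:C. Proof. by rewrite fmorphV rmorph_nat. Qed.

Lemma nm_half : nm (2^-1 : C) = 2^-1.
Proof. by rewrite halfC nm_real ger0_norm. Qed.

Lemma eq_dsum h h' k : (forall x, unitI x -> h x = h' x) -> dsum h k = dsum h' k.
Proof.
elim: k h h' => [|k IH] h h' e /=; first exact: e.
by congr (_ * (_ + _)); apply: IH => x /= ux; apply: e; auto.
Qed.

Lemma dsumD h h' k : dsum (fun x => h x + h' x) k = dsum h k + dsum h' k.
Proof. by elim: k h h' => [|k IH] h h' //=; rewrite !IH; ring. Qed.

Lemma dsumZ c h k : dsum (fun x => c * h x) k = c * dsum h k.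
Proof. by elim: k h => [|k IH] h //=; rewrite !IH; ring. Qed.

Lemma dsumJ h k : dsum (fun x => cj (h x)) k = cj (dsum h k).
Proof.
elim: k h => [|k IH] h //=; rewrite !IH rmorphM rmorphD; congr (_ * _).
by rewrite fmorphV rmorph_nat.
Qed.

Lemma dsum_cst c k : dsum (fun=> c) k = c.
Proof. by elim: k => //= k ->; field. Qed.

Lemma dsum_real (g : R -> R) k :
  exists r : R, dsum (fun x => (g x)%:C) k = r%:C.
Proof.
elim: k g => [|k IH] g /=; first by exists (g 0).
have [r ->] := IH (fun x => g (x / 2)).
have [s ->] := IH (fun x => g ((x + 1) / 2)).
by exists (2^-1 * (r + s)); rewrite halfC rmorphM rmorphD.
Qed.

(** The sums are complex by definition, so the real majorant is summed after embedding; by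
    [dsum_real] its real part is then the whole sum. *)
Lemma dsum_le h (g : R -> R) k : (forall x, unitI x -> nm (h x) <= g x) ->
  nm (dsum h k) <= complex.Re (dsum (fun x => (g x)%:C) k).
Proof.
elim: k h g => [|k IH] h g hg /=; first exact: hg.
rewrite nmM nm_half.
have [r er] := dsum_real (fun x => g (x / 2)) k.
have [s es] := dsum_real (fun x => g ((x + 1) / 2)) k.
have := IH (fun x => h (x / 2)) (fun x => g (x / 2)) (fun x ux => hg _ (unitI_half ux)).
have := IH (fun x => h ((x + 1) / 2)) (fun x => g ((x + 1) / 2))
  (fun x ux => hg _ (unitI_half1 ux)).
rewrite er es halfC -rmorphD -rmorphM => h1 h2; rewrite /= in h1 h2 *.
have := nmD (dsum (fun x => h (x / 2)) k) (dsum (fun x => h ((x + 1) / 2)) k); lra.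
Qed.

Lemma dsum_bound h (M : R) k : (forall x, unitI x -> nm (h x) <= M) ->
  nm (dsum h k) <= M.
Proof. by move=> /(@dsum_le h (fun=> M) k); rewrite dsum_cst. Qed.

Lemma dsumB h h' k : dsum (fun x => h x - h' x) k = dsum h k - dsum h' k.
Proof.
rewrite dsumD (_ : (fun x => - h' x) = fun x => -1 * h' x) ?dsumZ ?mulN1r//.
by apply/funext => x; rewrite mulN1r.
Qed.

(** Each refined sample is compared with a level [k] sample at distance at most [2^-1 ^+ k],
    whatever [m] is. In the induction each half is stretched to the unit interval, which turns the
    scale [k.+1] into [k]. *)
Lemma dsum_rate h (e : R) k m :
  (forall x y, unitI x -> unitI y -> `|x - y| <= 2^-1 ^+ k -> nm (h x - h y) <= e) ->
  nm (dsum h (k + m) - dsum h k) <= e.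
Proof.
elim: k h => [|k IH] h he.
  rewrite add0n /= -[h 0](dsum_cst _ m) -dsumB; apply: dsum_bound => x ux.
  by apply: he => //; move: ux; rewrite /unitI/= subr0 expr0 => /andP[? ?]; rewrite ger0_norm.
rewrite addSn /= -mulrBr nmM nm_half.
have st (h' : R -> R) : (forall x, unitI x -> unitI (h' x)) ->
    (forall x y, h' x - h' y = (x - y) / 2) ->
    nm (dsum (fun x => h (h' x)) (k + m) - dsum (fun x => h (h' x)) k) <= e.
  move=> h1 h2; apply: IH => x y ux uy xy; apply: he; [exact: h1|exact: h1|].
  by rewrite h2 normrM [`|2^-1|]ger0_norm// exprS mulrC ler_pM2l.
have := st (fun x => x / 2) unitI_half (fun x y => esym (mulrBl _ _ _)).
have e1 (x y : R) : (x + 1) / 2 - (y + 1) / 2 = (x - y) / 2 by field.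
have := st (fun x => (x + 1) / 2) unitI_half1 e1.
set a := dsum _ _; set b := dsum _ _; set c := dsum _ _; set d := dsum _ _ => h1 h2.
rewrite (_ : c + a - (d + b) = (c - d) + (a - b)); last by ring.
have := nmD (c - d) (a - b); lra.
Qed.

Section Continuous.
Variable h : R -> C.
Hypothesis uh : ucont dR unitI h.

Lemma dint_cvg : clim (dsum h) (dint h).
Proof.
apply: clim_Clim => e /(proj2 uh)[a a0 ha].
have h1 : (2^-1 : R) < 1 by rewrite invf_lt1// ltr1n.
have h0 : 0 <= (2^-1 : R) by [].
have [k hk] := expn_small 1 h0 h1 a0.
exists k => n kn; rewrite -(subnKC kn); apply: dsum_rate => x y ux uy xy.
apply: ha => //; rewrite /dR (le_trans xy)//.
by have := hk _ (leqnn k); rewrite mul1r.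
Qed.

Lemma dint_rate (e : R) k :
  (forall x y, unitI x -> unitI y -> `|x - y| <= 2^-1 ^+ k -> nm (h x - h y) <= e) ->
  nm (dint h - dsum h k) <= e.
Proof.
move=> he; apply: (@clim_le _ (fun n => dsum h n - dsum h k) _ _ k).
  exact: (climB dint_cvg (clim_cst _)).
by move=> n kn; rewrite -(subnKC kn); exact: dsum_rate.
Qed.

Lemma dint_bound (M : R) : (forall x, unitI x -> nm (h x) <= M) -> nm (dint h) <= M.
Proof.
by move=> hM; apply: (clim_le (n0 := 0%N) dint_cvg) => n _; exact: dsum_bound.
Qed.

End Continuous.

Lemma eq_dint h h' : (forall x, unitI x -> h x = h' x) -> dint h = dint h'.
Proof.
by move=> e; rewrite /dint; congr Clim; apply/funext => k; exact: eq_dsum.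
Qed.

Lemma dint_cst c : dint (fun=> c) = c.
Proof. by apply: ClimE; apply: clim_eq (clim_cst c) => n; rewrite dsum_cst. Qed.

Lemma dintD h h' : ucont dR unitI h -> ucont dR unitI h' ->
  dint (fun x => h x + h' x) = dint h + dint h'.
Proof.
move=> u u'; apply: ClimE; apply: clim_eq (climD (dint_cvg u) (dint_cvg u')) => n.
by rewrite dsumD.
Qed.

Lemma dintZ c h : ucont dR unitI h -> dint (fun x => c * h x) = c * dint h.
Proof.
move=> u; apply: ClimE; apply: clim_eq (climMl c (dint_cvg u)) => n.
by rewrite dsumZ.
Qed.

Lemma dintB h h' : ucont dR unitI h -> ucont dR unitI h' ->
  dint (fun x => h x - h' x) = dint h - dint h'.
Proof.
move=> u u'; apply: ClimE; apply: clim_eq (climB (dint_cvg u) (dint_cvg u')) => n.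
by rewrite dsumB.
Qed.

Lemma dintJ h : ucont dR unitI h -> dint (fun x => cj (h x)) = cj (dint h).
Proof.
move=> u; apply: ClimE; apply: clim_eq (climJ (dint_cvg u)) => n.
by rewrite dsumJ.
Qed.

Lemma dint_le h (g : R -> R) : ucont dR unitI h -> ucont dR unitI (fun x => (g x)%:C) ->
  (forall x, unitI x -> nm (h x) <= g x) ->
  nm (dint h) <= complex.Re (dint (fun x => (g x)%:C)).
Proof.
move=> uh ug hg; apply/ler_addgt0Pl => e e0; have e2 : 0 < e / 2 by rewrite divr_gt0.
have [n hn] := dint_cvg uh e2; have [m hm] := dint_cvg ug e2.
have := hn _ (leq_maxl n m); have := hm _ (leq_maxr n m).
set k := maxn n m; have := dsum_le k hg.
have := nm_triB (dint h) (dsum h k); rewrite (nm_sym (dint h)).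
have := nm_Re (dsum (fun x => (g x)%:C) k - dint (fun x => (g x)%:C)).
rewrite ReB; set x := complex.Re _; set y := complex.Re _.
have := ler_norm (x - y); lra.
Qed.

Lemma ucont_half h : ucont dR unitI h ->
  ucont dR unitI (fun x => h (x / 2)) /\ ucont dR unitI (fun x => h ((x + 1) / 2)).
Proof.
move=> u; have st (m : R -> R) : (forall x, unitI x -> unitI (m x)) ->
    (forall x y, m x - m y = (x - y) / 2) -> ucont dR unitI (fun x => h (m x)).
  move=> h1 h2; apply: (ucont_lip (L := 1) h1 _ _ u) => x y _ _; rewrite /dR//.
  by rewrite mul1r h2 normrM [`|2^-1|]ger0_norm// ler_piMr// invf_le1 ?ler1n.
split; apply: st => [x ux|x y]; [exact: unitI_half|by field|exact: unitI_half1|by field].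
Qed.

Lemma dint_half h : ucont dR unitI h ->
  dint h = 2^-1 * (dint (fun x => h (x / 2)) + dint (fun x => h ((x + 1) / 2))).
Proof.
move=> u; have [u1 u2] := ucont_half u; apply: ClimE => e e0.
have [n hn] := climMl 2^-1 (climD (dint_cvg u1) (dint_cvg u2)) e0.
by exists n.+1 => -[//|k] /hn.
Qed.

Lemma ucont_id : ucont dR unitI (fun x => x%:C).
Proof.
split; first by exists 1 => x /andP[x0 x1]; rewrite nm_real ger0_norm.
by move=> e e0; exists e => // x y _ _; rewrite -rmorphB nm_real.
Qed.

(** Self-similarity: halving the interval yields I = (I/2 + (I/2 + 1/2)) / 2 for the integral I, a
    linear equation with the single solution 1/2. *)
Lemma dint_id : dint (fun x => x%:C) = 2^-1.
Proof.
set I := dint _; have uC (c : C) : ucont dR unitI (fun=> c) by exact: ucont_cst.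
have : I = 2^-1 * (2^-1 * I + (2^-1 * I + 2^-1)).
  rewrite {1}/I (dint_half ucont_id) -(dintZ _ ucont_id); congr (_ * (_ + _)).
    by congr dint; apply/funext => x; rewrite halfC -rmorphM mulrC.
  have -> : 2^-1 = dint (fun=> 2^-1 : C) by rewrite dint_cst.
  rewrite -dintD//; last by apply: ucontM => //; exact: ucont_id.
  congr dint; apply/funext => x; rewrite dint_cst halfC -rmorphM -rmorphD.
  by congr (_%:C); ring.
move=> e; have <- : 2 * I - I = 2^-1 by rewrite [X in 2 * X]e; field.
by ring.
Qed.

Lemma dint_lim h l : clim (dsum h) l -> dint h = l. Proof. exact: ClimE. Qed.

Lemma dsum_swap (F : R -> R -> C) k l :
  dsum (fun x => dsum (F x) k) l = dsum (fun y => dsum (F^~ y) l) k.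
Proof.
elim: l F k => [|l IH] F k //=.
rewrite !IH -dsumD -dsumZ; apply: eq_dsum => //.
Qed.

End Integral.

(* Keeps conversion tests from unfolding limits. *)
#[global] Opaque dint.

(** * Means over the circle *)

Section Circle.
Variable R : realType.
Local Notation C := R[i].

Definition ci (t : R) : C := cos t +i* sin t.

Lemma ci0 : ci 0 = 1. Proof. by rewrite /ci cos0 sin0. Qed.

Lemma ciD s t : ci (s + t) = ci s * ci t.
Proof. by rewrite /ci cosD sinD; simpc; rewrite addrC; congr (_ +i* _); ring. Qed.

Lemma nm_ci t : nm (ci t) = 1.
Proof. by rewrite nmE cos2Dsin2 sqrtr1. Qed.

Lemma ci_pi : ci pi = -1.
Proof. by rewrite /ci cospi sinpi; simpc. Qed.

Lemma ci2pi : ci (2 * pi) = 1.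
Proof. by rewrite mulrDl mul1r ciD ci_pi mulrNN mulr1. Qed.

Lemma derivable_lip1 (f f' : R -> R) : (forall x : R, is_derive x 1 f (f' x)) ->
  (forall x, `|f' x| <= 1) -> forall x y, `|f x - f y| <= `|x - y|.
Proof.
move=> df bf; suff st x y : x <= y -> `|f x - f y| <= `|x - y|.
  move=> x y; have [xy|/ltW yx] := leP x y; first exact: st.
  by rewrite distrC (distrC x); exact: st.
move=> xy; have cf : {within `[x, y], continuous f}.
  apply: continuous_subspaceT => z; apply: differentiable_continuous.
  by have [+ _] := df z; rewrite derivable1_diffP.
have [c _] := MVT_segment xy (fun z _ => df z) cf.
rewrite distrC => ->; rewrite normrM (distrC x) ler_piMl//.
Qed.

Lemma ci_lip s t : nm (ci s - ci t) <= 2 * `|s - t|.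
Proof.
rewrite (le_trans (nm_ReIm _))// ReB ImB/= mulrDl mul1r lerD//.
  by apply: (derivable_lip1 (f' := fun x => - sin x)) => x; rewrite ?normrN sin_max.
by apply: (derivable_lip1 (f' := cos)) => x; rewrite cos_max.
Qed.

(** The arc cosine of the real part is an angle of the upper half circle; for a negative imaginary
    part it is reflected, hence the parameter [1 - acos a / (pi * 2)]. *)
Lemma ci_surj (z : C) : nm z = 1 -> exists2 t : R, 0 <= t <= 1 & z = ci (2 * pi * t).
Proof.
case: z => a b h; have h1 := h; rewrite nmE in h1.
have h2 : a ^+ 2 + b ^+ 2 = 1.
  by rewrite -(sqr_sqrtr (addr_ge0 (sqr_ge0 a) (sqr_ge0 b))) h1 expr1n.
have p0 := pi_gt0 R.
have ha : -1 <= a <= 1 by apply/andP; split; have := sqr_ge0 b; nra.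
have sb : Num.sqrt (1 - a ^+ 2) = `|b| by rewrite -h2 addrC addKr sqrtr_sqr.
have /andP[t0 t1] : 0 <= acos a <= pi by rewrite acos_ge0 ?acos_lepi.
have ac : cos (acos a) = a by rewrite acosK// in_itv/=.
have as_ : sin (acos a) = `|b| by rewrite sin_acos.
have e2 (q x : R) : q != 0 -> 2 * q * (x / (q * 2)) = x by move=> ?; field.
have e1 : 2 * pi * (acos a / (pi * 2)) = acos a by rewrite e2// gt_eqF.
have [b0|b0] := leP 0 b.
  exists (acos a / (pi * 2)).
    apply/andP; split; first by rewrite divr_ge0 ?mulr_ge0 ?(ltW p0).
    by rewrite ler_pdivrMr ?mulr_gt0//; move: (acos a) (pi) t0 t1 p0 => x q ? ? ?; lra.
  by rewrite e1 /ci ac as_ ger0_norm.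
exists (1 - acos a / (pi * 2)).
  apply/andP; split; last by rewrite gerBl divr_ge0 ?mulr_ge0 ?(ltW p0).
  by rewrite subr_ge0 ler_pdivrMr ?mulr_gt0//; lra.
by rewrite mulrBr mulr1 e1 ciD ci2pi mul1r /ci cosN sinN ac as_ ltr0_norm// opprK.
Qed.

Definition dC (x y : C) : R := nm (x - y).
Definition d2 (p q : C * C) : R := Num.max (dC p.1 q.1) (dC p.2 q.2).

Definition circ : set C := [set z | nm z = 1].
Definition cdisc : set C := [set z | nm z <= 1].

Lemma circ_cdisc z : circ z -> cdisc z.
Proof. by rewrite /circ /cdisc /= => ->. Qed.

Lemma circ_ci t : circ (ci t). Proof. exact: nm_ci. Qed.

Lemma dC_ge0 x y : 0 <= dC x y. Proof. exact: nm_ge0. Qed.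

Lemma d2_ge0 p q : 0 <= d2 p q. Proof. by rewrite le_max dC_ge0. Qed.

Lemma ucont_sub (T : Type) (d : T -> T -> R) (A B : set T) (f : T -> C) :
  B `<=` A -> ucont d A f -> ucont d B f.
Proof.
move=> BA [[M hM] hf]; split; first by exists M => x /BA/hM.
by move=> e /hf[a a0 h]; exists a => // x y /BA Ax /BA Ay; exact: h.
Qed.

Lemma ucont_idC (A : set C) : A `<=` cdisc -> ucont dC A id.
Proof.
move=> h; split; first by exists 1 => x /h.
by move=> e e0; exists e.
Qed.

Lemma ucont_fst (A B : set C) (f : C -> C) : ucont dC A f ->
  ucont d2 (A `*` B) (fun p => f p.1).
Proof.
apply: (ucont_lip (m := @fst C C) (L := 1)) => [p []//|p q _ _|p q _ _]; last exact: d2_ge0.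
by rewrite mul1r le_max lexx.
Qed.

Lemma ucont_snd (A B : set C) (f : C -> C) : ucont dC B f ->
  ucont d2 (A `*` B) (fun p => f p.2).
Proof.
apply: (ucont_lip (m := @snd C C) (L := 1)) => [p []//|p q _ _|p q _ _]; last exact: d2_ge0.
by rewrite mul1r le_max lexx orbT.
Qed.

Lemma ucont_slice1 (A B : set C) (F : C * C -> C) y : B y ->
  ucont d2 (A `*` B) F -> ucont dC A (fun x => F (x, y)).
Proof.
move=> By; apply: (ucont_lip (m := fun x => (x, y)) (L := 1)) => [p //|p q _ _|p q _ _]; last exact: dC_ge0.
by rewrite mul1r /d2/= ge_max lexx /dC/= subrr nm0 nm_ge0.
Qed.

Lemma ucont_slice2 (A B : set C) (F : C * C -> C) x : A x ->
  ucont d2 (A `*` B) F -> ucont dC B (fun y => F (x, y)).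
Proof.
move=> Ax; apply: (ucont_lip (m := fun y => (x, y)) (L := 1)) => [p //|p q _ _|p q _ _]; last exact: dC_ge0.
by rewrite mul1r /d2/= ge_max lexx andbT /dC/= subrr nm0 nm_ge0.
Qed.

Lemma ucont_swap (A B : set C) (F : C * C -> C) :
  ucont d2 (A `*` B) F -> ucont d2 (B `*` A) (fun p => F (p.2, p.1)).
Proof.
apply: (ucont_lip (m := fun p : C * C => (p.2, p.1)) (L := 1)) => [p []//|p q _ _|p q _ _]; last exact: d2_ge0.
by rewrite mul1r /d2 /= maxC.
Qed.

Definition pt (t : R) : C := ci (2 * pi * t).

Lemma pt_lip s t : dC (pt s) (pt t) <= 4 * pi * dR s t.
Proof.
rewrite (le_trans (ci_lip _ _))// -mulrBr normrM ger0_norm ?mulr_ge0 ?pi_ge0//.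
by rewrite /dR !mulrA (_ : 2 * 2 = 4) //; ring.
Qed.

Lemma ucont_pt f : ucont dC circ f -> ucont (@dR R) (@unitI R) (fun t => f (pt t)).
Proof.
by apply: (ucont_lip (m := pt) (L := 4 * pi)) => [t _|x y _ _|x y _ _];
  [exact: circ_ci|exact: pt_lip|exact: normr_ge0].
Qed.

Definition mean (f : C -> C) : C := dint (fun t => f (pt t)).

Lemma meanE f : mean f = dint (fun t => f (pt t)). Proof. by []. Qed.

Arguments mean : simpl never.
Arguments ci : simpl never.

Section MeanTheory.
Implicit Types f g : C -> C.
Local Notation uc := (ucont dC circ).

Lemma meanD f g : uc f -> uc g -> mean (fun x => f x + g x) = mean f + mean g.
Proof. by move=> /ucont_pt hf /ucont_pt hg; exact: dintD. Qed.

Lemma meanB f g : uc f -> uc g -> mean (fun x => f x - g x) = mean f - mean g.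
Proof. by move=> /ucont_pt hf /ucont_pt hg; exact: dintB. Qed.

Lemma meanZ c f : uc f -> mean (fun x => c * f x) = c * mean f.
Proof. by move=> /ucont_pt hf; exact: dintZ. Qed.

Lemma meanJ f : uc f -> mean (fun x => cj (f x)) = cj (mean f).
Proof. by move=> /ucont_pt hf; exact: dintJ. Qed.

Lemma mean_cst c : mean (fun=> c) = c. Proof. exact: dint_cst. Qed.

Lemma eq_mean f g : (forall x, circ x -> f x = g x) -> mean f = mean g.
Proof. by move=> e; apply: eq_dint => t _; apply: e; exact: circ_ci. Qed.

Lemma mean_bound (M : R) f : uc f -> (forall x, circ x -> nm (f x) <= M) -> nm (mean f) <= M.
Proof.
by move=> /ucont_pt uf hM; apply: dint_bound => // t _; apply: hM; exact: circ_ci.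
Qed.

Lemma mean_le f (g : C -> R) : uc f -> uc (fun x => (g x)%:C) ->
  (forall x, circ x -> nm (f x) <= g x) ->
  nm (mean f) <= complex.Re (mean (fun x => (g x)%:C)).
Proof.
move=> /ucont_pt uf /ucont_pt ug hfg.
by apply: (dint_le (g := fun t => g (pt t)) uf ug) => t _; apply: hfg; exact: circ_ci.
Qed.

Lemma pt_half x : pt (x / 2) = ci (pi * x).
Proof.
have e (q : R) : 2 * q * (x / 2) = q * x by field.
by rewrite /pt e.
Qed.

Lemma pt_half1 x : pt ((x + 1) / 2) = - ci (pi * x).
Proof.
have e (q : R) : 2 * q * ((x + 1) / 2) = q * x + q by field.
by rewrite /pt e ciD ci_pi mulrN1.
Qed.

(** The dyadic sums vanish exactly from some level on. Points of the two half intervals are opposite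
    on the circle: for odd [n] the halves cancel, and for even [n] they agree and reproduce the sum
    for [n./2] one level lower. *)
Lemma meanX n : (0 < n)%N -> mean (fun x => x ^+ n) = 0.
Proof.
move=> n0; apply: dint_lim => e e0.
suff [k0 h] : exists k0, forall k, (k0 <= k)%N -> dsum (fun t => pt t ^+ n) k = 0.
  by exists k0 => k /h ->; rewrite subrr nm0 ltW.
elim/ltn_ind: n n0 => n IH n0.
have [odn|evn] := boolP (odd n).
  exists 1%N => -[//|k] _ /=.
  rewrite (_ : (fun x => pt ((x + 1) / 2) ^+ n) = fun x => -1 * pt (x / 2) ^+ n).
    by rewrite dsumZ mulN1r subrr mulr0.
  by apply/funext => x; rewrite pt_half1 pt_half exprNn -signr_odd odn expr1.
have en : n = n./2.*2 by rewrite -[LHS]odd_double_half (negbTE evn).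
have m0 : (0 < n./2)%N by rewrite -double_gt0 -en.
have mn : (n./2 < n)%N by rewrite [X in (_ < X)%N]en -addnn -{1}[n./2]addn0 ltn_add2l.
have [k0 h] := IH _ mn m0; exists k0.+1 => -[//|k] /h hk /=.
have e1 (q x : R) : q * x + q * x = 2 * q * x by ring.
have e2 x : ci (pi * x) ^+ 2 = pt x by rewrite expr2 -ciD e1.
have -> : (fun x => pt (x / 2) ^+ n) = fun x => pt x ^+ n./2.
  by apply/funext => x; rewrite [in LHS]en -mul2n exprM pt_half e2.
have -> : (fun x => pt ((x + 1) / 2) ^+ n) = fun x => pt x ^+ n./2.
  by apply/funext => x; rewrite [in LHS]en -mul2n exprM pt_half1 sqrrN e2.
by rewrite hk addr0 mulr0.
Qed.

Lemma ucont_mean (A : set C) (F : C * C -> C) : ucont d2 (A `*` circ) F ->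
  ucont dC A (fun x => mean (fun y => F (x, y))).
Proof.
move=> uF; have [[M hM] hF] := uF; split.
  exists M => x Ax; apply: mean_bound => [|y cy]; last exact: hM.
  exact: ucont_slice2 uF.
move=> e /hF[a a0 h]; exists a => // x y Ax Ay xy.
rewrite -meanB; [|exact: ucont_slice2 uF..].
apply: mean_bound => [|z cz]; first by apply: ucontB; exact: ucont_slice2 uF.
by apply: h => //; rewrite /d2/= ge_max xy /dC subrr nm0 ltW.
Qed.

(** Both iterated means are close to the same double dyadic sum, where the exchange [dsum_swap] is
    exact. *)
Lemma mean_swap (F : C * C -> C) : ucont d2 (circ `*` circ) F ->
  mean (fun x => mean (fun y => F (x, y))) = mean (fun y => mean (fun x => F (x, y))).
Proof.
move=> uF; apply/eqP; rewrite -subr_eq0; apply/eqP; apply: nm_small0 => e e0.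
suff st (G : C * C -> C) : ucont d2 (circ `*` circ) G -> exists k0, forall k, (k0 <= k)%N ->
    nm (mean (fun x => mean (fun y => G (x, y))) -
        dsum (fun x => dsum (fun y => G (pt x, pt y)) k) k) <= e / 2.
  have [k hk] := st _ uF; have [l hl] := st _ (ucont_swap uF).
  have := hk _ (leq_maxl k l); have := hl _ (leq_maxr k l); set m := maxn k l.
  rewrite dsum_swap /=; set X := dsum _ m => h1 h2.
  by rewrite (le_trans (nm_tri X _ _))// (nm_sym X); lra.
move=> uG; have [_ /(_ (e / 4))[|a a0 ha]] := uG; first by rewrite divr_gt0.
have h1 : (2^-1 : R) < 1 by rewrite invf_lt1// ltr1n.
have h0 : 0 <= (2^-1 : R) by [].
have [k0 hk] := expn_small (4 * pi) h0 h1 a0; exists k0 => k /hk k0k.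
have cl x y : `|x - y| <= 2^-1 ^+ k -> dC (pt x) (pt y) <= a.
  move=> xy; rewrite (le_trans (pt_lip _ _))// (le_trans _ k0k)//.
  by rewrite ler_wpM2l// mulr_ge0// pi_ge0.
have aa : (fun x : C => dC x x <= a) = xpredT.
  by apply/funext => x; rewrite /dC subrr nm0 ltW.
have := @dint_rate _ (fun t => mean (fun y => G (pt t, y))) _ (e / 4) k.
move=> /(_ (ucont_pt (ucont_mean uG))) h3.
have {}h3 : nm (mean (fun x => mean (fun y => G (x, y))) -
    dsum (fun t => mean (fun y => G (pt t, y))) k) <= e / 4.
  apply: h3 => x y _ _ /cl xy.
  rewrite -meanB; [|exact: ucont_slice2 (circ_ci _) uG..].
  apply: mean_bound => [|z cz].
    by apply: ucontB; exact: ucont_slice2 (circ_ci _) uG.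
  by apply: ha; rewrite /d2/= ?ge_max ?xy ?(congr1 (@^~ z) aa)//=; split=> //; exact: circ_ci.
have h4 : nm (dsum (fun t => mean (fun y => G (pt t, y))) k -
    dsum (fun x => dsum (fun y => G (pt x, pt y)) k) k) <= e / 4.
  rewrite -dsumB; apply: dsum_bound => x _.
  apply: dint_rate; first exact: ucont_pt (ucont_slice2 (circ_ci _) uG).
  move=> s t _ _ /cl st; apply: ha; rewrite /d2/= ?ge_max ?st ?(congr1 (@^~ (pt x)) aa)//=.
  - by split=> //; exact: circ_ci.
  - by split=> //; exact: circ_ci.
set a1 := mean _ in h3 *; set a2 := dsum _ k in h3 h4; set a3 := dsum _ k in h4 *.
by have := nm_tri a2 a1 a3; lra.
Qed.

End MeanTheory.

End Circle.

#[global] Opaque mean.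

(** * Goursat's theorem on rectangles *)

Section Goursat.
Variable R : realType.
Local Notation C := R[i].
Implicit Types (G : R * R -> C) (a b p q s t : R).

Definition dRR (x y : R * R) : R := Num.max `|x.1 - y.1| `|x.2 - y.2|.

Definition rect a b p q : set (R * R) :=
  [set x | a <= x.1 <= a + p /\ b <= x.2 <= b + q].

(** An average over the edge, not an integral: the side lengths, and the factor ['i] of vertical
    edges, are put in by [bdry]. Halving an edge is then an instance of [dint_half]. *)
Definition hedge G s t p := dint (fun x => G (s + p * x, t)).
Definition vedge G s t q := dint (fun y => G (s, t + q * y)).

(* The integral of [G dw] over the boundary of the rectangle, [w = s + i t]. *)
Definition bdry G a b p q : C :=
  p%:C * (hedge G a b p - hedge G a (b + q) p) +
  'i * q%:C * (vedge G (a + p) b q - vedge G a b q).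

Lemma ucont_hedge G a b p q s t p' : 0 <= p' -> a <= s -> s + p' <= a + p ->
  b <= t <= b + q -> ucont dRR (rect a b p q) G ->
  ucont (@dR R) (@unitI R) (fun x => G (s + p' * x, t)).
Proof.
move=> p0 as_ sp tb; apply: (ucont_lip (m := fun x => (s + p' * x, t)) (L := p')).
- by move=> x /andP[x0 x1]; split => //=; apply/andP; split; nra.
- move=> x y _ _; rewrite /dRR /dR/= subrr normr0 opprD addrACA subrr add0r -mulrBr.
  by rewrite normrM (ger0_norm p0) ge_max lexx ?mulr_ge0.
- by move=> x y _ _; exact: normr_ge0.
Qed.

Lemma ucont_vedge G a b p q s t q' : 0 <= q' -> b <= t -> t + q' <= b + q ->
  a <= s <= a + p -> ucont dRR (rect a b p q) G ->
  ucont (@dR R) (@unitI R) (fun x => G (s, t + q' * x)).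
Proof.
move=> p0 as_ sp tb; apply: (ucont_lip (m := fun x => (s, t + q' * x)) (L := q')).
- by move=> x /andP[x0 x1]; split => //=; apply/andP; split; nra.
- move=> x y _ _; rewrite /dRR /dR/= subrr normr0 opprD addrACA subrr add0r -mulrBr.
  by rewrite normrM (ger0_norm p0) ge_max lexx ?mulr_ge0.
- by move=> x y _ _; exact: normr_ge0.
Qed.

Lemma hedge_half G a b p q t : 0 <= p -> b <= t <= b + q ->
  ucont dRR (rect a b p q) G ->
  hedge G a t p = 2^-1 * (hedge G a t (p / 2) + hedge G (a + p / 2) t (p / 2)).
Proof.
move=> p0 tb u; rewrite /hedge (dint_half (ucont_hedge p0 _ _ tb u))//.
congr (_ * (dint _ + dint _)); apply/funext => x; congr (G (_, _)); by field.
Qed.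

Lemma vedge_half G a b p q s : 0 <= q -> a <= s <= a + p ->
  ucont dRR (rect a b p q) G ->
  vedge G s b q = 2^-1 * (vedge G s b (q / 2) + vedge G s (b + q / 2) (q / 2)).
Proof.
move=> p0 tb u; rewrite /vedge (dint_half (ucont_vedge p0 _ _ tb u))//.
congr (_ * (dint _ + dint _)); apply/funext => x; congr (G (_, _)); by field.
Qed.

Lemma bdry_quarters G a b p q : 0 <= p -> 0 <= q -> ucont dRR (rect a b p q) G ->
  bdry G a b p q =
    bdry G a b (p / 2) (q / 2) + bdry G (a + p / 2) b (p / 2) (q / 2) +
    (bdry G a (b + q / 2) (p / 2) (q / 2) +
     bdry G (a + p / 2) (b + q / 2) (p / 2) (q / 2)).
Proof.
move=> p0 q0 u.
have hp : a + p / 2 + p / 2 = a + p by field.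
have hq : b + q / 2 + q / 2 = b + q by field.
have ta : a <= a <= a + p by rewrite lexx lerDl.
have ta' : a <= a + p <= a + p by rewrite lexx lerDl p0.
have tb : b <= b <= b + q by rewrite lexx lerDl.
have tb' : b <= b + q <= b + q by rewrite lexx lerDl q0.
rewrite /bdry hp hq (hedge_half p0 tb u) (hedge_half p0 tb' u).
rewrite (vedge_half q0 ta u) (vedge_half q0 ta' u).
have -> : (p / 2)%:C = 2^-1 * p%:C by rewrite halfC -rmorphM mulrC.
have -> : (q / 2)%:C = 2^-1 * q%:C by rewrite halfC -rmorphM mulrC.
ring.
Qed.

(** The inner edges of the four quarters cancel, so some quarter carries at least a fourth of the
    boundary integral. *)
Lemma bdry_quarter G a b p q : 0 <= p -> 0 <= q -> ucont dRR (rect a b p q) G ->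
  exists x : R * R, [/\ x.1 = a \/ x.1 = a + p / 2, x.2 = b \/ x.2 = b + q / 2 &
    nm (bdry G a b p q) <= 4 * nm (bdry G x.1 x.2 (p / 2) (q / 2))].
Proof.
move=> p0 q0 u; rewrite (bdry_quarters p0 q0 u).
set X := bdry _ a b _ _; set Y := bdry _ (a + _) b _ _.
set Z := bdry _ a (b + _) _ _; set W := bdry _ (a + _) (b + _) _ _.
have h : nm (X + Y + (Z + W)) <= nm X + nm Y + (nm Z + nm W).
  by rewrite (le_trans (nmD _ _))// lerD ?nmD.
pose M := nm (X + Y + (Z + W)).
have [|hX] := leP M (4 * nm X); first by exists (a, b); split => //; left.
have [|hY] := leP M (4 * nm Y).
  by exists (a + p / 2, b); split => //; [right|left].
have [|hZ] := leP M (4 * nm Z).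
  by exists (a, b + q / 2); split => //; [left|right].
exists (a + p / 2, b + q / 2); split; [by right|by right|].
by move: h hX hY hZ; rewrite /M -/W; lra.
Qed.

(** An affine function of s + i t has boundary integral zero ([bL]), so only its distance [e] to [G]
    counts, multiplied by the perimeter. *)
Lemma bdry_near_affine G a b p q (A B : C) s t (e : R) : 0 <= p -> 0 <= q ->
  ucont dRR (rect a b p q) G ->
  (forall x, rect a b p q x ->
     nm (G x - (A + B * ((x.1 - s)%:C + 'i * (x.2 - t)%:C))) <= e) ->
  nm (bdry G a b p q) <= 2 * (p + q) * e.
Proof.
move=> p0 q0 u he.
pose L (x : R * R) := A + B * ((x.1 - s)%:C + 'i * (x.2 - t)%:C).
have uI := @ucont_id R; have uC (c : C) := ucont_cst (@dR R) (@unitI R) c.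
have hL s' t' : hedge L s' t' p = L (s', t') + B * p%:C / 2.
  rewrite /hedge; under [X in dint X]eq_fun => x.
    rewrite (_ : L _ = L (s', t') + (B * p%:C) * x%:C); last first.
      by rewrite /L/= !rmorphB !rmorphD rmorphM; ring.
    over.
  rewrite dintD; [|exact: uC|by apply: ucontM].
  by rewrite dint_cst dintZ// dint_id.
have vL s' t' : vedge L s' t' q = L (s', t') + B * 'i * q%:C / 2.
  rewrite /vedge; under [X in dint X]eq_fun => x.
    rewrite (_ : L _ = L (s', t') + (B * 'i * q%:C) * x%:C); last first.
      by rewrite /L/= !rmorphB !rmorphD rmorphM; ring.
    over.
  rewrite dintD; [|exact: uC|by apply: ucontM].
  by rewrite dint_cst dintZ// dint_id.
have bL : bdry L a b p q = 0.
  by rewrite /bdry !hL !vL /L/= !rmorphB !rmorphD; ring.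
have dE (l : R -> R * R) : (forall x, unitI x -> rect a b p q (l x)) ->
    ucont (@dR R) (@unitI R) (G \o l) -> ucont (@dR R) (@unitI R) (L \o l) ->
    nm (dint (G \o l) - dint (L \o l)) <= e.
  move=> hl uG uL; rewrite -dintB//; apply: dint_bound => [|x ux].
    exact: ucontB.
  exact/he/hl.
have uLh s' t' : ucont (@dR R) (@unitI R) (fun x => L (s' + p * x, t')).
  apply: (@ucont_eq _ _ _ _ (fun x => L (s', t') + (B * p%:C) * x%:C)).
    by move=> x _; rewrite /L/= !rmorphB !rmorphD rmorphM; ring.
  by apply: ucontD => //; apply: ucontM.
have uLv s' t' : ucont (@dR R) (@unitI R) (fun x => L (s', t' + q * x)).
  apply: (@ucont_eq _ _ _ _ (fun x => L (s', t') + (B * 'i * q%:C) * x%:C)).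
    by move=> x _; rewrite /L/= !rmorphB !rmorphD rmorphM; ring.
  by apply: ucontD => //; apply: ucontM.
have h1 t' : b <= t' <= b + q -> nm (hedge G a t' p - hedge L a t' p) <= e.
  move=> tb; apply: (dE (fun x => (a + p * x, t'))) => //.
  - by move=> x /andP[x0 x1]; split => //=; apply/andP; split; nra.
  - exact: (ucont_hedge p0 (lexx _) (lexx _) tb u).
  - exact: uLh.
have h2 s' : a <= s' <= a + p -> nm (vedge G s' b q - vedge L s' b q) <= e.
  move=> sa; apply: (dE (fun x => (s', b + q * x))) => //.
  - by move=> x /andP[x0 x1]; split => //=; apply/andP; split; nra.
  - exact: (ucont_vedge q0 (lexx _) (lexx _) sa u).
  - exact: uLv.
rewrite -[bdry G _ _ _ _]subr0 -bL /bdry.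
have := h1 b; have := h1 (b + q); have := h2 a; have := h2 (a + p).
rewrite !lexx !lerDl p0 q0 /= => /(_ isT) k1 /(_ isT) k2 /(_ isT) k3 /(_ isT) k4.
set X1 := hedge G a b p in k4 *; set X2 := hedge L a b p in k4 *.
set Y1 := hedge G a _ p in k3 *; set Y2 := hedge L a _ p in k3 *.
set Z1 := vedge G a b q in k2 *; set Z2 := vedge L a b q in k2 *.
set W1 := vedge G _ b q in k1 *; set W2 := vedge L _ b q in k1 *.
rewrite [X in nm X](_ : _ = p%:C * ((X1 - X2) - (Y1 - Y2)) +
   'i * q%:C * ((W1 - W2) - (Z1 - Z2))); last by ring.
rewrite (le_trans (nmD _ _))// !nmM !nm_real !ger0_norm//.
rewrite nm_i mul1r.
have m1 : nm (X1 - X2 - (Y1 - Y2)) <= 2 * e.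
  by rewrite (mulr_natl e 2) (le_trans (nmB _ _) (lerD k4 k3)).
have m2 : nm (W1 - W2 - (Z1 - Z2)) <= 2 * e.
  by rewrite (mulr_natl e 2) (le_trans (nmB _ _) (lerD k1 k2)).
have := ler_wpM2l p0 m1; have := ler_wpM2l q0 m2.
rewrite (_ : 2 * (p + q) * e = p * (2 * e) + q * (2 * e)); last by ring.
by move=> ? ?; rewrite lerD.
Qed.

(** The left end points increase and stay below every right end point, so their supremum lies in all
    the intervals. *)
Lemma nested_point (x : nat -> R) p : 0 <= p ->
  (forall k, x k.+1 = x k \/ x k.+1 = x k + p / 2 ^+ k.+1) ->
  exists y, forall k, x k <= y <= x k + p / 2 ^+ k.
Proof.
move=> p0 hx.
have st m k : x k <= x (m + k)%N /\ x (m + k)%N + p / 2 ^+ (m + k) <= x k + p / 2 ^+ k.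
  elim: m => [|m [h1 h2]]; first by rewrite add0n.
  have e : p / 2 ^+ (m + k) = p / 2 ^+ (m + k).+1 + p / 2 ^+ (m + k).+1.
    by rewrite exprS; field; rewrite expf_neq0.
  have e0 : 0 <= p / 2 ^+ (m + k).+1 by rewrite divr_ge0// exprn_ge0.
  by rewrite addSn; have [->|->] := hx (m + k)%N; split; lra.
have le k m : x m <= x k + p / 2 ^+ k.
  have [mk|km] := leqP m k.
    have [h _] := st (k - m)%N m; rewrite subnK// in h.
    by rewrite (le_trans h)// lerDl divr_ge0// exprn_ge0.
  have [_ h] := st (m - k)%N k; rewrite subnK ?(ltnW km)// in h.
  by rewrite (le_trans _ h)// lerDl divr_ge0// exprn_ge0.
exists (sup (range x)) => k; apply/andP; split.
  apply: ub_le_sup; last by exists k.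
  by exists (x k + p / 2 ^+ k) => _ [m _ <-].
by apply: ge_sup; [exists (x k), k|move=> _ [m _ <-]].
Qed.

(** Complex differentiability in the variable s + i t: the linear part is the multiplication by one
    complex number [B], which encodes the Cauchy-Riemann equations. *)
Definition sdiff G (x : R * R) : Prop :=
  exists B : C, forall e, 0 < e -> exists2 del : R, 0 < del & forall y : R * R,
    `|y.1 - x.1| + `|y.2 - x.2| <= del ->
    nm (G y - (G x + B * ((y.1 - x.1)%:C + 'i * (y.2 - x.2)%:C)))
      <= e * (`|y.1 - x.1| + `|y.2 - x.2|).

Lemma goursat G a b p q : 0 <= p -> 0 <= q -> ucont dRR (rect a b p q) G ->
  (forall x, rect a b p q x -> sdiff G x) -> bdry G a b p q = 0.
Proof.
move=> p0 q0 uG dG.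
pose inside (k : nat) (x : R * R) := a <= x.1 /\ x.1 + p / 2 ^+ k <= a + p /\
  b <= x.2 /\ x.2 + q / 2 ^+ k <= b + q.
have half (r : R) k : r / 2 ^+ k / 2 = r / 2 ^+ k.+1.
  by rewrite exprSr; field; rewrite expf_neq0.
have rk (r : R) k : 0 <= r -> 0 <= r / 2 ^+ k by move=> ?; rewrite divr_ge0// exprn_ge0.
have sub k x : inside k x -> rect x.1 x.2 (p / 2 ^+ k) (q / 2 ^+ k) `<=` rect a b p q.
  move=> [h1 [h2 [h3 h4]]] [s t] [] /= /andP[? ?] /andP[? ?].
  by split => /=; apply/andP; split; lra.
(* The bisection step has to be a total function before it can be iterated; the premise [inside] is
   kept as a hypothesis and discharged along the actual sequence by [ins]. *)
have /choice[next hnext] : forall kx : nat * (R * R), exists y : R * R,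
    inside kx.1 kx.2 -> [/\ y.1 = kx.2.1 \/ y.1 = kx.2.1 + p / 2 ^+ kx.1.+1,
      y.2 = kx.2.2 \/ y.2 = kx.2.2 + q / 2 ^+ kx.1.+1 &
    nm (bdry G kx.2.1 kx.2.2 (p / 2 ^+ kx.1) (q / 2 ^+ kx.1)) <=
    4 * nm (bdry G y.1 y.2 (p / 2 ^+ kx.1.+1) (q / 2 ^+ kx.1.+1))].
  move=> [k x] /=; have [ix|nix] := pselect (inside k x); last by exists x.
  have [y hy] := bdry_quarter (rk _ k p0) (rk _ k q0) (ucont_sub (sub _ _ ix) uG).
  by exists y => _; rewrite -!half.
pose fix x_ k : R * R := if k is k'.+1 then next (k', x_ k') else (a, b).
have ins k : inside k (x_ k).
  elim: k => [|k ix] /=; first by rewrite /inside/= expr0 !divr1 !lexx.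
  have [] := hnext (k, x_ k) ix; move: ix => [h1 [h2 [h3 h4]]] /=.
  have pk := rk _ k.+1 p0; have qk := rk _ k.+1 q0; rewrite -!half in pk qk.
  have ep : p / 2 ^+ k = p / 2 ^+ k / 2 + p / 2 ^+ k / 2 by field; rewrite expf_neq0.
  have eq : q / 2 ^+ k = q / 2 ^+ k / 2 + q / 2 ^+ k / 2 by field; rewrite expf_neq0.
  rewrite /inside -!half; set x := next _; set u := p / 2 ^+ k / 2 in pk ep *.
  set v := q / 2 ^+ k / 2 in qk eq *; rewrite ep in h2; rewrite eq in h4.
  clear -h1 h2 h3 h4 pk qk.
  by move=> [->|->] [->|->] _; repeat split; lra.
have st k := hnext (k, x_ k) (ins k).
have [s hs] := @nested_point (fun k => (x_ k).1) p p0 (fun k => let: And3 h _ _ := st k in h).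
have [t ht] := @nested_point (fun k => (x_ k).2) q q0 (fun k => let: And3 _ h _ := st k in h).
have rst : rect a b p q (s, t).
  by have := hs 0%N; have := ht 0%N; rewrite /= expr0 !divr1.
have grow k : nm (bdry G a b p q) <= 4 ^+ k * nm (bdry G (x_ k).1 (x_ k).2 (p / 2 ^+ k) (q / 2 ^+ k)).
  elim: k => [|k IH]; first by rewrite /= !expr0 !divr1 mul1r.
  rewrite (le_trans IH)// exprSr -mulrA ler_wpM2l ?exprn_ge0//.
  by have [_ _ h] := st k.
apply: nm_small0 => e e0.
(* At level [k] the perimeter and the distance to the limit point contribute [2 * (p + q) / 2 ^+ k]
   and [(p + q) / 2 ^+ k], whose product absorbs the growth [4 ^+ k]. The added 1 keeps [M] positive
   for a degenerate rectangle. *)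
pose M := 2 * (p + q) * (p + q) + 1.
have M0 : 0 < M by rewrite ltr_wpDl// !mulr_ge0// addr_ge0.
have [B /(_ (e / M))[|del del0 hdel]] := dG _ rst; first by rewrite divr_gt0.
have h1 : (2^-1 : R) < 1 by rewrite invf_lt1// ltr1n.
have h0 : 0 <= (2^-1 : R) by [].
have [k /(_ _ (leqnn k)) hk] := expn_small (p + q) h0 h1 del0.
rewrite (le_trans (grow k))//.
suff key : forall x, rect (x_ k).1 (x_ k).2 (p / 2 ^+ k) (q / 2 ^+ k) x ->
    nm (G x - (G (s, t) + B * ((x.1 - s)%:C + 'i * (x.2 - t)%:C)))
      <= e / M * ((p + q) / 2 ^+ k).
  have h := bdry_near_affine (rk _ k p0) (rk _ k q0) (ucont_sub (sub _ _ (ins k)) uG) key.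
  set z := 2 ^+ k in h *; have z0 : 0 < z by rewrite exprn_gt0.
  have -> : 4 ^+ k = z * z by rewrite -exprMn; congr (_ ^+ _); rewrite -natrM.
  set Q := nm _ in h *.
  have h' : z * z * Q <= z * z * (2 * (p / z + q / z) * (e / M * ((p + q) / z))).
    by rewrite ler_wpM2l// mulr_ge0// ltW.
  rewrite (le_trans h')// [X in X <= _](_ : _ = (2 * (p + q) * (p + q)) * (e / M)); last first.
    by field; rewrite !gt_eqF.
  rewrite mulrA ler_pdivrMr// mulrC ler_wpM2l ?(ltW e0)// lerDl//.
move=> [s' t'] [] /= /andP[s1 s2] /andP[t1 t2].
have /andP[s3 s4] := hs k; have /andP[t3 t4] := ht k.
have d1 : `|s' - s| <= p / 2 ^+ k by rewrite ler_norml; apply/andP; split; lra.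
have d3 : `|t' - t| <= q / 2 ^+ k by rewrite ler_norml; apply/andP; split; lra.
have d4 : `|s' - s| + `|t' - t| <= (p + q) / 2 ^+ k by rewrite mulrDl lerD.
have := hdel (s', t'); rewrite /= => /(_ _)/le_trans; apply; last first.
  by rewrite ler_wpM2l// ltW// divr_gt0.
by rewrite (le_trans d4)// -exprVn.
Qed.

End Goursat.

(** * Circle means of holomorphic functions *)

Section Cauchy.
Variable R : realType.
Local Notation C := R[i].
Local Notation ucD := (ucont (@dC R) (@cdisc R)).

Definition cdiff (f : C -> C) (z : C) : Prop :=
  exists A : C, forall e : R, 0 < e -> exists2 del : R, 0 < del & forall y,
    nm (y - z) <= del -> nm (f y - (f z + A * (y - z))) <= e * nm (y - z).

Lemma real_diff (f : R -> R) (x l : R) : is_derive x 1 f l ->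
  forall e : R, 0 < e -> exists2 del : R, 0 < del & forall h, `|h| <= del ->
    `|f (x + h) - f x - l * h| <= e * `|h|.
Proof.
move=> [df <-] e e0; have /cvgrPdist_le/(_ _ e0) := df.
rewrite /dnbhs => -[d /= d0 hd]; exists (d / 2); first by rewrite divr_gt0.
move=> h hh; have [->|h0] := eqVneq h 0.
  by rewrite addr0 subrr mulr0 subr0 normr0 mulr0.
have := hd h; rewrite /ball_/= sub0r normrN => /(_ _ h0).
have hd' : `|h| < d by apply: le_lt_trans hh _; lra.
move=> /(_ hd'); rewrite /GRing.scale/= mulr1 (addrC h) => k.
rewrite -(ler_pM2r (_ : 0 < `|h|)) ?normr_gt0// -normrM mulrBl in k.
by rewrite mulrAC mulVf// mul1r distrC in k.
Qed.

Definition cexp (x : R * R) : C := (expR x.1)%:C * ci x.2.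

Lemma cexpD x y : cexp (x.1 + y.1, x.2 + y.2) = cexp x * cexp y.
Proof. by rewrite /cexp/= expRD rmorphM ciD; ring. Qed.

Lemma nm_cexp x : nm (cexp x) = expR x.1.
Proof. by rewrite nmM nm_ci mulr1 nm_real ger0_norm ?expR_ge0. Qed.

Lemma cexp_diff x (e : R) : 0 < e -> exists2 del : R, 0 < del & forall y : R * R,
  `|y.1 - x.1| + `|y.2 - x.2| <= del ->
  nm (cexp y - (cexp x + cexp x * ((y.1 - x.1)%:C + 'i * (y.2 - x.2)%:C)))
    <= e * (`|y.1 - x.1| + `|y.2 - x.2|).
Proof.
move=> e0; have n0 : 0 < expR x.1 := expR_gt0 _.
(* By [cexpD] the estimate reduces to the origin, where the three error terms add up to at most
   [10 * k]; the 20 leaves half of [e] to spare. *)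
pose k := e / (expR x.1 * 20); have k0 : 0 < k by rewrite divr_gt0// mulr_gt0.
have [k1 [k10 k11 kk]] : exists k1 : R, [/\ 0 < k1, k1 <= 1 & k1 <= k].
  by exists (Num.min k 1); split; rewrite ?lt_min ?k0 ?ltr01// ge_min lexx ?orbT.
have [a a0 ha] := real_diff (is_derive_expR 0) k10.
have [b b0 hb] := real_diff (is_derive_sin 0) k10.
have [c c0 hc] := real_diff (is_derive_cos 0) k10.
pose del := Num.min (Num.min a b) (Num.min c k1).
exists del => [|y]; first by rewrite /del !lt_min a0 b0 c0 k10.
set s := y.1 - x.1; set t := y.2 - x.2.
rewrite /del !le_min => /andP[/andP[h1 h2] /andP[h3 h4]].
have s0 := normr_ge0 s; have t0 := normr_ge0 t.
have -> : cexp y = cexp x * cexp (s, t).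
  have e1 : x.1 + s = y.1 by rewrite /s addrC subrK.
  have e2 : x.2 + t = y.2 by rewrite /t addrC subrK.
  by rewrite -cexpD/= e1 e2 -surjective_pairing.
rewrite [X in nm X](_ : _ = cexp x * (cexp (s, t) - (1 + (s%:C + 'i * t%:C)))); last by ring.
rewrite nmM nm_cexp.
have := ha s; rewrite !add0r expR0 mul1r => /(_ _)/= A.
have {}A : `|expR s - 1 - s| <= k1 * `|s| by apply: A; lra.
have := hb t; rewrite !add0r sin0 cos0 mul1r subr0 => /(_ _)/= B.
have {}B : `|sin t - t| <= k1 * `|t| by apply: B; lra.
have := hc t; rewrite !add0r sin0 cos0 oppr0 mul0r subr0 => /(_ _)/= D.
have {}D : `|cos t - 1| <= k1 * `|t| by apply: D; lra.
have E1 : `|expR s - 1| <= 2 * `|s|.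
  have := ler_normD (expR s - 1 - s) s; rewrite subrK; nra.
have -> : cexp (s, t) - (1 + (s%:C + 'i * t%:C)) =
    (expR s - 1 - s)%:C + (expR s - 1)%:C * ((cos t - 1)%:C + 'i * (sin t)%:C)
     + ((cos t - 1)%:C + 'i * (sin t - t)%:C).
  rewrite /cexp/=; have -> : ci t = (cos t)%:C + 'i * (sin t)%:C.
    by rewrite /ci; simpc.
  by rewrite !rmorphB !rmorph1; ring.
have ni := nm_i R.
have N (u v : R) : nm (u%:C + 'i * v%:C) <= `|u| + `|v|.
  by rewrite (le_trans (nmD _ _))// nmM ni mul1r !nm_real.
have C1 : nm ((cos t - 1)%:C + 'i * (sin t)%:C) <= 3 * `|t|.
  rewrite (le_trans (N _ _))//.
  by have := ler_normD (sin t - t) t; rewrite subrK; nra.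
have C2 : nm ((cos t - 1)%:C + 'i * (sin t - t)%:C) <= 2 * k1 * `|t|.
  by rewrite (le_trans (N _ _))//; lra.
have T : nm ((expR s - 1 - s)%:C + (expR s - 1)%:C * ((cos t - 1)%:C + 'i * (sin t)%:C)
     + ((cos t - 1)%:C + 'i * (sin t - t)%:C)) <= 10 * k * (`|s| + `|t|).
  rewrite (le_trans (nmD _ _))// (le_trans (lerD (nmD _ _) (lexx _)))// nmM !nm_real.
  set P := nm _ in C1 *; set Q := nm _ in C2 *.
  have P0 : 0 <= P := nm_ge0 _.
  have E2 : `|expR s - 1| * P <= (2 * `|s|) * (3 * `|t|) by rewrite ler_pM.
  have E3 : `|s| * `|t| <= k1 * `|t| by rewrite ler_wpM2r//; lra.
  have : k1 * `|s| <= k * `|s| by rewrite ler_wpM2r.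
  have : k1 * `|t| <= k * `|t| by rewrite ler_wpM2r.
  have : 0 <= k * `|t| by rewrite mulr_ge0// ltW.
  have : 0 <= k * `|s| by rewrite mulr_ge0// ltW.
  lra.
rewrite (le_trans (ler_wpM2l (ltW n0) T))// !mulrA ler_wpM2r ?addr_ge0//.
rewrite [X in X <= _](_ : _ = e / 2); last by rewrite /k; field; rewrite gt_eqF.
lra.
Qed.

Lemma sdiff_cexp (F : C -> C) x : cdiff F (cexp x) -> sdiff (F \o cexp) x.
Proof.
move=> [A hA]; exists (A * cexp x) => e e0; set w0 := cexp x in hA *.
(* [W] is a local Lipschitz constant of [cexp] at [x]: the modulus of its derivative [w0], plus one
   for the remainder. *)
pose W := nm w0 + 1; have W0 : 0 < W by rewrite ltr_wpDl ?nm_ge0.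
have e1 : 0 < e / (2 * W) by rewrite divr_gt0// mulr_gt0.
have [a a0 ha] := hA _ e1.
pose k := Num.min 1 (e / (2 * (nm A + 1))).
have A0 : 0 < nm A + 1 by rewrite ltr_wpDl ?nm_ge0.
have k0 : 0 < k by rewrite lt_min ltr01/= divr_gt0// mulr_gt0.
have [b b0 hb] := cexp_diff x k0.
exists (Num.min b (a / W)) => [|y]; first by rewrite lt_min b0 divr_gt0.
rewrite le_min ler_pdivlMr// => /andP[/hb h1 h2]; move: h1 h2.
set D := `|_| + _; set L := _%:C + _ => h1 h2.
have D0 : 0 <= D by rewrite addr_ge0.
have ni := nm_i R.
have LD : nm L <= D by rewrite (le_trans (nmD _ _))// nmM ni mul1r !nm_real.
have k1 : k <= 1 by rewrite ge_min lexx.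
have kA : k * (2 * (nm A + 1)) <= e by rewrite -ler_pdivlMr ?mulr_gt0// ge_min lexx orbT.
have wy : nm (cexp y - w0) <= W * D.
  rewrite [X in nm X](_ : _ = (cexp y - (w0 + w0 * L)) + w0 * L); last by ring.
  rewrite (le_trans (nmD _ _))// nmM.
  have : nm w0 * nm L <= nm w0 * D by rewrite ler_wpM2l ?nm_ge0.
  have : k * D <= 1 * D by rewrite ler_wpM2r.
  rewrite /W; lra.
rewrite /= [X in nm X](_ : _ = (F (cexp y) - (F w0 + A * (cexp y - w0)))
   + A * (cexp y - (w0 + w0 * L))); last by rewrite -/w0; ring.
rewrite (le_trans (nmD _ _))// nmM.
have wa : nm (cexp y - w0) <= a by rewrite (le_trans wy)// mulrC.
have := ha _ wa; have : e / (2 * W) * nm (cexp y - w0) <= e / (2 * W) * (W * D).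
  by rewrite ler_wpM2l// ltW.
rewrite [X in _ <= X](_ : _ = e / 2 * D); last by field; rewrite gt_eqF.
have : nm A * nm (cexp y - (w0 + w0 * L)) <= nm A * (k * D) by rewrite ler_wpM2l ?nm_ge0.
have : (k * (2 * (nm A + 1))) * D <= e * D by rewrite ler_wpM2r.
have : 0 <= k * D by rewrite mulr_ge0// ltW.
set u := k * D; rewrite [k * _ * D](_ : _ = 2 * (nm A * u) + 2 * u); last by rewrite /u; ring.
lra.
Qed.

Lemma expR_lip (s t : R) : s <= 0 -> t <= 0 -> `|expR s - expR t| <= `|s - t|.
Proof.
suff st (u v : R) : u <= v -> v <= 0 -> `|expR u - expR v| <= `|u - v|.
  move=> s0 t0; have [h|/ltW h] := leP s t; first exact: st.
  by rewrite distrC (distrC s); exact: st.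
move=> uv v0; rewrite distrC (distrC u) !ger0_norm ?subr_ge0 ?ler_expR//.
have := expR_ge1Dx (u - v); have : expR u = expR v * expR (u - v).
  by rewrite -expRD addrC subrK.
have : expR v <= 1 by rewrite -expR0 ler_expR.
have := expR_gt0 v; nra.
Qed.

Lemma ucont_cexp (F : C -> C) (a b p q : R) : a + p <= 0 -> ucD F ->
  ucont (@dRR R) (rect a b p q) (F \o cexp).
Proof.
move=> ap; apply: (ucont_lip (m := cexp) (L := 3)).
- move=> [s t] [/= /andP[s1 s2] _]; rewrite /cdisc/= nm_cexp/=.
  by rewrite -expR0 ler_expR (le_trans s2).
- move=> [s t] [s' t'] [/= /andP[s1 s2] _] [/= /andP[s1' s2'] _].
  rewrite /dC /dRR /cexp/=.
  rewrite [X in nm X](_ : _ = (expR s - expR s')%:C * ci t + (expR s')%:C * (ci t - ci t')).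
    rewrite (le_trans (nmD _ _))// !nmM nm_ci mulr1 !nm_real.
    have /= h1 : `|expR s - expR s'| <= `|s - s'| by apply: expR_lip; lra.
    have h2 := ci_lip t t'.
    have h3 : `|expR s'| <= 1 by rewrite ger0_norm ?expR_ge0// -expR0 ler_expR; lra.
    have h4 : `|expR s'| * nm (ci t - ci t') <= 1 * (2 * `|t - t'|).
      by rewrite ler_pM ?nm_ge0.
    have : `|s - s'| <= Num.max `|s - s'| `|t - t'| by rewrite le_max lexx.
    have : `|t - t'| <= Num.max `|s - s'| `|t - t'| by rewrite le_max lexx orbT.
    lra.
  by rewrite rmorphB; ring.
- by move=> x y _ _; rewrite le_max normr_ge0.
Qed.

(** Goursat's theorem for [F \o cexp] on [ln r0, ln r1] x [0, 2 pi]: the horizontal edges cancel by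
    periodicity, and the vertical edges are the two circle means. *)
Lemma circle_mean_const (F : C -> C) (r0 r1 : R) : 0 < r0 -> r0 <= r1 -> r1 <= 1 ->
  ucD F -> (forall z, r0 <= nm z <= r1 -> cdiff F z) ->
  mean (fun x => F (r0%:C * x)) = mean (fun x => F (r1%:C * x)).
Proof.
move=> p0 r01 r1le uF dF; have p1 := lt_le_trans p0 r01.
pose a := ln r0; pose p := ln r1 - ln r0.
have ap : a + p = ln r1 by rewrite /a /p addrC subrK.
have ap0 : a + p <= 0 by rewrite ap ln_le0.
have pp : 0 <= p by rewrite subr_ge0 ler_ln.
have q0 : 0 <= 2 * pi :> R by rewrite mulr_ge0// pi_ge0.
have sd x : rect a 0 p (2 * pi) x -> sdiff (F \o cexp) x.
  case: x => s t [] /= /andP[s1 s2] _; apply/sdiff_cexp/dF; rewrite nm_cexp/=.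
  apply/andP; split; first by rewrite -[r0](lnK p0) ler_expR.
  by rewrite -[r1](lnK p1) ler_expR -ap.
have := goursat pp q0 (ucont_cexp 0 (2 * pi) ap0 uF) sd.
rewrite /bdry ap add0r.
have -> : hedge (F \o cexp) a (2 * pi) p = hedge (F \o cexp) a 0 p.
  by rewrite /hedge /cexp /= ci2pi ci0.
have ve r : 0 < r -> vedge (F \o cexp) (ln r) 0 (2 * pi) = mean (fun x => F (r%:C * x)).
  move=> r0'; rewrite /vedge meanE; congr dint; apply/funext => x.
  by rewrite /= /cexp/= lnK// add0r.
rewrite subrr mulr0 add0r !ve// => /eqP.
rewrite mulf_eq0 mulf_eq0 subr_eq0 => /orP[/orP[]|/eqP->//].
  by rewrite eq_complex/= oner_eq0 andbF.
by rewrite eq_complex /= mulf_eq0 pnatr_eq0 (gt_eqF (pi_gt0 R)).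
Qed.

End Cauchy.

(** * Cauchy's formula in the disc *)

Section ComplexDerivative.
Variable R : realType.
Local Notation C := R[i].
Implicit Types (f g : C -> C) (z : C).

Lemma cdiff_cst c z : cdiff (fun=> c) z.
Proof.
exists 0 => e e0; exists 1 => // y _.
by rewrite mul0r addr0 subrr nm0 mulr_ge0 ?nm_ge0// ltW.
Qed.

Lemma cdiff_id z : cdiff (fun x => x) z.
Proof.
exists 1 => e e0; exists 1 => // y _.
have -> : y - (z + 1 * (y - z)) = 0 by ring.
by rewrite nm0 mulr_ge0 ?nm_ge0// ltW.
Qed.

Lemma cdiff_near f g z (d : R) : 0 < d -> (forall y, nm (y - z) <= d -> f y = g y) ->
  cdiff f z -> cdiff g z.
Proof.
move=> d0 fg [A hA]; exists A => e /hA[a a0 ha].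
exists (Num.min a d) => [|y]; first by rewrite lt_min a0.
rewrite le_min => /andP[ya yd]; rewrite -!fg ?ha//.
by rewrite subrr nm0 ltW.
Qed.

Lemma cdiff_cont f z : cdiff f z -> forall e : R, 0 < e ->
  exists2 del : R, 0 < del & forall y, nm (y - z) <= del -> nm (f y - f z) <= e.
Proof.
move=> [A hA] e e0; have [a a0 ha] := hA _ (@ltr01 R).
have A0 : 0 < 1 + nm A by rewrite ltr_wpDr ?nm_ge0.
exists (Num.min a (e / (1 + nm A))) => [|y]; first by rewrite lt_min a0 divr_gt0.
rewrite le_min ler_pdivlMr// => /andP[/ha h1 h2].
rewrite [X in nm X](_ : _ = (f y - (f z + A * (y - z))) + A * (y - z)); last by ring.
rewrite (le_trans (nmD _ _))// nmM.
by rewrite mul1r in h1; have := nm_ge0 (y - z); nra.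
Qed.

Lemma cdiffD f g z : cdiff f z -> cdiff g z -> cdiff (fun x => f x + g x) z.
Proof.
move=> [A hA] [B hB]; exists (A + B) => e e0; have e2 : 0 < e / 2 by rewrite divr_gt0.
have [a a0 ha] := hA _ e2; have [b b0 hb] := hB _ e2.
exists (Num.min a b) => [|y]; first by rewrite lt_min a0.
rewrite le_min => /andP[/ha h1 /hb h2].
rewrite [X in nm X](_ : _ = (f y - (f z + A * (y - z))) +
  (g y - (g z + B * (y - z)))); last by ring.
by rewrite (le_trans (nmD _ _))//; lra.
Qed.

Lemma cdiffM f g z : cdiff f z -> cdiff g z -> cdiff (fun x => f x * g x) z.
Proof.
move=> df dg; have [c c0 hc] := cdiff_cont dg (@ltr01 R).
case: df dg => [A hA] [B hB].
exists (A * g z + f z * B) => e e0.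
pose M := nm A + nm (f z) + nm (g z) + 1.
have A0 := nm_ge0 A; have f0 := nm_ge0 (f z); have g0 := nm_ge0 (g z).
have M0 : 0 < M by rewrite /M; lra.
pose k := e / (4 * M); have k0 : 0 < k by rewrite divr_gt0// mulr_gt0.
have kM : k * M = e / 4 by rewrite /k; field; rewrite gt_eqF.
have [a a0 ha] := hA _ k0; have [b b0 hb] := hB _ k0.
have [l l0 hl] := cdiff_cont (ex_intro _ B hB) k0.
exists (Num.min (Num.min a b) (Num.min c l)) => [|y]; first by rewrite !lt_min a0 b0 c0.
rewrite !le_min => /andP[/andP[/ha h1 /hb h2] /andP[/hc h3 /hl h4]].
rewrite [X in nm X](_ : _ = (f y - (f z + A * (y - z))) * g y +
  f z * (g y - (g z + B * (y - z))) + A * (y - z) * (g y - g z)); last by ring.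
rewrite (le_trans (nmD _ _))// (le_trans (lerD (nmD _ _) (lexx _)))// !nmM.
set h := nm (y - z) in h1 h2 *; have h0 : 0 <= h := nm_ge0 _.
have gy : nm (g y) <= nm (g z) + 1 by have := nm_triB (g y) (g z); lra.
have t1 : nm (f y - (f z + A * (y - z))) * nm (g y) <= k * h * (nm (g z) + 1).
  by rewrite ler_pM ?nm_ge0.
have t2 : nm (f z) * nm (g y - (g z + B * (y - z))) <= nm (f z) * (k * h).
  by rewrite ler_wpM2l.
have t3 : nm A * h * nm (g y - g z) <= nm A * h * k.
  by rewrite ler_wpM2l// mulr_ge0.
have : k * M * h = e / 4 * h by rewrite kM.
have : 0 <= e * h by rewrite mulr_ge0// ltW.
have -> : k * M * h = nm A * h * k + nm (f z) * (k * h) + k * h * (nm (g z) + 1).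
  by rewrite /M; ring.
lra.
Qed.

Lemma cdiffN f z : cdiff f z -> cdiff (fun x => - f x) z.
Proof.
move=> /(cdiffM (cdiff_cst (-1) z)); apply: (cdiff_near (d := 1)) => // y _.
by rewrite mulN1r.
Qed.

Lemma cdiffB f g z : cdiff f z -> cdiff g z -> cdiff (fun x => f x - g x) z.
Proof. by move=> df dg; exact: cdiffD df (cdiffN dg). Qed.

Lemma cdiffX f n z : cdiff f z -> cdiff (fun x => f x ^+ n) z.
Proof.
move=> df; elim: n => [|n IH].
  by apply: (cdiff_near (d := 1)) (cdiff_cst 1 z) => // y _; rewrite expr0.
by apply: (cdiff_near (d := 1)) (cdiffM df IH) => // y _; rewrite exprS.
Qed.

Lemma cdiffV f z : f z != 0 -> cdiff f z -> cdiff (fun x => (f x)^-1) z.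
Proof.
move=> v0 df; pose V := nm (f z); have V0 : 0 < V by rewrite nm_gt0.
have V20 : 0 < V / 2 by rewrite divr_gt0.
have [c c0 hc] := cdiff_cont df V20.
case: (df) => A hA; exists (- A / f z ^+ 2) => e e0.
have e1 : 0 < e * V ^+ 2 / 4 by rewrite divr_gt0// mulr_gt0// exprn_gt0.
have [a a0 ha] := hA _ e1.
have A0 : 0 < nm A + 1 by rewrite ltr_wpDl ?nm_ge0.
have e2 : 0 < e * V ^+ 3 / (4 * (nm A + 1)).
  by rewrite divr_gt0 ?mulr_gt0// exprn_gt0.
have [l l0 hl] := cdiff_cont df e2.
exists (Num.min a (Num.min c l)) => [|y]; first by rewrite !lt_min a0 c0.
rewrite !le_min => /andP[/ha h1 /andP[/hc h2 /hl h3]].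
have hu : V / 2 <= nm (f y) by have := nm_triB (f z) (f y); rewrite nm_sym -/V; lra.
have u0 : f y != 0 by rewrite -nm_gt0; lra.
rewrite [X in nm X](_ : _ = - (f y - (f z + A * (y - z))) / (f y * f z) +
  A * (y - z) * (f y - f z) / (f y * f z ^+ 2)); last by field; rewrite ?u0 ?v0.
rewrite (le_trans (nmD _ _))// !nmM !nmV !nmM nmN -/V -expr2.
set h := nm (y - z) in h1 *; have h0 : 0 <= h := nm_ge0 _.
set r := nm _ in h1 *; set U := nm (f y) in hu *; set w := nm _ in h3 *.
have U0 : 0 < U by lra.
have t1 : r / (U * V) <= e / 2 * h.
  rewrite ler_pdivrMr ?mulr_gt0//.
  have : e * h * V * (V / 2) <= e * h * V * U by rewrite ler_wpM2l// !mulr_ge0// ltW.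
  lra.
have t2 : nm A * h * w / (U * V ^+ 2) <= e / 2 * h.
  rewrite ler_pdivrMr ?mulr_gt0 ?exprn_gt0//.
  have : nm A * h * w <= (nm A + 1) * h * (e * V ^+ 3 / (4 * (nm A + 1))).
    rewrite ler_pM ?nm_ge0 ?mulr_ge0 ?nm_ge0// ler_wpM2r// lerDl//.
  rewrite (_ : (nm A + 1) * h * _ = e * h * V ^+ 2 * (V / 2) / 2); last first.
    by field; rewrite gt_eqF.
  have : e * h * V ^+ 2 * (V / 2) <= e * h * V ^+ 2 * U.
    by rewrite ler_wpM2l// !mulr_ge0// ltW// exprn_gt0.
  rewrite (_ : e / 2 * h * _ = e * h * V ^+ 2 * U / 2); last by ring.
  lra.
lra.
Qed.

End ComplexDerivative.

(** * The Szego kernel and the proof of Cauchy's formula *)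

Section Szego.
Variable R : realType.
Local Notation C := R[i].
Local Notation uc := (ucont (@dC R) (@circ R)).
Local Notation ucD := (ucont (@dC R) (@cdisc R)).

Implicit Types (f h : C -> C) (w z : C).

(** The conjugate of k_z(x). On the unit circle it equals x / (x - z), so that the mean against it
    is the Cauchy integral. *)
Definition szego (z x : C) : C := (1 - z * cj x)^-1.

(* Uniformly continuous functions on the circle without negative frequencies. *)
Definition anT (f : C -> C) : Prop :=
  uc f /\ forall k, (0 < k)%N -> mean (fun x => f x * x ^+ k) = 0.

Lemma circ_neq0 (x : C) : circ x -> x != 0. Proof. exact: nm1_neq0. Qed.

Lemma circ_mulJ (x : C) : circ x -> x * cj x = 1. Proof. exact: nm1_mulJ. Qed.

Lemma uc_id : uc (fun x => x). Proof. by apply: ucont_idC => x; exact: circ_cdisc. Qed.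

Lemma uc_cj : uc (fun x => cj x). Proof. exact: ucontJ uc_id. Qed.

Lemma uc_X n : uc (fun x => x ^+ n). Proof. exact: ucontX uc_id. Qed.

Lemma den_ge (w x : C) : nm x <= 1 -> nm w < 1 -> 1 - nm w <= nm (1 - w * x).
Proof.
move=> x1 w1; have := nm_triB 1 (w * x); rewrite nm1 nmM.
by have := nm_ge0 w; have := nm_ge0 x; nra.
Qed.

Lemma ucont_geo (T : Type) (d : T -> T -> R) (A : set T) (f : T -> C) (w : C) : nm w < 1 ->
  (forall x, A x -> nm (f x) <= 1) -> ucont d A f -> ucont d A (fun x => (1 - w * f x)^-1).
Proof.
move=> w1 f1 uf; apply: (ucontV (c := 1 - nm w)); first by rewrite subr_gt0.
  by move=> x Ax; apply: den_ge => //; exact: f1.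
by apply: ucontB; [exact: ucont_cst|apply: ucontM => //; exact: ucont_cst].
Qed.

Lemma uc_geo (w : C) : nm w < 1 -> uc (fun x => (1 - w * x)^-1).
Proof. by move=> w1; apply: ucont_geo => //; [move=> x ->|exact: uc_id]. Qed.

Lemma uc_szego z : nm z < 1 -> uc (szego z).
Proof. by move=> w1; apply: ucont_geo => //; [move=> x cx; rewrite nmJ cx|exact: uc_cj]. Qed.

Lemma anT_cst c : anT (fun=> c).
Proof.
split=> [|k k0]; first exact: ucont_cst.
by rewrite meanZ ?meanX ?mulr0//; exact: uc_X.
Qed.

Lemma anT_X n : anT (fun x => x ^+ n).
Proof.
split=> [|k k0]; first exact: uc_X.
under [X in mean X]eq_fun do rewrite -exprD.
by rewrite meanX// addn_gt0 k0 orbT.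
Qed.

(** Peeling off one term of the geometric series at a time avoids exchanging a series with a mean:
    every term beyond the first has mean zero, and the remainder after [k] steps is of order
    [nm w ^+ k]. *)
Lemma mean_anT_geo h w : anT h -> nm w < 1 -> mean (fun x => h x * (1 - w * x)^-1) = mean h.
Proof.
move=> [uh hh] w1; pose y m := mean (fun x => h x * x ^+ m * (1 - w * x)^-1).
have uX m : uc (fun x => h x * x ^+ m) by apply: ucontM => //; exact: uc_X.
have uY m : uc (fun x => h x * x ^+ m * (1 - w * x)^-1).
  by apply: ucontM => //; exact: uc_geo.
have st m : y m = mean (fun x => h x * x ^+ m) + w * y m.+1.
  rewrite /y -meanZ// -meanD//; last by apply: ucontM => //; exact: ucont_cst.
  apply: eq_mean => x cx; rewrite exprS; field.
  by apply: nm_lt1_neq; rewrite cx mulr1.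
have bd m : nm (y m) <= (projT1 (cid (proj1 (uY 0%N)))).
  rewrite /y; apply: mean_bound => // x cx; case: cid => M /= hM.
  by have := hM _ cx; rewrite expr0 mulr1 !nmM nmX cx expr1n mulr1.
have y1 k : y 1%N = w ^+ k * y k.+1.
  elim: k => [|k ->]; first by rewrite mul1r.
  by rewrite [in LHS]st hh// add0r exprSr mulrA.
have -> : mean (fun x => h x * (1 - w * x)^-1) = y 0%N.
  by apply: eq_mean => x _; rewrite expr0 mulr1.
rewrite st (_ : y 1%N = 0) ?mulr0 ?addr0.
  by apply: eq_mean => x _; rewrite expr0 mulr1.
apply: nm_small0 => e e0.
have [k /(_ _ (leqnn k)) hk] := expn_small (projT1 (cid (proj1 (uY 0%N)))) (nm_ge0 w) w1 e0.
by rewrite (y1 k) nmM nmX (le_trans _ hk)// mulrC ler_wpM2r ?exprn_ge0 ?nm_ge0.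
Qed.

Lemma mean_geo w : nm w < 1 -> mean (fun x => (1 - w * x)^-1) = 1.
Proof.
move=> w1; have := mean_anT_geo (anT_cst 1) w1; rewrite mean_cst => h.
by rewrite -[RHS]h; apply: eq_mean => x _; rewrite mul1r.
Qed.

Lemma szegoJ z x : cj (szego z x) = (1 - cj z * x)^-1.
Proof. by rewrite /szego fmorphV rmorphB rmorph1 rmorphM /= conjcK. Qed.

Lemma mean_szego z : nm z < 1 -> mean (szego z) = 1.
Proof.
move=> z1; rewrite -[LHS]conjcK -meanJ; last exact: uc_szego.
under [X in mean X]eq_fun do rewrite szegoJ.
by rewrite mean_geo ?rmorph1// nmJ.
Qed.

Lemma mean_anT_szegoJ h z : anT h -> nm z < 1 -> mean (fun x => h x * cj (szego z x)) = mean h.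
Proof.
move=> ah z1; under [X in mean X]eq_fun do rewrite szegoJ.
by rewrite mean_anT_geo// nmJ.
Qed.

Section CauchyFormula.
Variables (f : C -> C) (z A : C).
Hypotheses (uf : ucD f) (df : forall x, nm x < 1 -> cdiff f x) (z1 : nm z < 1).
Hypothesis hA : forall e : R, 0 < e -> exists2 del : R, 0 < del & forall y,
    nm (y - z) <= del -> nm (f y - (f z + A * (y - z))) <= e * nm (y - z).

(** The difference quotient with its singularity removed. The factor [x] makes [H] vanish at 0 and
    turns the quotient into [(f x - f z) * szego z x] on the unit circle, so the formula amounts to
    [H] having mean zero there. *)
Let H (x : C) := if x == z then z * A else x * (f x - f z) * (x - z)^-1.

Let ucH : ucD H.
Proof.
(* Near [z] the continuity of [H] comes from the derivative [A]; away from [z], in [far], it is that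
   of a quotient with denominator bounded below. *)
have dH (e : R) : 0 < e -> exists2 a : R, 0 < a & forall x, nm x <= 1 -> nm (x - z) <= a ->
    nm (H x - z * A) <= e.
  move=> e0; have e2 : 0 < e / 2 by rewrite divr_gt0.
  have [a a0 ha] := hA e2; have A0 : 0 < nm A + 1 by rewrite ltr_wpDl ?nm_ge0.
  exists (Num.min a (e / 2 / (nm A + 1))) => [|x x1]; first by rewrite lt_min a0 divr_gt0.
  rewrite le_min ler_pdivlMr// => /andP[/ha h1 h2].
  rewrite /H; case: eqVneq => [_|xz]; first by rewrite subrr nm0 ltW.
  have xz0 : x - z != 0 by rewrite subr_eq0.
  rewrite [X in nm X](_ : _ = x * ((f x - (f z + A * (x - z))) * (x - z)^-1) +
    (x - z) * A); last by field.
  rewrite (le_trans (nmD _ _))// !nmM nmV.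
  have t : nm (f x - (f z + A * (x - z))) / nm (x - z) <= e / 2.
    by rewrite ler_pdivrMr ?nm_gt0.
  have : nm x * (nm (f x - (f z + A * (x - z))) / nm (x - z)) <= 1 * (e / 2).
    by rewrite ler_pM ?nm_ge0 ?divr_ge0 ?nm_ge0.
  have := nm_ge0 (x - z); have := nm_ge0 A; nra.
have far (b : R) : 0 < b -> ucont (@dC R) [set x | nm x <= 1 /\ b <= nm (x - z)] H.
  move=> b0; apply: (@ucont_eq _ _ _ _ (fun x => x * (f x - f z) * (x - z)^-1)).
    move=> x [_ xb]; rewrite /H; case: eqVneq => // xz.
    by move: xb; rewrite xz subrr nm0 leNgt b0.
  have s : [set x | nm x <= 1 /\ b <= nm (x - z)] `<=` @cdisc R by move=> x [].
  have uI := ucont_idC s; have uC c := ucont_cst (@dC R) [set x | nm x <= 1 /\ b <= nm (x - z)] c.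
  apply: ucontM; first by apply: ucontM => //; apply: ucontB => //; exact: ucont_sub uf.
  by apply: (ucontV (c := b)) => //; [move=> x []|exact: ucontB].
split.
  have [a a0 ha] := dH _ (@ltr01 R); have [[M hM] _] := far _ a0.
  exists (Num.max M (nm (z * A) + 1)) => x x1; rewrite le_max.
  have [/ha|/ltW xa] := leP (nm (x - z)) a; last by rewrite hM.
  move=> /(_ x1); have := nm_triB (H x) (z * A) => h1 h2; apply/orP; right; lra.
move=> e e0; have e2 : 0 < e / 2 by rewrite divr_gt0.
have [a a0 ha] := dH _ e2; have a2 : 0 < a / 2 by rewrite divr_gt0.
have [_ /(_ _ e0)[b b0 hb]] := far _ a2.
exists (Num.min b (a / 2)) => [|x y x1 y1]; first by rewrite lt_min b0.
rewrite le_min => /andP[xb xa].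
have a2a : a / 2 <= a by lra.
have [nx|fx] := leP (nm (x - z)) (a / 2).
  have ny : nm (y - z) <= a.
    by have := nm_tri x y z; rewrite (nm_sym y x); move: xa; rewrite /dC; lra.
  have := ha _ x1 (le_trans nx a2a); have := ha _ y1 ny.
  by have := nm_tri (z * A) (H x) (H y); rewrite (nm_sym (z * A)); lra.
have [ny|fy] := leP (nm (y - z)) (a / 2).
  have nx : nm (x - z) <= a.
    by have := nm_tri y x z; move: xa; rewrite /dC; lra.
  have := ha _ y1 (le_trans ny a2a); have := ha _ x1 nx.
  by have := nm_tri (z * A) (H x) (H y); rewrite (nm_sym (z * A)); lra.
by apply: hb => //; split => //; exact: ltW.
Qed.

Let diffH x : nm x < 1 -> x != z -> cdiff H x.
Proof.
move=> x1 xz; have xz0 : x - z != 0 by rewrite subr_eq0.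
have d0 : 0 < nm (x - z) / 2 by rewrite divr_gt0 ?nm_gt0.
apply: (cdiff_near (f := fun x => x * (f x - f z) * (x - z)^-1) d0).
  move=> y hy; rewrite /H; case: eqVneq => // e.
  by exfalso; move: hy xz0; rewrite e nm_sym -nm_gt0; lra.
apply: cdiffM; first by apply: cdiffM; [exact: cdiff_id|apply: cdiffB; [exact: df|exact: cdiff_cst]].
by apply: cdiffV => //; apply: cdiffB; [exact: cdiff_id|exact: cdiff_cst].
Qed.

Let J (r : R) := mean (fun x => H (r%:C * x)).

Let ucHr (r : R) : 0 <= r <= 1 -> uc (fun x => H (r%:C * x)).
Proof.
move=> /andP[r0 r1]; apply: (ucont_lip (m := fun x => r%:C * x) (L := 1)) ucH.
- by move=> x cx; rewrite /cdisc/= nmM nm_real cx mulr1 ger0_norm.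
- by move=> x y _ _; rewrite /dC -mulrBr nmM nm_real ger0_norm// ler_wpM2r ?nm_ge0.
- by move=> *; exact: nm_ge0.
Qed.

Let J_cont (e : R) : 0 < e -> exists2 a : R, 0 < a & forall r s : R, 0 <= r <= 1 -> 0 <= s <= 1 ->
  `|r - s| <= a -> nm (J r - J s) <= e.
Proof.
move=> e0; have [_ /(_ _ e0)[a a0 ha]] := ucH; exists a => // r s r1 s1 rs.
rewrite /J -meanB; [|exact: ucHr..].
apply: mean_bound => [|x cx]; first by apply: ucontB; exact: ucHr.
apply: ha; rewrite /cdisc /dC /= ?nmM ?nm_real ?cx ?mulr1.
- by case/andP: r1 => ? ?; rewrite ger0_norm.
- by case/andP: s1 => ? ?; rewrite ger0_norm.
- by rewrite -mulrBl nmM cx mulr1 -rmorphB nm_real.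
Qed.

Let J_const (r s : R) : 0 < r -> r <= s -> s < 1 -> (s < nm z \/ nm z < r) -> J r = J s.
Proof.
move=> r0 rs s1 hz; apply: (circle_mean_const r0 rs (ltW s1) ucH).
move=> x /andP[rx xs]; apply: diffH; first exact: le_lt_trans s1.
by apply/eqP => e; exfalso; move: rx xs; rewrite e; case: hz => h; lra.
Qed.

Let J0 : J 0 = 0.
Proof.
rewrite /J; under [X in mean X]eq_fun do rewrite mul0r.
by rewrite mean_cst /H; case: eqVneq => [<-|_]; rewrite ?mul0r.
Qed.

(** [J] is constant on the radii below [nm z] and on those between [nm z] and 1, where the closed
    annuli avoid [z]. Continuity of [J] carries the value 0 from radius 0 across the radius [nm z]
    and up to 1. *)
Let J1 : J 1 = 0.
Proof.
have small (r : R) : 0 <= r < nm z -> J r = 0.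
  move=> /andP[r0 rz]; move: r0; rewrite le_eqVlt => /predU1P[<-|r0]; first exact: J0.
  apply: nm_small0 => e /J_cont[a a0 ha].
  have [s [s0 sr sa]] : exists s : R, [/\ 0 < s, s <= r & s <= a].
    by exists (Num.min r a); rewrite lt_min r0 a0 !ge_min !lexx orbT.
  rewrite -(J_const s0 sr _ (or_introl rz)); last exact: lt_trans z1.
  rewrite -[X in nm X]subr0 -J0 ha// ?lexx ?ler01//.
    by rewrite (ltW s0)/=; move: z1; lra.
  by rewrite subr0 gtr0_norm.
have mid : J (nm z) = 0.
  have := nm_ge0 z; rewrite le_eqVlt => /predU1P[<-|z0]; first exact: J0.
  apply: nm_small0 => e /J_cont[a a0 ha].
  have [s [s0 sr sa]] : exists s : R, [/\ 0 < s, s < nm z & nm z - s <= a].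
    exists (Num.max (nm z / 2) (nm z - a)).
    have : nm z / 2 <= Num.max (nm z / 2) (nm z - a) by rewrite le_max lexx.
    have : nm z - a <= Num.max (nm z / 2) (nm z - a) by rewrite le_max lexx orbT.
    have : Num.max (nm z / 2) (nm z - a) < nm z by rewrite gt_max; apply/andP; split; lra.
    by split; lra.
  rewrite -[X in nm X]subr0 -(small s) ?(ltW s0)//.
  apply: ha; [by rewrite nm_ge0 ltW|by rewrite (ltW s0)/=; move: z1; lra|].
  by rewrite gtr0_norm// subr_gt0.
have large (r : R) : nm z < r < 1 -> J r = 0.
  move=> /andP[zr r1]; apply: nm_small0 => e /J_cont[a a0 ha].
  have [s [zs sr sa]] : exists s : R, [/\ nm z < s, s <= r & s - nm z <= a].
    exists (Num.min r (nm z + a)).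
    by rewrite lt_min ge_min lexx lerBlDl ge_min lexx orbT zr ltrDl.
  have z0 := nm_ge0 z.
  rewrite -(J_const _ sr r1 (or_intror zs)); last by lra.
  rewrite -[X in nm X]subr0 -mid; apply: ha.
  - by apply/andP; split; lra.
  - by rewrite z0 ltW.
  - by rewrite gtr0_norm// subr_gt0.
apply: nm_small0 => e /J_cont[a a0 ha].
have [s [zs s1 sa]] : exists s : R, [/\ nm z < s, s < 1 & 1 - s <= a].
  exists (Num.max ((1 + nm z) / 2) (1 - a)).
  have : (1 + nm z) / 2 <= Num.max ((1 + nm z) / 2) (1 - a) by rewrite le_max lexx.
  have : 1 - a <= Num.max ((1 + nm z) / 2) (1 - a) by rewrite le_max lexx orbT.
  have : Num.max ((1 + nm z) / 2) (1 - a) < 1.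
    by rewrite gt_max; apply/andP; split; move: z1; lra.
  by move: z1; split; lra.
have z0 := nm_ge0 z.
rewrite -[X in nm X]subr0 -(large s) ?zs//; apply: ha; rewrite ?lexx ?ler01//.
  by apply/andP; split; lra.
by rewrite gtr0_norm// subr_gt0.
Qed.

Lemma cauchy_aux : f z = mean (fun x => f x * szego z x).
Proof.
have us := uc_szego z1; have uf' : uc f by apply: ucont_sub uf => x; exact: circ_cdisc.
have E : J 1 = mean (fun x => f x * szego z x - f z * szego z x).
  apply: eq_mean => x cx; rewrite mul1r /H; case: eqVneq => [e|xz].
    by move: z1; rewrite -e cx ltxx.
  have xz0 : x - z != 0 by rewrite subr_eq0.
  have x0 := circ_neq0 cx.
  have -> : szego z x = x * (x - z)^-1; last by ring.
  have e : cj x = x^-1 by apply: (mulfI x0); rewrite circ_mulJ// divff.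
  by rewrite /szego e; field; rewrite xz0 x0.
rewrite J1 meanB ?meanZ ?mean_szego// in E.
- by rewrite mulr1 in E; apply/esym/subr0_eq.
- exact: ucontM.
- by apply: ucontM => //; exact: ucont_cst.
Qed.

End CauchyFormula.

Lemma cauchy_formula f z : ucD f -> (forall x, nm x < 1 -> cdiff f x) -> nm z < 1 ->
  f z = mean (fun x => f x * szego z x).
Proof. by move=> uf df z1; have [A hA] := df _ z1; exact: (cauchy_aux (A := A)). Qed.

End Szego.

(** * The disc algebra and the Poisson kernel *)

Section DiscAlgebra.
Variable R : realType.
Local Notation C := R[i].
Local Notation uc := (ucont (@dC R) (@circ R)).
Local Notation ucD := (ucont (@dC R) (@cdisc R)).
Implicit Types (f h : C -> C) (w z l : C).

(** The Cauchy transform: the value at [z] of the analytic part of the boundary function [f]. *)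
Definition ext f z : C := mean (fun x => f x * szego z x).

(* The disc algebra, characterized by the Cauchy formula. *)
Definition dalg f : Prop := ucD f /\ forall z, nm z < 1 -> f z = ext f z.

Lemma uc_D f : ucD f -> uc f.
Proof. by apply: ucont_sub => x; exact: circ_cdisc. Qed.

Lemma uc_scale f (r : R) : 0 <= r <= 1 -> ucD f -> uc (fun x => f (r%:C * x)).
Proof.
move=> /andP[r0 r1]; apply: (ucont_lip (m := fun x => r%:C * x) (L := 1)).
- by move=> x cx; rewrite /cdisc/= nmM nm_real cx mulr1 ger0_norm.
- by move=> x y _ _; rewrite /dC -mulrBr nmM nm_real ger0_norm// ler_wpM2r ?nm_ge0.
- by move=> *; exact: nm_ge0.
Qed.

Lemma ucont_scale (f : C -> C) (e : R) : ucD f -> 0 < e ->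
  exists2 a : R, 0 < a & forall (r : R) (x : C), 0 <= r <= 1 -> 1 - r <= a -> circ x ->
    nm (f (r%:C * x) - f x) <= e.
Proof.
move=> [_ uf] e0; have [a a0 ha] := uf _ e0; exists a => // r x /andP[r0 r1] ra cx.
apply: ha; rewrite /cdisc /dC/= ?nmM ?nm_real ?cx ?mulr1 ?ger0_norm//.
rewrite -[X in _ - X]mul1r -mulrBl nmM cx mulr1 -(rmorph1 (real_complex R)) -rmorphB.
by rewrite nm_real distrC ger0_norm// subr_ge0.
Qed.

Lemma near1 (a : R) : 0 < a -> exists r : R, [/\ 0 <= r, r < 1 & 1 - r <= a].
Proof.
move=> a0; exists (Num.max 0 (1 - a)).
have h1 : 0 <= Num.max 0 (1 - a) by rewrite le_max lexx.
have h2 : 1 - a <= Num.max 0 (1 - a) by rewrite le_max lexx orbT.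
have h3 : Num.max 0 (1 - a) < 1 by rewrite gt_max ltr01 /=; lra.
by split; lra.
Qed.

(** Cauchy's formula writes a dilate of [f] as a mean of kernels in which only nonnegative powers of
    the circle variable occur; after exchanging the means, each of them kills [x ^+ k]. The dilates
    converge uniformly to [f]. *)
Lemma dalg_anT f : dalg f -> anT f.
Proof.
move=> [uf hf]; split=> [|k k0]; first exact: uc_D.
apply: nm_small0 => e e0; have [a a0 ha] := ucont_scale uf e0.
have [r [r0 r1 ra]] := near1 a0; have r01 : 0 <= r <= 1 by rewrite r0 ltW.
have ur := uc_scale r01 uf.
have nr : nm (r%:C) < 1 by rewrite nm_real ger0_norm.
have uX := @uc_X R k.
pose F (p : C * C) := f p.2 * (1 - r%:C * (p.1 * cj p.2))^-1 * p.1 ^+ k.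
have uF : ucont (@d2 R) (@circ R `*` @circ R) F.
  apply: ucontM; last exact: (@ucont_fst _ _ _ ( fun x => x ^+ k)).
  apply: ucontM; first exact/ucont_snd/uc_D.
  apply: ucont_geo => //; first by move=> p [/= c1 c2]; rewrite nmM nmJ c1 c2 mulr1.
  by apply: ucontM; [exact: (@ucont_fst _ _ _ ( fun x => x)) (@uc_id R)|
                     exact: (@ucont_snd _ _ _ ( fun x => cj x)) (@uc_cj R)].
have E0 : mean (fun x => f (r%:C * x) * x ^+ k) = 0.
  have -> : mean (fun x => f (r%:C * x) * x ^+ k) = mean (fun x => mean (fun y => F (x, y))).
    apply: eq_mean => x cx; rewrite hf; last by rewrite nmM cx mulr1.
    rewrite mulrC -meanZ; last first.
      by apply: ucontM; [exact: uc_D|apply: uc_szego; rewrite nmM cx mulr1].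
    by apply: eq_mean => y cy; rewrite /F/= /szego -[r%:C * x * _]mulrA; ring.
  rewrite mean_swap// -[RHS](mean_cst 0); apply: eq_mean => y cy.
  have ny : nm (r%:C * cj y) < 1 by rewrite nmM nmJ cy mulr1.
  have uy : uc (fun x => x ^+ k * (1 - r%:C * cj y * x)^-1).
    by apply: ucontM => //; exact: uc_geo.
  transitivity (f y * mean (fun x => x ^+ k * (1 - r%:C * cj y * x)^-1)).
    rewrite -meanZ//; apply: eq_mean => x cx; rewrite /F/=.
    by rewrite (_ : r%:C * (x * cj y) = r%:C * cj y * x); ring.
  by rewrite mean_anT_geo ?meanX ?mulr0//; exact: anT_X.
rewrite -[X in nm X]subr0 -E0 -meanB; [|by apply: ucontM => //; exact: uc_D|exact: ucontM].
apply: mean_bound => [|x cx].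
  by apply: ucontB; apply: ucontM => //; exact: uc_D.
by rewrite -mulrBl nmM nmX cx expr1n mulr1 nm_sym ha.
Qed.

(** The Poisson kernel as a normalized square of the Szego kernel, the form that appears in the
    kernel of the commutator and shows positivity. The additive form [pkE] yields its moments. *)
Definition pk l (x : C) : R := (1 - nm l ^+ 2) * nm (szego l x) ^+ 2.

Lemma pk_ge0 l x : nm l < 1 -> 0 <= pk l x.
Proof.
by move=> l1; rewrite mulr_ge0 ?sqr_ge0// subr_ge0 expr_le1 ?nm_ge0// ltW.
Qed.

Lemma pkM l x : (pk l x)%:C = (1 - nm l ^+ 2)%:C * (szego l x * cj (szego l x)).
Proof. by rewrite mulJ -rmorphM. Qed.

Lemma pkE l x : nm l < 1 -> circ x -> (pk l x)%:C = szego l x + cj (szego l x) - 1.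
Proof.
move=> l1 cx; have n1 : 1 - l * cj x != 0 by apply: nm_lt1_neq; rewrite nmJ cx mulr1.
have n2 : 1 - cj l * x != 0 by apply: nm_lt1_neq; rewrite nmJ cx mulr1.
have e : (1 - nm l ^+ 2)%:C = 1 - l * cj l by rewrite mulJ rmorphB rmorph1.
rewrite pkM e szegoJ /szego.
apply: (mulfI (mulf_neq0 n1 n2)).
transitivity (1 - l * cj l); first by field; rewrite n1 n2.
transitivity ((1 - l * cj x) + (1 - cj l * x) - (1 - l * cj x - cj l * x + l * cj l * (x * cj x))).
  by rewrite (circ_mulJ cx); ring.
by field; rewrite n1 n2.
Qed.

Lemma uc_pk l : nm l < 1 -> uc (fun x => (pk l x)%:C).
Proof.
move=> l1; apply: (@ucont_eq _ _ _ _ (fun x => szego l x + cj (szego l x) - 1)).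
  by move=> x cx; rewrite pkE.
have us := uc_szego l1; apply: ucontB; last exact: ucont_cst.
by apply: ucontD => //; exact: ucontJ.
Qed.

Lemma mean_mul_pk f l : uc f -> nm l < 1 -> mean (fun x => f x * (pk l x)%:C) =
  ext f l + mean (fun x => f x * cj (szego l x)) - mean f.
Proof.
move=> uf l1; have us := uc_szego l1; have usJ := ucontJ us.
rewrite /ext -meanD; [|exact: ucontM..].
rewrite -meanB//; last by apply: ucontD; exact: ucontM.
by apply: eq_mean => x cx; rewrite pkE//; ring.
Qed.

Lemma mean_pk l : nm l < 1 -> mean (fun x => (pk l x)%:C) = 1.
Proof.
move=> l1; have := mean_mul_pk (anT_cst 1).1 l1.
rewrite (mean_anT_szegoJ (anT_cst 1) l1) mean_cst addrK.
move=> E; transitivity (mean (fun x => 1 * (pk l x)%:C)).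
  by apply: eq_mean => x _; rewrite mul1r.
by rewrite E /ext -[RHS](mean_szego l1); apply: eq_mean => x _; rewrite mul1r.
Qed.

Lemma mean_anT_pk f l : anT f -> nm l < 1 -> mean (fun x => f x * (pk l x)%:C) = ext f l.
Proof.
by move=> af l1; rewrite (mean_mul_pk (proj1 af) l1) (mean_anT_szegoJ af l1) addrK.
Qed.

Lemma mean_idpk l : nm l < 1 -> mean (fun x => x * (pk l x)%:C) = l.
Proof.
move=> l1; rewrite mean_anT_pk//; last exact: (anT_X _ 1).
have us := uc_szego l1; have uI := @uc_id R.
transitivity (mean (fun x => x + l * szego l x)).
  apply: eq_mean => x cx; rewrite /szego.
  have n1 : 1 - l * cj x != 0 by apply: nm_lt1_neq; rewrite nmJ cx mulr1.
  apply: (mulIf n1); rewrite mulfVK// mulrDl mulfVK//.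
  by rewrite mulrBr mulr1 mulrCA circ_mulJ// mulr1 subrK.
rewrite meanD ?meanZ ?mean_szego//; last by apply: ucontM => //; exact: ucont_cst.
by rewrite (@meanX R 1)// mulr1 add0r.
Qed.

(** On the circle |x - eta|^2 = 2 - 2 Re (x conj(eta)), and the first moment of the Poisson kernel
    at [l] is [l] itself. *)
Lemma mean_dist_pk (eta : C) (r : R) : circ eta -> 0 <= r < 1 ->
  mean (fun x => (nm (x - eta) ^+ 2 * pk (r%:C * eta) x)%:C) = (2 - 2 * r)%:C.
Proof.
move=> ce /andP[r0 r1]; set l := r%:C * eta.
have l1 : nm l < 1 by rewrite nmM ce mulr1 nm_real ger0_norm.
have up := uc_pk l1; have uI := @uc_id R; have uJ := @uc_cj R.
transitivity (mean (fun x => 2 * (pk l x)%:C - cj eta * (x * (pk l x)%:C)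
  - eta * (cj (x * (pk l x)%:C)))).
  apply: eq_mean => x cx; transitivity ((nm (x - eta) ^+ 2)%:C * (pk l x)%:C); first by rewrite rmorphM.
  have -> : cj (x * (pk l x)%:C) = cj x * (pk l x)%:C.
    by rewrite rmorphM; congr (_ * _); exact: conjc_real.
  rewrite -mulJ rmorphB.
  transitivity ((x * cj x + eta * cj eta - x * cj eta - cj x * eta) * (pk l x)%:C); first by ring.
  by rewrite (circ_mulJ cx) (circ_mulJ ce); ring.
have u1 : uc (fun x => x * (pk l x)%:C) by exact: ucontM.
have u2 := ucontJ u1; have uC c : uc (fun=> c) by exact: ucont_cst.
rewrite !meanB ?meanZ ?meanJ ?mean_pk ?mean_idpk//.
- have -> : cj l = r%:C * cj eta by rewrite rmorphM; congr (_ * _); exact: conjc_real.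
  rewrite mulr1 rmorphB rmorphM !rmorph_nat.
  transitivity (2 - 2 * (r%:C * (eta * cj eta))); first by rewrite /l; ring.
  by rewrite (circ_mulJ ce) mulr1.
- exact: ucontM.
- exact: ucontM.
- by apply: ucontB; exact: ucontM.
- exact: ucontM.
Qed.

(* Korovkin's argument: the Poisson kernel is positive, has mean one and second
   moment [2 (1 - r)] around [eta]. *)
Lemma poisson_near f (M e d : R) (eta : C) (r : R) : uc f -> 0 < d -> 0 <= e ->
  (forall x, circ x -> nm (f x) <= M) ->
  (forall x y, circ x -> circ y -> nm (x - y) <= d -> nm (f x - f y) <= e) ->
  circ eta -> 0 <= r < 1 ->
  nm (mean (fun x => f x * (pk (r%:C * eta) x)%:C) - f eta)
    <= e + 2 * M / d ^+ 2 * (2 - 2 * r).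
Proof.
move=> uf d0 e0 hM hd ce r01; set l := r%:C * eta.
have l1 : nm l < 1.
  by case/andP: r01 => r0 r1; rewrite nmM ce mulr1 nm_real ger0_norm.
have up := uc_pk l1; have uC c : uc (fun=> c) by exact: ucont_cst.
have M0 : 0 <= M by rewrite (le_trans (nm_ge0 _) (hM _ ce)).
(* Beyond distance [d] from [eta] the trivial bound [2 * M] is at most [K] times the squared
   distance, so the majorant [g] holds on the whole circle. *)
pose K := 2 * M / d ^+ 2; have K0 : 0 <= K by rewrite divr_ge0 ?sqr_ge0// mulr_ge0.
have ud : uc (fun x => (nm (x - eta) ^+ 2 * pk l x)%:C).
  apply: (@ucont_eq _ _ _ _ (fun x => (x - eta) * cj (x - eta) * (pk l x)%:C)).
    by move=> x _; rewrite mulJ -rmorphM.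
  have u1 : uc (fun x => x - eta) by apply: ucontB => //; exact: uc_id.
  by apply: ucontM => //; apply: ucontM => //; exact: ucontJ.
have -> : f eta = mean (fun x => f eta * (pk l x)%:C) by rewrite meanZ// mean_pk// mulr1.
rewrite -meanB; [|exact: ucontM..].
pose g x := e * pk l x + K * (nm (x - eta) ^+ 2 * pk l x).
have gE x : (g x)%:C = e%:C * (pk l x)%:C + K%:C * (nm (x - eta) ^+ 2 * pk l x)%:C.
  by rewrite rmorphD !rmorphM.
have ug : uc (fun x => (g x)%:C).
  apply: (@ucont_eq _ _ _ _ (fun x => e%:C * (pk l x)%:C + K%:C * (nm (x - eta) ^+ 2 * pk l x)%:C)).
    by move=> x _; rewrite gE.
  by apply: ucontD; exact: ucontM.
have := @mean_le _ (fun x => f x * (pk l x)%:C - f eta * (pk l x)%:C) g.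
have -> : mean (fun x => (g x)%:C) = (e + K * (2 - 2 * r))%:C.
  under [X in mean X]eq_fun do rewrite gE.
  rewrite meanD ?meanZ ?mean_pk ?mean_dist_pk ?mulr1 -?rmorphM -?rmorphD//; exact: ucontM.
apply; [by apply: ucontB; exact: ucontM|exact: ug|move=> x cx].
rewrite -mulrBl nmM nm_real ger0_norm ?pk_ge0//.
have -> : g x = (e + K * nm (x - eta) ^+ 2) * pk l x by rewrite /g; ring.
rewrite ler_wpM2r ?pk_ge0//.
have [xd|/ltW xd] := leP (nm (x - eta)) d.
  by rewrite (le_trans (hd _ _ cx ce xd))// lerDl mulr_ge0// exprn_ge0// nm_ge0.
rewrite (le_trans (nmB _ _))// (le_trans (lerD (hM _ cx) (hM _ ce)))//.
have -> : M + M = 2 * M by ring.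
have : nm (x - eta) ^+ 2 >= d ^+ 2 by rewrite lerXn2r ?nnegrE ?nm_ge0 ?(ltW d0).
rewrite -(ler_pM2l (_ : 0 < d ^- 2)) ?invr_gt0 ?exprn_gt0// mulVf ?gt_eqF ?exprn_gt0// => h.
have : 2 * M * 1 <= 2 * M * (d ^- 2 * nm (x - eta) ^+ 2) by rewrite ler_wpM2l// mulr_ge0.
by rewrite mulr1 mulrA -/K; lra.
Qed.

Lemma poisson_unif f (e : R) : uc f -> 0 < e -> exists2 a : R, 0 < a &
  forall (r : R) (eta : C), 0 <= r < 1 -> 1 - r <= a -> circ eta ->
  nm (mean (fun x => f x * (pk (r%:C * eta) x)%:C) - f eta) <= e.
Proof.
move=> uf e0; have [M M0 hM] := ucont_pos uf.
have e2 : 0 < e / 2 by rewrite divr_gt0.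
have [d d0 hd] := proj2 uf _ e2.
pose K := 2 * M / d ^+ 2; have K0 : 0 < K by apply: divr_gt0; [rewrite mulr_gt0|rewrite exprn_gt0].
exists (e / (4 * K)) => [|r eta r01 ra ce]; first by rewrite divr_gt0// mulr_gt0.
have ra' : (1 - r) * (4 * K) <= e.
  have p4 : 0 < 4 * K by rewrite mulr_gt0.
  by rewrite -ler_pdivlMr.
rewrite (le_trans (poisson_near uf d0 (ltW e2) hM hd ce r01))// -/K; lra.
Qed.

Lemma ext_unif f (e : R) : anT f -> 0 < e -> exists2 a : R, 0 < a &
  forall (r : R) (eta : C), 0 <= r < 1 -> 1 - r <= a -> circ eta ->
  nm (ext f (r%:C * eta) - f eta) <= e.
Proof.
move=> af e0; have [a a0 ha] := poisson_unif (proj1 af) e0.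
exists a => // r eta r01 ra ce; rewrite -mean_anT_pk//; first exact: ha.
by case/andP: r01 => r0 r1; rewrite nmM ce mulr1 nm_real ger0_norm.
Qed.

Lemma ucont_szego2 (r : R) : 0 <= r < 1 ->
  ucont (@d2 R) (@circ R `*` @circ R) (fun p => szego (r%:C * p.1) p.2).
Proof.
move=> /andP[r0 r1]; have nr : nm (r%:C) < 1 by rewrite nm_real ger0_norm.
apply: (@ucont_eq _ _ _ _ (fun p : C * C => (1 - r%:C * (p.1 * cj p.2))^-1)).
  by move=> p _; rewrite /szego mulrA.
apply: ucont_geo => //; first by move=> p [/= c1 c2]; rewrite nmM nmJ c1 c2 mulr1.
by apply: ucontM; [exact: (@ucont_fst _ _ _ ( fun x => x)) (@uc_id R)|
                   exact: (@ucont_snd _ _ _ ( fun x => cj x)) (@uc_cj R)].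
Qed.

Lemma ucont_ext2 f (r : R) : 0 <= r < 1 -> uc f ->
  ucont (@d2 R) (@circ R `*` @circ R) (fun p => f p.2 * szego (r%:C * p.1) p.2).
Proof. by move=> r01 uf; apply: ucontM; [exact: ucont_snd|exact: ucont_szego2]. Qed.

Lemma uc_ext f (r : R) : 0 <= r < 1 -> uc f -> uc (fun x => ext f (r%:C * x)).
Proof. by move=> r01 uf; exact: (ucont_mean (ucont_ext2 r01 uf)). Qed.

(* The dilates of the extension of any function have no negative frequencies. *)
Lemma mean_ext_mul f h (r : R) : 0 <= r < 1 -> uc f -> anT h ->
  mean (fun x => ext f (r%:C * x) * h x) = mean f * mean h.
Proof.
move=> r01 uf ah; have /andP[r0 r1] := r01; have uh := proj1 ah.
have nr : nm (r%:C) < 1 by rewrite nm_real ger0_norm.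
pose F (p : C * C) := f p.2 * szego (r%:C * p.1) p.2 * h p.1.
have uF : ucont (@d2 R) (@circ R `*` @circ R) F.
  by apply: ucontM; [exact: ucont_ext2|exact: ucont_fst].
transitivity (mean (fun x => mean (fun y => F (x, y)))).
  apply: eq_mean => x cx; rewrite mulrC -meanZ.
    by apply: eq_mean => y cy; rewrite /F /=; ring.
  exact: (ucont_slice2 cx (ucont_ext2 r01 uf)).
rewrite mean_swap// mulrC -meanZ//; apply: eq_mean => y cy.
have ny : nm (r%:C * cj y) < 1 by rewrite nmM nmJ cy mulr1.
rewrite -(mean_anT_geo ah ny) mulrC -meanZ; last by apply: ucontM => //; exact: uc_geo.
by apply: eq_mean => x cx; rewrite /F /szego/= mulrAC -mulrA; congr (_ * (_ * _^-1)); ring.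
Qed.

(** For dilates of the extension of [f] this is [mean_ext_mul], and they converge to [f] uniformly
    on the circle by [ext_unif]. *)
Lemma mean_anTM f h : anT f -> anT h -> mean (fun x => f x * h x) = mean f * mean h.
Proof.
move=> af ah; have uf := proj1 af; have uh := proj1 ah.
apply/eqP; rewrite -subr_eq0; apply/eqP; apply: nm_small0 => e e0.
have [M M0 hM] := ucont_pos uh.
have [a a0 ha] := ext_unif af (divr_gt0 e0 M0).
have [r [r0 r1 ra]] := near1 a0; have r01 : 0 <= r < 1 by rewrite r0.
have ur := uc_ext r01 uf.
rewrite -(mean_ext_mul r01 uf ah) -meanB; [|exact: ucontM..].
apply: mean_bound => [|x cx]; first by apply: ucontB; exact: ucontM.
rewrite -mulrBl nmM nm_sym.
have : nm (ext f (r%:C * x) - f x) * nm (h x) <= e / M * M.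
  by rewrite ler_pM ?nm_ge0 ?hM ?ha.
by rewrite mulfVK// gt_eqF.
Qed.

Lemma anT_mulX f n : anT f -> anT (fun x => f x * x ^+ n).
Proof.
move=> [uf hf]; split=> [|k k0]; first by apply: ucontM => //; exact: uc_X.
by rewrite -[RHS](hf (n + k)%N) ?addn_gt0 ?k0 ?orbT//; apply: eq_mean => x _; rewrite exprD mulrA.
Qed.

Lemma anTM f h : anT f -> anT h -> anT (fun x => f x * h x).
Proof.
move=> af ah; split=> [|k k0]; first by apply: ucontM; [exact: (proj1 af)|exact: (proj1 ah)].
under [X in mean X]eq_fun do rewrite -mulrA.
rewrite mean_anTM//; last exact: anT_mulX.
by rewrite (proj2 ah _ k0) mulr0.
Qed.

Lemma anTD f h : anT f -> anT h -> anT (fun x => f x + h x).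
Proof.
move=> [uf hf] [uh hh]; split=> [|k k0]; first exact: ucontD.
under [X in mean X]eq_fun do rewrite mulrDl.
have uX := @uc_X R k.
by rewrite meanD ?hf ?hh ?addr0//; exact: ucontM.
Qed.

Lemma anTZ c f : anT f -> anT (fun x => c * f x).
Proof. by move=> af; apply: anTM => //; exact: anT_cst. Qed.

Lemma eq_anT f h : (forall x, circ x -> f x = h x) -> anT f -> anT h.
Proof.
move=> e [uf hf]; split=> [|k k0]; first exact: ucont_eq uf.
by rewrite -[RHS](hf k k0); apply: eq_mean => x cx; rewrite e.
Qed.

(** On the circle x szego(z, x) = x + z szego(z, x); the first summand contributes a mean that
    vanishes, the second one a factor [z]. *)
Lemma ext_mulX f z k : anT f -> nm z < 1 ->
  mean (fun x => f x * szego z x * x ^+ k) = z ^+ k * ext f z.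
Proof.
move=> [uf hf] z1; have us := uc_szego z1; elim: k => [|k IH].
  by rewrite mul1r; apply: eq_mean => x _; rewrite expr0 mulr1.
have uX n := @uc_X R n.
have u1 : uc (fun x => f x * szego z x * x ^+ k) by apply: ucontM => //; exact: ucontM.
have u2 : uc (fun x => f x * x ^+ k.+1) by exact: ucontM.
rewrite exprS -mulrA -IH -meanZ//.
rewrite -[RHS]add0r -(hf k.+1)// -meanD//; last by apply: ucontM => //; exact: ucont_cst.
apply: eq_mean => x cx; rewrite /szego.
have n1 : 1 - z * cj x != 0 by apply: nm_lt1_neq; rewrite nmJ cx mulr1.
apply: (mulIf n1); rewrite exprS.
transitivity (f x * (x * x ^+ k)); first by field.
transitivity (f x * (x * x ^+ k) * (1 - z * cj x) + z * f x * x ^+ k * (x * cj x)).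
  by ring.
rewrite (circ_mulJ cx).
transitivity (f x * (x * x ^+ k) * (1 - z * cj x) + z * f x * x ^+ k); first by ring.
by field.
Qed.

(* [(f - ext f z) * szego z] has no negative frequencies and mean zero, so that
   [mean_anTM] applies to its product with [h]. *)
Lemma ext_mul f h z : anT f -> anT h -> nm z < 1 ->
  ext (fun x => f x * h x) z = ext f z * ext h z.
Proof.
move=> af ah z1; have uf := proj1 af; have uh := proj1 ah; have us := uc_szego z1.
pose q x := (f x - ext f z) * szego z x.
have uq : uc q by apply: ucontM => //; apply: ucontB => //; exact: ucont_cst.
have hq k : mean (fun x => q x * x ^+ k) = 0.
  have uX := @uc_X R k.
  have h2 := ext_mulX k af z1.
  have h1 : mean (fun x => szego z x * x ^+ k) = z ^+ k.
    have e1 : ext (fun=> 1) z = 1.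
      by rewrite -[RHS](mean_szego z1); apply: eq_mean => x _; rewrite mul1r.
    have := ext_mulX k (anT_cst 1) z1; rewrite e1 mulr1 => hk.
    by rewrite -[RHS]hk; apply: eq_mean => x _; rewrite mul1r.
  have : mean (fun x => q x * x ^+ k) = mean (fun x => f x * szego z x * x ^+ k) -
      ext f z * mean (fun x => szego z x * x ^+ k).
    have u1 : uc (fun x => szego z x * x ^+ k) by exact: ucontM.
    have u2 : uc (fun x => f x * szego z x * x ^+ k) by apply: ucontM => //; exact: ucontM.
    rewrite -meanZ// -meanB//; last by apply: ucontM => //; exact: ucont_cst.
    by apply: eq_mean => x _; rewrite /q; ring.
  by rewrite h1 h2 => ->; ring.
have aq : anT q by split.
have q0 : mean q = 0 by rewrite -(hq 0%N); apply: eq_mean => x _; rewrite expr0 mulr1.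
have := mean_anTM ah aq; rewrite q0 mulr0 => E.
have us2 : uc (fun x => h x * szego z x) by exact: ucontM.
apply/eqP; rewrite -subr_eq0; apply/eqP; rewrite -[RHS]E /ext -[X in _ - X]meanZ//.
rewrite -meanB; [|by apply: ucontM => //; exact: ucontM|by apply: ucontM => //; exact: ucont_cst].
by apply: eq_mean => x _; rewrite /q /ext; ring.
Qed.

Lemma anT_lim f : (forall e : R, 0 < e -> exists2 h, anT h &
  forall x, circ x -> nm (f x - h x) <= e) -> anT f.
Proof.
move=> hf; have uf : uc f by apply: ucont_unif => e /hf[h [uh _] hh]; exists h.
split=> // k k0; apply: nm_small0 => e /hf[h [uh ah] hh].
have uX := @uc_X R k.
rewrite -[X in nm X]subr0 -(ah k k0) -meanB; [|exact: ucontM..].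
apply: mean_bound => [|x cx]; first by apply: ucontB; exact: ucontM.
by rewrite -mulrBl nmM nmX cx expr1n mulr1 hh.
Qed.

Lemma anTX f n : anT f -> anT (fun x => f x ^+ n).
Proof.
move=> af; elim: n => [|n IH].
  by apply: eq_anT (anT_cst 1) => x _; rewrite expr0.
by apply: eq_anT (anTM af IH) => x _; rewrite exprS.
Qed.

Lemma anT_sum n (F : nat -> C -> C) : (forall i, anT (F i)) ->
  anT (fun x => \sum_(i < n) F i x).
Proof.
move=> aF; elim: n => [|n IH].
  by apply: eq_anT (anT_cst 0) => x _; rewrite big_ord0.
by apply: eq_anT (anTD IH (aF n)) => x _; rewrite big_ord_recr.
Qed.

(** Frequencies of both signs are excluded: conjugating the Cauchy transform of [f] gives the mean
    of [cj (f x)] against a conjugated kernel, which by [mean_anT_szegoJ] sees only the mean. *)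
Lemma anT_const f : anT f -> anT (fun x => cj (f x)) ->
  forall x, circ x -> f x = mean f.
Proof.
move=> af aJ x cx; apply/eqP; rewrite -subr_eq0; apply/eqP; apply: nm_small0 => e e0.
have [a a0 ha] := ext_unif af e0; have [r [r0 r1 ra]] := near1 a0.
have := ha r x; rewrite r0 r1 => /(_ isT ra cx).
have n1 : nm (r%:C * x) < 1 by rewrite nmM cx mulr1 nm_real ger0_norm.
suff -> : ext f (r%:C * x) = mean f by rewrite nm_sym.
rewrite -[RHS]conjcK -meanJ; last exact: (proj1 af).
rewrite -(mean_anT_szegoJ aJ n1) -meanJ; last first.
  by apply: ucontM; [exact: (proj1 aJ)|exact/ucontJ/uc_szego].
by apply: eq_mean => y _; rewrite -rmorphM conjcK.
Qed.

(* The conjugate of [f] is [1 / f], a uniform limit of polynomials in [f]. *)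
Lemma anT_near_const f (q : R) : anT f -> q < 1 -> (forall x, circ x -> nm (f x) = 1) ->
  (forall x, circ x -> nm (1 - f x) <= q) -> forall x, circ x -> f x = mean f.
Proof.
move=> af q1 f1 fq; apply: anT_const => //; apply: anT_lim => e e0.
have q0 : 0 <= q by rewrite (le_trans (nm_ge0 _) (fq 1 _))// /circ/= nm1.
have [n /(_ _ (leqnn n)) hn] := expn_small 1 q0 q1 e0.
have ag : anT (fun x => 1 - f x).
  by apply: eq_anT (anTD (anT_cst 1) (anTZ (-1) af)) => x _; rewrite mulN1r.
exists (fun x => \sum_(j < n) (1 - f x) ^+ j).
  exact: (@anT_sum n (fun j x => (1 - f x) ^+ j) (fun j => anTX j ag)).
move=> x cx; rewrite mul1r in hn; rewrite (le_trans _ hn)//.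
(* The remainder of the geometric series for 1 / f, with 1 / f = conj(f) on the circle. *)
have -> : cj (f x) - \sum_(j < n) (1 - f x) ^+ j = cj (f x) * (1 - f x) ^+ n.
  have := subrX1 (1 - f x) n; have := nm1_mulJ (f1 _ cx).
  set S := \sum_(_ < _) _; rewrite (_ : 1 - f x - 1 = - f x); last by ring.
  move=> h1 h2; transitivity (cj (f x) - (f x * cj (f x)) * S); first by rewrite h1 mul1r.
  transitivity (cj (f x) + cj (f x) * (- f x * S)); first by ring.
  by rewrite -h2; ring.
by rewrite nmM nmJ f1// mul1r nmX lerXn2r ?nnegrE ?nm_ge0 ?fq.
Qed.

End DiscAlgebra.

(** * Means over the torus *)

Section Torus.
Variable R : realType.
Local Notation C := R[i].
Local Notation uc := (ucont (@dC R) (@circ R)).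
Local Notation ucD := (ucont (@dC R) (@cdisc R)).
Local Notation ucT := (ucont (@d2 R) (@circ R `*` @circ R)).
Local Notation ucB := (ucont (@d2 R) (@cdisc R `*` @cdisc R)).
Implicit Types (F G H : C * C -> C) (f h : C -> C) (z w : C * C).

Lemma clim_ge0 (x : nat -> C) (l : C) : clim x l -> (forall n, 0 <= x n) -> 0 <= l.
Proof.
move=> h x0; have {}x0 n : complex.Im (x n) = 0 /\ 0 <= complex.Re (x n).
  by have := x0 n; case: (x n) => a b; rewrite lecE /= => /andP[/eqP -> ->].
suff [i0 r0] : complex.Im l = 0 /\ 0 <= complex.Re l.
  by move: i0 r0; case: l {h} => a b /= -> a0; rewrite lecE/= eqxx.
split.
  apply/eqP; rewrite -normr_le0; apply/ler_addgt0Pl => e /h[n hn].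
  have [i0 _] := x0 n; have := le_trans (nm_Im _) (hn n (leqnn n)).
  by rewrite ImB i0 sub0r normrN addr0.
rewrite -oppr_le0; apply/ler_addgt0Pl => e /h[n hn].
have [_ r0] := x0 n; have := le_trans (nm_Re _) (hn n (leqnn n)).
by rewrite ReB ler_norml => /andP[_ ?]; lra.
Qed.

Lemma dsum_ge0 (h : R -> C) k : (forall t, 0 <= h t) -> 0 <= dsum h k.
Proof.
elim: k h => [|k IH] h h0 /=; first exact: h0.
by rewrite mulr_ge0 ?addr_ge0 ?invr_ge0 ?ler0n//; apply: IH.
Qed.

Lemma mean_ge0 f : uc f -> (forall x, circ x -> 0 <= f x) -> 0 <= mean f.
Proof.
move=> uf f0; rewrite meanE; apply: (clim_ge0 (dint_cvg (ucont_pt uf))) => n.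
by apply: dsum_ge0 => t; apply: f0; exact: circ_ci.
Qed.

Definition mean2 F : C := mean (fun x => mean (fun y => F (x, y))).

Lemma mean2E F : mean2 F = mean (fun x => mean (fun y => F (x, y))). Proof. by []. Qed.

Lemma uc_mean2 F : ucT F -> uc (fun x => mean (fun y => F (x, y))).
Proof. exact: ucont_mean. Qed.

Lemma eq_mean2 F G : (forall x y, circ x -> circ y -> F (x, y) = G (x, y)) ->
  mean2 F = mean2 G.
Proof. by move=> e; apply: eq_mean => x cx; apply: eq_mean => y cy; exact: e. Qed.

Lemma mean2D F G : ucT F -> ucT G -> mean2 (fun p => F p + G p) = mean2 F + mean2 G.
Proof.
move=> uF uG; rewrite /mean2 -meanD; [|exact: uc_mean2..].
by apply: eq_mean => x cx; rewrite meanD//; [exact: ucont_slice2 uF|exact: ucont_slice2 uG].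
Qed.

Lemma mean2B F G : ucT F -> ucT G -> mean2 (fun p => F p - G p) = mean2 F - mean2 G.
Proof.
move=> uF uG; rewrite /mean2 -meanB; [|exact: uc_mean2..].
by apply: eq_mean => x cx; rewrite meanB//; [exact: ucont_slice2 uF|exact: ucont_slice2 uG].
Qed.

Lemma mean2Z c F : ucT F -> mean2 (fun p => c * F p) = c * mean2 F.
Proof.
move=> uF; rewrite /mean2 -meanZ; last exact: uc_mean2.
by apply: eq_mean => x cx; rewrite meanZ//; exact: ucont_slice2 uF.
Qed.

Lemma mean2J F : ucT F -> mean2 (fun p => cj (F p)) = cj (mean2 F).
Proof.
move=> uF; rewrite /mean2 -meanJ; last exact: uc_mean2.
by apply: eq_mean => x cx; rewrite meanJ//; exact: ucont_slice2 uF.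
Qed.

Lemma mean2_cst (c : C) : mean2 (fun=> c) = c.
Proof. by rewrite -[RHS]mean_cst; apply: eq_mean => x _; rewrite mean_cst. Qed.

Lemma mean2_bound (M : R) F : ucT F ->
  (forall x y, circ x -> circ y -> nm (F (x, y)) <= M) -> nm (mean2 F) <= M.
Proof.
move=> uF hM; apply: mean_bound => [|x cx]; first exact: uc_mean2.
by apply: mean_bound => [|y cy]; [exact: ucont_slice2 uF|exact: hM].
Qed.

Lemma mean2_swap F : ucT F -> mean2 F = mean2 (fun p => F (p.2, p.1)).
Proof. exact: mean_swap. Qed.

Lemma mean2_mul f h : uc f -> uc h -> mean2 (fun p => f p.1 * h p.2) = mean f * mean h.
Proof.
move=> uf uh; rewrite mulrC -meanZ//; apply: eq_mean => x cx /=.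
by rewrite meanZ// mulrC.
Qed.

Lemma mean2_sum n (F : nat -> C * C -> C) : (forall i, ucT (F i)) ->
  mean2 (fun p => \sum_(i < n) F i p) = \sum_(i < n) mean2 (F i).
Proof.
move=> uF; elim: n => [|n IH].
  by rewrite big_ord0 -[RHS](mean2_cst 0); apply: eq_mean2 => x y _ _; rewrite big_ord0.
rewrite big_ord_recr /= -IH -mean2D//; last by apply: ucont_sum => i _.
by apply: eq_mean2 => x y _ _; rewrite big_ord_recr.
Qed.

Lemma ucont_sum2 (T : Type) (d : T -> T -> R) (A : set T) n (F : nat -> nat -> T -> C) :
  (forall i j, ucont d A (F i j)) ->
  ucont d A (fun p => \sum_(i < n) \sum_(j < n) F i j p).
Proof.
move=> uF; apply: (@ucont_sum _ _ d A n (fun i p => \sum_(j < n) F i j p)) => i _.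
by apply: (@ucont_sum _ _ d A n (F i)) => j _.
Qed.

Lemma mean2_sum2 n (F : nat -> nat -> C * C -> C) : (forall i j, ucT (F i j)) ->
  mean2 (fun p => \sum_(i < n) \sum_(j < n) F i j p) =
  \sum_(i < n) \sum_(j < n) mean2 (F i j).
Proof.
move=> uF; rewrite (@mean2_sum n (fun i p => \sum_(j < n) F i j p)).
  by apply: eq_bigr => i _; rewrite mean2_sum.
by move=> i; apply: (@ucont_sum _ _ _ _ n (F i)) => j _.
Qed.

Lemma ucT_B F : ucB F -> ucT F.
Proof. by apply: ucont_sub => p [/= c1 c2]; split; exact: circ_cdisc. Qed.

Definition mono (m n : nat) (p : C * C) : C := p.1 ^+ m * p.2 ^+ n.

Lemma ucB_mono m n : ucB (mono m n).
Proof.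
have u : ucD (fun x => x) by exact: ucont_idC.
apply: ucontM.
  by apply: (@ucont_fst _ _ _ (fun x => x ^+ m)); exact: ucontX.
by apply: (@ucont_snd _ _ _ (fun x => x ^+ n)); exact: ucontX.
Qed.

Lemma ucT_mono m n : ucT (mono m n). Proof. exact/ucT_B/ucB_mono. Qed.

Lemma nm_mono m n p : circ p.1 -> circ p.2 -> nm (mono m n p) = 1.
Proof. by move=> c1 c2; rewrite nmM !nmX c1 c2 !expr1n mulr1. Qed.

Lemma mean_XJ m n : mean (fun x : C => x ^+ m * cj (x ^+ n)) = (m == n)%:R.
Proof.
have st k l : (l <= k)%N -> mean (fun x : C => x ^+ k * cj (x ^+ l)) = (k == l)%:R.
  move=> lk; transitivity (mean (fun x : C => x ^+ (k - l))).
    apply: eq_mean => x cx; rewrite -{1}(subnK lk) exprD -mulrA.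
    by rewrite nm1_mulJ ?mulr1// nmX cx expr1n.
  case: eqVneq => [->|kl]; last by rewrite meanX// subn_gt0 ltn_neqAle eq_sym kl.
  by rewrite subnn -[RHS]mean_cst; apply: eq_mean => x _; rewrite expr0.
have [/st//|/ltnW/st h] := leqP n m.
transitivity (cj (mean (fun x : C => x ^+ n * cj (x ^+ m)))); last first.
  by rewrite h conjc_nat eq_sym.
rewrite -meanJ; last by apply: ucontM; [exact: uc_X|apply: ucontJ; exact: uc_X].
by apply: eq_mean => x _; rewrite rmorphM /= conjcK mulrC.
Qed.

Lemma mean2_mono m n k l :
  mean2 (fun p => mono m n p * cj (mono k l p)) = ((m == k) && (n == l))%:R.
Proof.
have u i j : uc (fun x : C => x ^+ i * cj (x ^+ j)).
  by apply: ucontM; [exact: uc_X|apply: ucontJ; exact: uc_X].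
transitivity (mean2 (fun p => (p.1 ^+ m * cj (p.1 ^+ k)) * (p.2 ^+ n * cj (p.2 ^+ l)))).
  by apply: eq_mean2 => x y _ _; rewrite /mono rmorphM/=; ring.
by rewrite (mean2_mul (u m k) (u n l)) !mean_XJ -natrM mulnb.
Qed.

Definition cf F m n : C := mean2 (fun p => F p * cj (mono m n p)).

Definition pol (N : nat) (b : nat -> nat -> C) (p : C * C) : C :=
  \sum_(m < N) \sum_(n < N) b m n * mono m n p.

Lemma ucB_pol N b : ucB (pol N b).
Proof.
apply: (@ucont_sum2 _ _ _ N (fun m n p => b m n * mono m n p)) => i j.
by apply: ucontM; [exact: ucont_cst|exact: ucB_mono].
Qed.

Lemma ucT_pol N b : ucT (pol N b). Proof. exact/ucT_B/ucB_pol. Qed.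

Lemma mean2_mul_polJ F N b : ucT F ->
  mean2 (fun p => F p * cj (pol N b p)) = \sum_(m < N) \sum_(n < N) cf F m n * cj (b m n).
Proof.
move=> uF; transitivity (mean2 (fun p => \sum_(m < N) \sum_(n < N)
    (cj (b m n) * (F p * cj (mono m n p))))).
  apply: eq_mean2 => x y _ _; rewrite /pol rmorph_sum mulr_sumr; apply: eq_bigr => m _.
  rewrite rmorph_sum mulr_sumr; apply: eq_bigr => n _.
  by rewrite rmorphM /=; ring.
have u m n : ucT (fun p => F p * cj (mono m n p)).
  by apply: ucontM => //; apply: ucontJ; exact: ucT_mono.
rewrite (@mean2_sum2 N (fun m n p => cj (b m n) * (F p * cj (mono m n p)))).
  by apply: eq_bigr => m _; apply: eq_bigr => n _; rewrite mean2Z// mulrC.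
by move=> i j; apply: ucontM => //; exact: ucont_cst.
Qed.

Lemma cf_pol N b m n : cf (pol N b) m n = if (m < N)%N && (n < N)%N then b m n else 0.
Proof.
transitivity (mean2 (fun p => \sum_(i < N) \sum_(j < N)
    (b i j * (mono i j p * cj (mono m n p))))).
  apply: eq_mean2 => x y _ _; rewrite /pol mulr_suml; apply: eq_bigr => i _.
  by rewrite mulr_suml; apply: eq_bigr => j _; ring.
have u i j : ucT (fun p => mono i j p * cj (mono m n p)).
  by apply: ucontM; [exact: ucT_mono|apply: ucontJ; exact: ucT_mono].
rewrite (@mean2_sum2 N (fun i j p => b i j * (mono i j p * cj (mono m n p)))); last first.
  by move=> i j; apply: ucontM => //; exact: ucont_cst.
transitivity (\sum_(i < N) \sum_(j < N) (if (i == m :> nat) && (j == n :> nat) then b i j else 0)).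
  apply: eq_bigr => i _; apply: eq_bigr => j _; rewrite mean2Z// mean2_mono.
  by case: (_ && _); rewrite ?mulr1 ?mulr0.
case: ifPn => [/andP[mN nN]|].
  rewrite (bigD1 (Ordinal mN))//= (bigD1 (Ordinal nN))//= !eqxx /= big1 ?addr0.
    rewrite big1 ?addr0// => i im; rewrite big1// => j _.
    by rewrite ifF//; apply/negbTE; rewrite negb_and; move: im; rewrite -val_eqE /= => ->.
  move=> j jn; rewrite ifF//; apply/negbTE.
  by move: jn; rewrite -val_eqE/= => /negbTE ->.
move=> nmn; rewrite big1// => i _; rewrite big1// => j _; case: ifP => // /andP[/eqP im /eqP jn].
by move: nmn; rewrite -im -jn !ltn_ord.
Qed.

Lemma mean2_ge0 F : ucT F -> 0 <= mean2 (fun p => F p * cj (F p)).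
Proof.
move=> uF; have uFF : ucT (fun p => F p * cj (F p)) by apply: ucontM => //; exact: ucontJ.
apply: (@mean_ge0 (fun x => mean (fun y => F (x, y) * cj (F (x, y))))) => [|x cx].
  exact: uc_mean2 uFF.
by apply: (@mean_ge0 (fun y => F (x, y) * cj (F (x, y)))) => [|y cy]; [exact: (ucont_slice2 cx uFF)|exact: mulcJ_ge0].
Qed.

End Torus.

#[global] Opaque mean2.

(** * Cauchy's formula and Parseval's identity in the bidisc *)

Section BidiscAlgebra.
Variable R : realType.
Local Notation C := R[i].
Local Notation uc := (ucont (@dC R) (@circ R)).
Local Notation ucD := (ucont (@dC R) (@cdisc R)).
Local Notation ucT := (ucont (@d2 R) (@circ R `*` @circ R)).
Local Notation ucB := (ucont (@d2 R) (@cdisc R `*` @cdisc R)).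
Implicit Types (F G H : C * C -> C) (f h : C -> C) (z w : C * C).

(** Separate holomorphy and uniform continuity up to the boundary are what the iterated Cauchy
    formula uses, and both are symmetric in the two variables. *)
Definition hol2 G : Prop := ucB G /\ forall x y : C, nm x < 1 -> nm y < 1 ->
  cdiff (fun t => G (t, y)) x /\ cdiff (fun t => G (x, t)) y.

Lemma hol2_cst (c : C) : hol2 (fun=> c).
Proof. by split=> [|x y _ _]; [exact: ucont_cst|split; exact: cdiff_cst]. Qed.

Lemma hol2M F G : hol2 F -> hol2 G -> hol2 (fun p => F p * G p).
Proof.
move=> [uF hF] [uG hG]; split=> [|x y x1 y1]; first exact: ucontM.
by have [? ?] := hF _ _ x1 y1; have [? ?] := hG _ _ x1 y1; split; exact: cdiffM.
Qed.

Lemma hol2D F G : hol2 F -> hol2 G -> hol2 (fun p => F p + G p).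
Proof.
move=> [uF hF] [uG hG]; split=> [|x y x1 y1]; first exact: ucontD.
by have [? ?] := hF _ _ x1 y1; have [? ?] := hG _ _ x1 y1; split; exact: cdiffD.
Qed.

Lemma hol2_mono m n : hol2 (mono m n : C * C -> C).
Proof.
split=> [|x y _ _]; first exact: ucB_mono.
by split; apply: cdiffM; [exact/cdiffX/cdiff_id|exact: cdiff_cst|exact: cdiff_cst|exact/cdiffX/cdiff_id].
Qed.

Lemma hol2_sum n (F : nat -> C * C -> C) : (forall i, hol2 (F i)) ->
  hol2 (fun p => \sum_(i < n) F i p).
Proof.
move=> hF; elim: n => [|n IH].
  rewrite (_ : (fun _ => _) = fun=> 0); first exact: hol2_cst.
  by apply/funext => p; rewrite big_ord0.
rewrite (_ : (fun _ => _) = fun p => \sum_(i < n) F i p + F n p); first exact: hol2D.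
by apply/funext => p; rewrite big_ord_recr.
Qed.

Lemma hol2_pol N b : hol2 (pol N b : C * C -> C).
Proof.
apply: (@hol2_sum N (fun m p => \sum_(n < N) b m n * mono m n p)) => m.
apply: (@hol2_sum N (fun n p => b m n * mono m n p)) => n.
by apply: hol2M; [exact: hol2_cst|exact: hol2_mono].
Qed.

Definition kern w (p : C * C) : C := (1 - cj w.1 * p.1)^-1 * (1 - cj w.2 * p.2)^-1.

Lemma hol2_kern w : nm w.1 < 1 -> nm w.2 < 1 -> hol2 (kern w).
Proof.
move=> w1 w2.
have u (c : C) : nm c < 1 -> ucD (fun x => (1 - cj c * x)^-1).
  by move=> c1; apply: ucont_geo; [rewrite nmJ|move=> x|exact: ucont_idC].
have d (c x : C) : nm c < 1 -> nm x < 1 -> cdiff (fun x => (1 - cj c * x)^-1) x.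
  move=> c1 x1; apply: cdiffV.
    apply: nm_lt1_neq; rewrite nmJ; have := nm_ge0 c; have := nm_ge0 x; nra.
  apply: cdiffB; first exact: cdiff_cst.
  by apply: cdiffM; [exact: cdiff_cst|exact: cdiff_id].
split=> [|x y x1 y1].
  apply: ucontM.
    exact: (@ucont_fst _ _ _ (fun x => (1 - cj w.1 * x)^-1) (u _ w1)).
  exact: (@ucont_snd _ _ _ (fun x => (1 - cj w.2 * x)^-1) (u _ w2)).
by split; apply: cdiffM; rewrite /=; [exact: d|exact: cdiff_cst|exact: cdiff_cst|exact: d].
Qed.

Lemma nm_ext f (M : R) (x : C) : uc f -> (forall t, circ t -> nm (f t) <= M) -> nm x < 1 ->
  nm (ext f x) <= M / (1 - nm x).
Proof.
move=> uf hM x1; have x10 : 0 < 1 - nm x by rewrite subr_gt0.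
apply: mean_bound => [|t ct]; first by apply: ucontM => //; exact: uc_szego.
rewrite nmM nmV ler_pM ?nm_ge0 ?invr_ge0 ?nm_ge0 ?hM//.
rewrite lef_pV2 ?posrE//; first by apply: den_ge => //; rewrite nmJ ct.
by rewrite (lt_le_trans x10)//; apply: den_ge => //; rewrite nmJ ct.
Qed.

Lemma extB f h (x : C) : uc f -> uc h -> nm x < 1 ->
  ext (fun t => f t - h t) x = ext f x - ext h x.
Proof.
move=> uf uh x1; have us := uc_szego x1; rewrite /ext -meanB; [|exact: ucontM..].
by apply: eq_mean => t _; rewrite mulrBl.
Qed.

Lemma dalg_lim f : ucD f -> (forall e : R, 0 < e -> exists2 h, dalg h &
  forall x, cdisc x -> nm (f x - h x) <= e) -> dalg f.
Proof.
move=> uf hf; split=> // x x1; apply/eqP; rewrite -subr_eq0; apply/eqP.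
apply: nm_small0 => e e0; have x10 : 0 < 1 - nm x by rewrite subr_gt0.
pose k := e * (1 - nm x) / 2; have k0 : 0 < k by rewrite divr_gt0// mulr_gt0.
have [h [uh ah] hh] := hf _ k0.
rewrite [X in nm X](_ : _ = (f x - h x) - ext (fun t => f t - h t) x); last first.
  by rewrite extB ?ah//; [ring|exact: uc_D..].
rewrite (le_trans (nmB _ _))//.
have t1 : nm (ext (fun t => f t - h t) x) <= k / (1 - nm x).
  apply: nm_ext => // [|t ct]; first by apply: ucontB; exact: uc_D.
  exact/hh/circ_cdisc.
have t2 : nm (f x - h x) <= k by apply: hh; exact: ltW.
have e1 : k / (1 - nm x) = e / 2 by rewrite /k; field; rewrite gt_eqF.
have : k <= e / 2 by rewrite /k; have := nm_ge0 x; nra.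
rewrite e1 in t1; lra.
Qed.

Lemma hol2_swap G : hol2 G -> hol2 (fun p => G (p.2, p.1)).
Proof.
move=> [uG hG]; split=> [|x y x1 y1]; first exact: ucont_swap.
by have [? ?] := hG _ _ y1 x1; split.
Qed.

(** Inside the disc this is Cauchy's formula. For [x] on the circle nothing is assumed about
    derivatives, and the slice is a uniform limit of the slices at [r%:C * x]; these boundary slices
    are the ones [cauchy2] integrates. *)
Lemma hol2_dalg1 G (x : C) : hol2 G -> nm x <= 1 -> dalg (fun y => G (x, y)).
Proof.
move=> [uG hG]; have u t : cdisc t -> ucD (fun y => G (t, y)).
  by move=> ct; exact: (ucont_slice2 ct uG).
have inner_ t : nm t < 1 -> dalg (fun y => G (t, y)).
  move=> t1; have ut := u t (ltW t1); split=> // y y1; apply: cauchy_formula => // y' y1'.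
  by have [_] := hG _ _ t1 y1'.
rewrite le_eqVlt => /predU1P[x1|]; last exact: inner_.
apply: dalg_lim => [|e e0]; first by apply: u; rewrite /cdisc/= x1.
have [_ /(_ _ e0)[a a0 ha]] := uG; have [r [r0 r1 ra]] := near1 a0.
have rx : nm (r%:C * x) < 1 by rewrite nmM x1 mulr1 nm_real ger0_norm.
exists (fun y => G (r%:C * x, y)); first exact: inner_.
move=> y cy; apply: ha; [by split => //=; rewrite /cdisc/= x1|by split => //; exact: ltW|].
rewrite /d2 /dC /= subrr nm0 ge_max (ltW a0) andbT.
rewrite -[X in X - _]mul1r -mulrBl nmM x1 mulr1 -(rmorph1 (real_complex R)) -rmorphB.
by rewrite nm_real ger0_norm// subr_ge0 ltW.
Qed.

Lemma hol2_dalg2 G (y : C) : hol2 G -> nm y <= 1 -> dalg (fun x => G (x, y)).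
Proof. by move=> /hol2_swap hG; exact: (hol2_dalg1 hG). Qed.

Definition szego2 z (p : C * C) : C := szego z.1 p.1 * szego z.2 p.2.

Lemma ucT_szego2 z : nm z.1 < 1 -> nm z.2 < 1 -> ucT (szego2 z).
Proof.
move=> z1 z2; apply: ucontM.
  by apply: (@ucont_fst _ _ _ (szego z.1)); exact: uc_szego.
by apply: (@ucont_snd _ _ _ (szego z.2)); exact: uc_szego.
Qed.

Definition ext2 F z : C := mean2 (fun p => F p * szego2 z p).

Lemma cauchy2 G z : hol2 G -> nm z.1 < 1 -> nm z.2 < 1 -> G z = ext2 G z.
Proof.
move=> hG z1 z2; have [_ h2] := hol2_dalg2 hG (ltW z2).
rewrite [z in LHS]surjective_pairing h2// /ext2 mean2E; apply: eq_mean => x cx.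
have [u1 h1] : dalg (fun y => G (x, y)) by apply: hol2_dalg1 => //; rewrite cx.
rewrite h1// mulrC -meanZ; last by apply: ucontM; [exact: uc_D|exact: uc_szego].
by apply: eq_mean => y cy; rewrite /szego2/=; ring.
Qed.

Definition gsum (N : nat) (t : C) : C := \sum_(m < N) t ^+ m.

Lemma gsum_err N (t : C) (r : R) : nm t <= r -> r < 1 ->
  nm ((1 - t)^-1 - gsum N t) <= r ^+ N / (1 - r) /\ nm (gsum N t) <= 2 / (1 - r) /\
  nm ((1 - t)^-1) <= 1 / (1 - r).
Proof.
move=> tr r1; have t1 : 1 - t != 0.
  by rewrite -[t]mul1r; apply: nm_lt1_neq; rewrite nm1 mul1r; exact: le_lt_trans r1.
have r0 : 0 <= r := le_trans (nm_ge0 _) tr.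
have e : (1 - t)^-1 - gsum N t = t ^+ N * (1 - t)^-1.
  apply: (mulIf t1); rewrite mulfVK// mulrBl mulVf//.
  have := subrX1 t N; rewrite -/(gsum N t) => h.
  rewrite (_ : gsum N t * (1 - t) = - ((t - 1) * gsum N t)); last by ring.
  by rewrite -h; ring.
have d : 1 - r <= nm (1 - t) by have := nm_triB 1 t; rewrite nm1; lra.
have r10 : 0 < 1 - r by rewrite subr_gt0.
have h1 : nm (1 - t)^-1 <= 1 / (1 - r).
  by rewrite nmV mul1r lef_pV2 ?posrE// (lt_le_trans r10).
have h2 : nm ((1 - t)^-1 - gsum N t) <= r ^+ N / (1 - r).
  rewrite e nmM nmX; apply: ler_pM; rewrite ?exprn_ge0 ?nm_ge0//.
    by rewrite lerXn2r ?nnegrE ?nm_ge0.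
  by rewrite -[X in _ <= X]mul1r.
have h3 : r ^+ N / (1 - r) <= 1 / (1 - r).
  by rewrite ler_wpM2r ?invr_ge0 ?(ltW r10)// exprn_ile1// ltW.
split=> //; split=> //.
rewrite (_ : gsum N t = (1 - t)^-1 - ((1 - t)^-1 - gsum N t)); last by ring.
by rewrite (le_trans (nmB _ _))// (_ : 2 / (1 - r) = 1 / (1 - r) + 1 / (1 - r)); [lra|ring].
Qed.

(** The polynomial is the mean of [F] against the product of two truncated geometric series. The 3
    is 1 + 2, from the bounds of the two terms of (s - u) t + u (t - v). *)
Lemma ext2_pol F z (M r : R) N : ucT F -> (forall x y, circ x -> circ y -> nm (F (x, y)) <= M) ->
  nm z.1 <= r -> nm z.2 <= r -> r < 1 ->
  nm (ext2 F z - pol N (cf F) z) <= 3 * M / (1 - r) ^+ 2 * r ^+ N.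
Proof.
move=> uF hM z1 z2 r1; have r0 : 0 <= r := le_trans (nm_ge0 _) z1.
have r10 : 0 < 1 - r by rewrite subr_gt0.
pose Q p := gsum N (z.1 * cj p.1) * gsum N (z.2 * cj p.2).
have QE p : Q p = cj (pol N (fun m n => cj (mono m n z)) p).
  rewrite /Q /gsum mulr_suml /pol rmorph_sum; apply: eq_bigr => m _.
  rewrite mulr_sumr rmorph_sum; apply: eq_bigr => n _.
  by rewrite rmorphM /= conjcK /mono rmorphM !rmorphXn /= !exprMn; ring.
have uQ : ucT Q.
  apply: (@ucont_eq _ _ _ _ (fun p => cj (pol N (fun m n => cj (mono m n z)) p))).
    by move=> p _; rewrite QE.
  by apply: ucontJ; exact: ucT_pol.
have -> : pol N (cf F) z = mean2 (fun p => F p * Q p).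
  transitivity (mean2 (fun p => F p * cj (pol N (fun m n => cj (mono m n z)) p))).
    by rewrite mean2_mul_polJ//; apply: eq_bigr => m _; apply: eq_bigr => n _; rewrite conjcK.
  by apply: eq_mean2 => x y _ _; rewrite QE.
have us : ucT (szego2 z) by apply: ucT_szego2; exact: le_lt_trans r1.
rewrite -mean2B; [|exact: ucontM..].
apply: mean2_bound => [|x y cx cy]; first by apply: ucontB; exact: ucontM.
rewrite -mulrBr nmM -mulrA [3 * _]mulrC -!mulrA.
have M0 : 0 <= M := le_trans (nm_ge0 _) (hM _ _ cx cy).
rewrite ler_pM ?nm_ge0 ?hM// /Q /szego2 /szego /=.
have tx : nm (z.1 * cj x) <= r by rewrite nmM nmJ cx mulr1.
have ty : nm (z.2 * cj y) <= r by rewrite nmM nmJ cy mulr1.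
have [a1 [a2 a3]] := gsum_err N tx r1; have [b1 [b2 b3]] := gsum_err N ty r1.
set s := (1 - z.1 * cj x)^-1 in a1 a3 *; set t := (1 - z.2 * cj y)^-1 in b1 b3 *.
set u := gsum N _ in a1 a2 *; set v := gsum N _ in b1 b2 *.
rewrite (_ : s * t - u * v = (s - u) * t + u * (t - v)); last by ring.
rewrite (le_trans (nmD _ _))// !nmM.
have c1 : nm (s - u) * nm t <= (r ^+ N / (1 - r)) * (1 / (1 - r)) by rewrite ler_pM ?nm_ge0.
have c2 : nm u * nm (t - v) <= (2 / (1 - r)) * (r ^+ N / (1 - r)) by rewrite ler_pM ?nm_ge0.
rewrite (le_trans (lerD c1 c2))// le_eqVlt; apply/orP; left; apply/eqP.
by field; rewrite gt_eqF.
Qed.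

Definition ip F G : C := mean2 (fun p => F p * cj (G p)).

Definition csum (N : nat) (a b : nat -> nat -> C) : C :=
  \sum_(m < N) \sum_(n < N) a m n * cj (b m n).

Lemma csumJ N a b : cj (csum N a b) = csum N b a.
Proof.
rewrite /csum rmorph_sum; apply: eq_bigr => m _; rewrite rmorph_sum; apply: eq_bigr => n _.
by rewrite rmorphM /= conjcK mulrC.
Qed.

Lemma csum_ge0 N a : 0 <= csum N a a.
Proof. by apply: sumr_ge0 => m _; apply: sumr_ge0 => n _; exact: mulcJ_ge0. Qed.

Lemma csumBl N a b c : csum N (fun m n => a m n - b m n) c = csum N a c - csum N b c.
Proof.
rewrite /csum -sumrB; apply: eq_bigr => m _; rewrite -sumrB; apply: eq_bigr => n _.
by rewrite mulrBl.
Qed.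

Lemma csumBr N a b c : csum N c (fun m n => a m n - b m n) = csum N c a - csum N c b.
Proof. by rewrite -csumJ csumBl rmorphB /= !csumJ. Qed.

Lemma ipJ F G : ucT F -> ucT G -> cj (ip F G) = ip G F.
Proof.
move=> uF uG; rewrite /ip -mean2J; last by apply: ucontM => //; exact: ucontJ.
by apply: eq_mean2 => x y _ _; rewrite rmorphM /= conjcK mulrC.
Qed.

Lemma ipBl F G H : ucT F -> ucT G -> ucT H -> ip (fun p => F p - G p) H = ip F H - ip G H.
Proof.
move=> uF uG uH; have uJ := ucontJ uH; rewrite /ip -mean2B; [|exact: ucontM..].
by apply: eq_mean2 => x y _ _; rewrite mulrBl.
Qed.

Lemma ipBr F G H : ucT F -> ucT G -> ucT H -> ip H (fun p => F p - G p) = ip H F - ip H G.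
Proof.
move=> uF uG uH; have us := ucontB uF uG.
by rewrite -(ipJ us uH) (ipBl uF uG uH) rmorphB /= !ipJ.
Qed.

Lemma ip_polr F N b : ucT F -> ip F (pol N b) = csum N (cf F) b.
Proof. exact: mean2_mul_polJ. Qed.

Lemma ip_poll F N b : ucT F -> ip (pol N b) F = csum N b (cf F).
Proof. by move=> uF; rewrite -ipJ ?ip_polr ?csumJ//; exact: ucT_pol. Qed.

Lemma ip_pol N a b : ip (pol N a) (pol N b) = csum N a b.
Proof.
rewrite ip_polr; last exact: ucT_pol.
apply: eq_bigr => m _; apply: eq_bigr => n _.
by rewrite cf_pol !ltn_ord.
Qed.

Lemma ip_sub_pol F N b : ucT F -> ip (fun p => F p - pol N b p) (fun p => F p - pol N b p) =
  ip F F - csum N (cf F) (cf F) + csum N (fun m n => cf F m n - b m n) (fun m n => cf F m n - b m n).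
Proof.
move=> uF; have up := ucT_pol N b; have us := ucontB uF up.
rewrite ipBl// !ipBr// ip_polr// ip_poll// ip_pol csumBl !csumBr; ring.
Qed.

Lemma ip_proj F G N : ucT F -> ucT G ->
  ip (fun p => F p - pol N (cf F) p) (fun p => G p - pol N (cf G) p) =
  ip F G - csum N (cf F) (cf G).
Proof.
move=> uF uG; have uf := ucT_pol N (cf F); have ug := ucT_pol N (cf G).
rewrite ipBl//; last exact: ucontB.
by rewrite !ipBr// ip_polr// ip_poll// ip_pol; ring.
Qed.

Lemma bessel F N : ucT F -> csum N (cf F) (cf F) <= ip F F.
Proof.
move=> uF; have := mean2_ge0 (ucontB uF (ucT_pol N (cf F))).
by rewrite -/(ip _ _) ip_proj// subr_ge0.
Qed.

Lemma ip_le F (e : R) : ucT F -> (forall x y, circ x -> circ y -> nm (F (x, y)) <= e) ->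
  nm (ip F F) <= e ^+ 2.
Proof.
move=> uF he; apply: mean2_bound => [|x y cx cy]; first by apply: ucontM => //; exact: ucontJ.
by rewrite nmM nmJ expr2 ler_pM ?nm_ge0 ?he.
Qed.

Lemma nm_ge0_le (x y : C) : 0 <= x -> x <= y -> nm x <= nm y.
Proof. by move=> x0 xy; rewrite -lecR -!normE !ger0_norm// (le_trans x0). Qed.

(** A substitute for Cauchy-Schwarz that integrates a pointwise inequality. It is applied to
    remainders which are both small, so the arithmetic mean is good enough. *)
Lemma ip_amgm F G : ucT F -> ucT G ->
  nm (ip F G) <= 2^-1 * (nm (ip F F) + nm (ip G G)).
Proof.
move=> uF uG.
have uJF := ucontJ uF; have uJG := ucontJ uG.
have real H : ucT H -> ip H H = (nm (ip H H))%:C.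
  by move=> uH; rewrite -normE ger0_norm// mean2_ge0.
have uF2 := ucontM uF uJF; have uG2 := ucontM uG uJG.
suff : nm (ip F G) <= complex.Re (2^-1 * (ip F F + ip G G)).
  move=> h; rewrite (le_trans h)// {1}(real _ uF) {1}(real _ uG) halfC -rmorphD -rmorphM.
  exact: lexx.
have E : 2^-1 * (ip F F + ip G G) =
    mean2 (fun p => (2^-1 * (nm (F p) ^+ 2 + nm (G p) ^+ 2))%:C).
  rewrite /ip -mean2D// -mean2Z; last exact: ucontD.
  by apply: eq_mean2 => x y _ _; rewrite !mulJ halfC -rmorphD -rmorphM.
have uS : ucT (fun p => (2^-1 * (nm (F p) ^+ 2 + nm (G p) ^+ 2))%:C).
  apply: (@ucont_eq _ _ _ _ (fun p => 2^-1 * (F p * cj (F p) + G p * cj (G p)))).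
    by move=> p _; rewrite !mulJ halfC -rmorphD -rmorphM.
  by apply: ucontM; [exact: ucont_cst|exact: ucontD].
rewrite E.
pose g x := complex.Re (mean (fun y => (2^-1 * (nm (F (x, y)) ^+ 2 + nm (G (x, y)) ^+ 2))%:C)).
have uFG := ucontM uF uJG.
have gE x : circ x -> mean (fun y => (2^-1 * (nm (F (x, y)) ^+ 2 + nm (G (x, y)) ^+ 2))%:C) = (g x)%:C.
  move=> cx; have h : 0 <= mean (fun y => (2^-1 * (nm (F (x, y)) ^+ 2 + nm (G (x, y)) ^+ 2))%:C).
    apply: mean_ge0 => [|y cy]; first exact: (ucont_slice2 cx uS).
    by rewrite lecR mulr_ge0 ?addr_ge0 ?sqr_ge0.
  by rewrite /g; set v := mean _ in h *; rewrite RRe_real// ger0_real.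
have -> : mean2 (fun p => (2^-1 * (nm (F p) ^+ 2 + nm (G p) ^+ 2))%:C) = mean (fun x => (g x)%:C).
  by apply: eq_mean => x cx; rewrite gE.
apply: mean_le; first exact: uc_mean2 uFG.
  by apply: ucont_eq (uc_mean2 uS) => x cx; rewrite gE.
move=> x cx; apply: mean_le; first exact: (ucont_slice2 cx uFG).
  exact: (ucont_slice2 cx uS).
by move=> y cy; rewrite -(nmJ (G (x, y))); exact: nm_sq_sum.
Qed.

Lemma hol2_ucT F : hol2 F -> ucT F. Proof. by case=> /ucT_B. Qed.

(** Among polynomials of the same size the one with the coefficients of [F] is the best quadratic
    approximation ([ip_sub_pol]). It is compared with the Taylor polynomial of a dilate of [F],
    which is uniformly close to [F] on the torus. *)
Lemma parseval_proj F (e : R) : hol2 F -> 0 < e -> exists N0, forall N, (N0 <= N)%N ->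
  nm (ip (fun p => F p - pol N (cf F) p) (fun p => F p - pol N (cf F) p)) <= e.
Proof.
move=> hF e0; have uF := hol2_ucT hF; have [uB _] := hF.
pose k := Num.min e 1; have k0 : 0 < k by rewrite lt_min e0 ltr01.
have k2 : k ^+ 2 <= e.
  have h1 : k <= 1 by rewrite ge_min lexx orbT.
  have h2 : k <= e by rewrite ge_min lexx.
  by rewrite expr2; nra.
have k20 : 0 < k / 2 by rewrite divr_gt0.
have [M M0 hM] := ucont_pos uF.
have [_ /(_ _ k20)[a a0 ha]] := uB; have [r [r0 r1 ra]] := near1 a0.
have [N0 hN] := expn_small (3 * M / (1 - r) ^+ 2) r0 r1 k20.
exists N0 => N /hN hN'; rewrite (le_trans _ k2)//.
pose b m n := cf F m n * r%:C ^+ (m + n).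
have polE p : pol N b p = pol N (cf F) (r%:C * p.1, r%:C * p.2).
  apply: eq_bigr => m _; apply: eq_bigr => n _.
  by rewrite /b /mono/= !exprMn exprD; ring.
apply: (le_trans _ (ip_le (F := fun p => F p - pol N b p) (e := k) _ _)).
- apply: nm_ge0_le; first by apply: mean2_ge0; apply: ucontB => //; exact: ucT_pol.
  by rewrite ip_proj// ip_sub_pol// lerDl csum_ge0.
- by apply: ucontB => //; exact: ucT_pol.
move=> x y cx cy; rewrite polE /=.
have nr (t : C) : circ t -> nm (r%:C * t) = r by move=> ct; rewrite nmM ct mulr1 nm_real ger0_norm.
have FE : F (r%:C * x, r%:C * y) = ext2 F (r%:C * x, r%:C * y).
  by apply: cauchy2; rewrite //= nr.
have t1 : nm (F (x, y) - F (r%:C * x, r%:C * y)) <= k / 2.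
  apply: ha; [by split; exact: circ_cdisc|by split; rewrite /cdisc/= nr// ltW|].
  have d (t : C) : circ t -> dC t (r%:C * t) <= a.
    move=> ct; rewrite /dC -[X in X - _]mul1r -mulrBl nmM ct mulr1.
    by rewrite -(rmorph1 (real_complex R)) -rmorphB nm_real ger0_norm// subr_ge0 ltW.
  by rewrite /d2 ge_max !d.
have t2 := ext2_pol (z := (r%:C * x, r%:C * y)) N uF (fun x y cx cy => hM (x, y) (conj cx cy)).
have {}t2 := t2 r; rewrite /= !nr// in t2; have {}t2 := t2 (lexx _) (lexx _) r1.
have := nm_tri (F (r%:C * x, r%:C * y)) (F (x, y)) (pol N (cf F) (r%:C * x, r%:C * y)).
by rewrite -FE in t2; lra.
Qed.

Lemma half_le (x y e : R) : x <= e -> y <= e -> 2^-1 * (x + y) <= e.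
Proof. lra. Qed.

Lemma parseval F G : hol2 F -> hol2 G -> clim (fun N => csum N (cf F) (cf G)) (ip F G).
Proof.
move=> hF hG e e0; have [n hn] := parseval_proj hF e0; have [m hm] := parseval_proj hG e0.
exists (maxn n m) => N; rewrite geq_max => /andP[/hn h1 /hm h2].
have uF := hol2_ucT hF; have uG := hol2_ucT hG.
rewrite nm_sym -(ip_proj N uF uG).
have uf := ucontB uF (ucT_pol N (cf F)); have ug := ucontB uG (ucT_pol N (cf G)).
exact: (le_trans (ip_amgm uf ug) (half_le h1 h2)).
Qed.

Lemma hol2_taylor F z : hol2 F -> nm z.1 < 1 -> nm z.2 < 1 ->
  clim (fun N => pol N (cf F) z) (F z).
Proof.
move=> hF z1 z2 e e0; have uF := hol2_ucT hF; have [M M0 hM] := ucont_pos uF.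
pose r := Num.max (nm z.1) (nm z.2).
have r1 : r < 1 by rewrite gt_max z1.
have r0 : 0 <= r by rewrite le_max nm_ge0.
have [N0 hN] := expn_small (3 * M / (1 - r) ^+ 2) r0 r1 e0.
exists N0 => N /hN h; rewrite nm_sym cauchy2//.
rewrite (le_trans _ h)//; apply: ext2_pol => //; rewrite ?le_max ?lexx ?orbT//.
by move=> x y cx cy; exact: (hM (x, y)).
Qed.

End BidiscAlgebra.

(** * Square summable families *)

Section SquareSummable.
Variable R : realType.
Local Notation C := R[i].
Implicit Types (a b c d : nat -> nat -> C) (N : nat).

Definition sq N a : R := \sum_(m < N) \sum_(n < N) nm (a m n) ^+ 2.

(* [a] belongs to l^2(N^2), with squared norm at most [B]. *)
Definition l2le a (B : R) : Prop := forall N, sq N a <= B.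

Definition ell2 a : Prop := exists B, l2le a B.

Definition trunc N a m n : C := if (m < N)%N && (n < N)%N then a m n else 0.

Definition sub2 a b m n : C := a m n - b m n.

Lemma sq_ge0 N a : 0 <= sq N a.
Proof. by apply: sumr_ge0 => m _; apply: sumr_ge0 => n _; exact: sqr_ge0. Qed.

Lemma csum_sq N a : csum N a a = (sq N a)%:C.
Proof.
rewrite /csum /sq rmorph_sum; apply: eq_bigr => m _; rewrite rmorph_sum.
by apply: eq_bigr => n _; rewrite mulJ.
Qed.

Lemma csumZl N (l : C) a b : csum N (fun m n => l * a m n) b = l * csum N a b.
Proof.
rewrite /csum mulr_sumr; apply: eq_bigr => m _; rewrite mulr_sumr; apply: eq_bigr => n _.
by rewrite mulrA.
Qed.

(** The weighted arithmetic-geometric mean inequality, termwise; the weight [t] stays free so that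
    it can be optimized after passing to the limit. *)
Lemma nm_csum N a b (t : R) : 0 < t ->
  nm (csum N a b) <= 2^-1 * (t * sq N a + t^-1 * sq N b).
Proof.
move=> t0; have t0' : 0 < t^-1 by rewrite invr_gt0.
rewrite /csum /sq !mulr_sumr -big_split mulr_sumr (le_trans (nm_sum _ _ _))//.
apply: ler_sum => m _; rewrite !mulr_sumr -big_split mulr_sumr (le_trans (nm_sum _ _ _))//.
apply: ler_sum => n _; rewrite nmM nmJ; set x := nm _; set y := nm _ => /=.
have : 0 <= t * (x - t^-1 * y) ^+ 2 by rewrite mulr_ge0 ?sqr_ge0// ltW.
have -> : t * (x - t^-1 * y) ^+ 2 = t * x ^+ 2 + t^-1 * y ^+ 2 - 2 * (x * y).
  by field; rewrite gt_eqF.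
lra.
Qed.

Lemma csum_trunc N M a b : (N <= M)%N -> csum M (trunc N a) b = csum N a b.
Proof.
move=> NM; rewrite /csum.
rewrite -(big_mkord predT (fun m => \sum_(n < M) trunc N a m n * cj (b m n))).
rewrite -(big_mkord predT (fun m => \sum_(n < N) a m n * cj (b m n))).
rewrite (big_cat_nat (leq0n N) NM)//= [X in _ + X]big1_seq ?addr0; last first.
  move=> m; rewrite mem_index_iota => /andP[_ /andP[Nm _]]; rewrite big1// => n _.
  by rewrite /trunc ltnNge Nm mul0r.
rewrite big_nat_cond [RHS]big_nat_cond; apply: eq_bigr => m; rewrite andbT => /andP[_ mN].
rewrite -(big_mkord predT (fun n => trunc N a m n * cj (b m n))).
rewrite -(big_mkord predT (fun n => a m n * cj (b m n))).
rewrite (big_cat_nat (leq0n N) NM)//= [X in _ + X]big1_seq ?addr0; last first.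
  by move=> n; rewrite mem_index_iota => /andP[_ /andP[Nn _]]; rewrite /trunc mN ltnNge Nn mul0r.
rewrite big_nat_cond [RHS]big_nat_cond; apply: eq_bigr => n; rewrite andbT => /andP[_ nN].
by rewrite /trunc mN nN.
Qed.

Lemma csum_truncr N M a b : (N <= M)%N -> csum M a (trunc N b) = csum N a b.
Proof. by move=> NM; rewrite -csumJ csum_trunc// csumJ. Qed.

Lemma sq_trunc N M a : (N <= M)%N -> sq M (trunc N a) = sq N a.
Proof.
move=> NM; apply: complexI; rewrite -!csum_sq csum_trunc//.
apply: eq_bigr => m _; apply: eq_bigr => n _; by rewrite /trunc !ltn_ord.
Qed.

Lemma csum_tail N M a b : (N <= M)%N ->
  csum M (sub2 a (trunc N a)) (sub2 b (trunc N b)) = csum M a b - csum N a b.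
Proof.
move=> NM; rewrite /sub2 csumBl !csumBr !csum_truncr// csum_trunc//.
have -> : csum N (trunc N a) b = csum N a b; last by ring.
by apply: eq_bigr => m _; apply: eq_bigr => n _; rewrite /trunc !ltn_ord.
Qed.

Lemma sq_tail N M a : (N <= M)%N -> sq M (sub2 a (trunc N a)) = sq M a - sq N a.
Proof. by move=> NM; apply: complexI; rewrite rmorphB /= -!csum_sq csum_tail. Qed.

Lemma sq_mono N M a : (N <= M)%N -> sq N a <= sq M a.
Proof. by move=> NM; rewrite -subr_ge0 -sq_tail// sq_ge0. Qed.

Lemma l2le_term a B m n : l2le a B -> nm (a m n) ^+ 2 <= B.
Proof.
move=> /(_ (maxn m n).+1); apply: le_trans; rewrite /sq.
have mN : (m < (maxn m n).+1)%N by rewrite ltnS leq_maxl.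
have nN : (n < (maxn m n).+1)%N by rewrite ltnS leq_maxr.
rewrite (bigD1 (Ordinal mN))//= (bigD1 (Ordinal nN))//= -addrA lerDl addr_ge0//.
  by apply: sumr_ge0 => i _; exact: sqr_ge0.
by apply: sumr_ge0 => i _; apply: sumr_ge0 => j _; exact: sqr_ge0.
Qed.

Lemma l2le_ge0 a B : l2le a B -> 0 <= B.
Proof. by move=> /(_ 0%N); exact/le_trans/sq_ge0. Qed.

(** The sums over squares increase, so one that is within [e] of their supremum leaves at most [e]
    for every later tail. *)
Lemma ell2_tail a (e : R) : ell2 a -> 0 < e -> exists N0, forall N, (N0 <= N)%N ->
  l2le (sub2 a (trunc N a)) e.
Proof.
move=> [B hB] e0; pose S := [set sq N a | N in setT].
have hS : has_sup S by split; [exists (sq 0 a), 0%N|exists B => _ [N _ <-]].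
have [_ [N0 _ <-] hN0] := sup_adherent e0 hS.
exists N0 => N N0N M.
have [NM|MN] := leqP N M.
  rewrite sq_tail// lerBlDl.
  have : sq M a <= sup S by apply: ub_le_sup; [exact: (proj2 hS)|exists M].
  have := sq_mono a N0N; lra.
rewrite (_ : sq M _ = 0) ?ltW//; rewrite /sq big1// => m _; rewrite big1// => n _.
by rewrite /sub2 /trunc !(ltn_trans (ltn_ord _) MN) subrr nm0 expr0n.
Qed.

Definition l2dot a b : C := Clim (fun N => csum N a b).

Lemma l2dot_lim a b (l : C) : clim (fun N => csum N a b) l -> l2dot a b = l.
Proof. exact: ClimE. Qed.

Lemma csum_cvg a b : ell2 a -> ell2 b -> clim (fun N => csum N a b) (l2dot a b).
Proof.
move=> ha hb; apply: clim_Clim => e e0.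
have [n hn] := ell2_tail ha e0; have [m hm] := ell2_tail hb e0.
exists (maxn n m) => N hN; rewrite -csum_tail//.
have := nm_csum N (sub2 a (trunc (maxn n m) a)) (sub2 b (trunc (maxn n m) b)) (@ltr01 R).
have := hn _ (leq_maxl n m) N; have := hm _ (leq_maxr n m) N.
rewrite mul1r invr1 mul1r; lra.
Qed.

Lemma l2le_sub a b A B : l2le a A -> l2le b B -> l2le (sub2 a b) (2 * (A + B)).
Proof.
move=> hA hB N; have : sq N (sub2 a b) <= 2 * (sq N a + sq N b).
  rewrite /sq -big_split mulr_sumr; apply: ler_sum => m _.
  rewrite -big_split mulr_sumr; apply: ler_sum => n _; rewrite /sub2 /=.
  have := nmB (a m n) (b m n); have := nm_ge0 (a m n - b m n).
  have := sqr_ge0 (nm (a m n) - nm (b m n)).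
  set x := nm _; set y := nm _; set z := nm _ => h1 h2 h3.
  have : z ^+ 2 <= (x + y) ^+ 2 by rewrite lerXn2r ?nnegrE// (le_trans h2).
  by rewrite sqrrD; move: h1; rewrite sqrrB; lra.
by have := hA N; have := hB N; lra.
Qed.

Lemma ell2_sub a b : ell2 a -> ell2 b -> ell2 (sub2 a b).
Proof. by move=> [A hA] [B hB]; exists (2 * (A + B)); exact: l2le_sub. Qed.

Lemma ell2Z (l : C) a : ell2 a -> ell2 (fun m n => l * a m n).
Proof.
move=> [A hA]; exists (nm l ^+ 2 * A) => N.
rewrite (_ : sq N _ = nm l ^+ 2 * sq N a) ?ler_wpM2l ?sqr_ge0//.
rewrite /sq mulr_sumr; apply: eq_bigr => m _; rewrite mulr_sumr; apply: eq_bigr => n _.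
by rewrite nmM exprMn.
Qed.

Lemma ell2_trunc N a : ell2 (trunc N a).
Proof.
exists (sq N a) => M; have [NM|/ltnW MN] := leqP N M; first by rewrite sq_trunc.
by rewrite -(sq_trunc a (leqnn N)) sq_mono.
Qed.

Lemma l2dotBl a b c : ell2 a -> ell2 b -> ell2 c ->
  l2dot (sub2 a b) c = l2dot a c - l2dot b c.
Proof.
move=> ha hb hc; apply: l2dot_lim; apply: clim_eq (climB (csum_cvg ha hc) (csum_cvg hb hc)) => N.
by rewrite csumBl.
Qed.

Lemma l2dotZl (l : C) a c : ell2 a -> ell2 c -> l2dot (fun m n => l * a m n) c = l * l2dot a c.
Proof.
move=> ha hc; apply: l2dot_lim; apply: clim_eq (climMl l (csum_cvg ha hc)) => N.
by rewrite csumZl.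
Qed.

Lemma l2dotJ a b : ell2 a -> ell2 b -> cj (l2dot a b) = l2dot b a.
Proof.
move=> ha hb; apply/esym/l2dot_lim; apply: clim_eq (climJ (csum_cvg ha hb)) => N.
by rewrite csumJ.
Qed.

Lemma l2dot_diff a a' b b' : ell2 a -> ell2 a' -> ell2 b -> ell2 b' ->
  l2dot a' b' - l2dot a b = - (l2dot (sub2 a a') b + cj (l2dot (sub2 b b') a')).
Proof.
move=> ha ha' hb hb'; rewrite (l2dotBl ha ha' hb) (l2dotBl hb hb' ha') rmorphB /=.
by rewrite (l2dotJ hb ha') (l2dotJ hb' ha'); ring.
Qed.

Lemma l2dot_trunc N a b : l2dot (trunc N a) b = csum N a b.
Proof.
apply: l2dot_lim => e e0; exists N => M NM.
by rewrite csum_trunc// subrr nm0 ltW.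
Qed.

(* Cauchy-Schwarz from the weighted arithmetic-geometric mean inequality. *)
Lemma l2_cauchy_schwarz a b A B : l2le a A -> l2le b B -> nm (l2dot a b) ^+ 2 <= A * B.
Proof.
move=> hA hB; have A0 := l2le_ge0 hA; have B0 := l2le_ge0 hB.
have ha : ell2 a by exists A. have hb : ell2 b by exists B.
have h t : 0 < t -> 2 * nm (l2dot a b) <= t * A + t^-1 * B.
  move=> t0; have t0' : 0 < t^-1 by rewrite invr_gt0.
  rewrite -ler_pdivlMl//; apply: (clim_le (n0 := 0%N) (csum_cvg ha hb)) => N _.
  rewrite (le_trans (nm_csum N a b t0))// ler_wpM2l//.
  by rewrite lerD// ler_wpM2l// ltW.
set x := nm _ in h *; have x0 : 0 <= x := nm_ge0 _.
have [x00|xN] := eqVneq x 0; first by rewrite x00 expr0n mulr_ge0.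
have xp : 0 < x by rewrite lt_def xN.
have [A00|AN] := eqVneq A 0.
  (* With [A] zero, a large weight leaves only the second term: this one gives 2 x <= x B / (B + 1),
     impossible for positive x. *)
  exfalso; have := h (x^-1 * (B + 1)).
  rewrite A00 mulr0 add0r invfM invrK => /(_ _).
  have B1 : 0 < B + 1 by lra.
  rewrite mulr_gt0 ?invr_gt0// => /(_ isT).
  have : x * (B + 1)^-1 * B <= x.
    by rewrite -mulrA ler_piMr// ler_pdivrMl// mulr1; lra.
  lra.
have Ap : 0 < A by rewrite lt_def AN.
(* This weight makes the first term equal to [x], which cancels one of the two on the left. *)
have := h (x / A); rewrite divr_gt0// => /(_ isT).
rewrite mulfVK// invf_div => h1.
have h2 : x <= A / x * B by lra.
have h3 : x * x <= x * (A / x * B) by rewrite ler_wpM2l.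
by rewrite expr2 (le_trans h3)// le_eqVlt; apply/orP; left; apply/eqP; field.
Qed.

Lemma l2dot_small b B (e : R) : l2le b B -> 0 < e ->
  exists2 d : R, 0 < d & forall a, l2le a d -> nm (l2dot a b) <= e.
Proof.
move=> hB e0; have B0 := l2le_ge0 hB; have B1 : 0 < B + 1 by lra.
exists (e ^+ 2 / (B + 1)) => [|a ha]; first by rewrite divr_gt0// exprn_gt0.
have := l2_cauchy_schwarz ha hB => h.
have : e ^+ 2 / (B + 1) * B <= e ^+ 2.
  by rewrite -mulrA ler_piMr ?sqr_ge0// ler_pdivrMl// mulr1; lra.
by move=> /(le_trans h); rewrite ler_sqr ?nnegrE ?nm_ge0 ?(ltW e0).
Qed.

Lemma l2dot_eq0 a : ell2 a -> l2dot a a = 0 -> forall m n, a m n = 0.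
Proof.
move=> ha h m n; have := csum_cvg ha ha; rewrite h => hc.
apply/eqP; rewrite -nm_eq0 -(sqrf_eq0 (nm _)) eq_le sqr_ge0 andbT.
apply/ler_addgt0Pl => e /hc[N hN]; rewrite addr0.
apply: (@l2le_term a e) => M; rewrite (le_trans (sq_mono a (leq_maxr N M)))//.
have := hN _ (leq_maxl N M); rewrite subr0 csum_sq nm_real ger0_norm ?sq_ge0//.
Qed.

(** A Fatou property: each partial sum involves finitely many entries, so entrywise convergence
    preserves the bound. *)
Lemma l2le_lim a B (x : nat -> nat -> nat -> C) :
  (forall m n, clim (fun k => x k m n) (a m n)) ->
  (exists k0, forall k, (k0 <= k)%N -> l2le (x k) B) -> l2le a B.
Proof.
move=> hx [k0 hB] N.
suff : nm (csum N a a) <= B by rewrite csum_sq nm_real ger0_norm ?sq_ge0.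
apply: (@clim_le _ (fun k => csum N (x k) (x k)) _ _ k0) => [|k /hB/(_ N)]; last first.
  by rewrite csum_sq nm_real ger0_norm ?sq_ge0.
rewrite /csum.
have sum_lim n (F : nat -> nat -> C) (l : nat -> C) : (forall i, clim (F^~ i) (l i)) ->
    clim (fun k => \sum_(i < n) F k i) (\sum_(i < n) l i).
  move=> hF; elim: n => [|n IH].
    by rewrite big_ord0; apply: clim_eq (clim_cst 0) => k; rewrite big_ord0.
  rewrite big_ord_recr /=; apply: clim_eq (climD IH (hF n)) => k.
  by rewrite big_ord_recr.
apply: (sum_lim N (fun k m => \sum_(n < N) x k m n * cj (x k m n))
  (fun m => \sum_(n < N) a m n * cj (a m n))) => m.
apply: (sum_lim N (fun k n => x k m n * cj (x k m n)) (fun n => a m n * cj (a m n))) => n.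
move=> e e0; have hM := hx m n.
pose s := nm (a m n); have s0 : 0 <= s := nm_ge0 _.
pose d := Num.min 1 (e / (2 * s + 1)).
have d0 : 0 < d by rewrite lt_min ltr01/= divr_gt0//; lra.
have d1 : d <= 1 by rewrite ge_min lexx.
have d2 : d * (2 * s + 1) <= e by rewrite -ler_pdivlMr ?ge_min ?lexx ?orbT//; lra.
have [k1 hk] := hM _ d0; exists k1 => k /hk h.
rewrite (_ : _ - _ = (x k m n - a m n) * cj (x k m n) + a m n * cj (x k m n - a m n)); last first.
  by rewrite rmorphB; ring.
rewrite (le_trans (nmD _ _))// !nmM !nmJ -/s.
have h3 : nm (x k m n) <= s + d by have := nm_triB (x k m n) (a m n); rewrite -/s; lra.
set u := nm (x k m n - a m n) in h *; have u0 : 0 <= u := nm_ge0 _.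
have : u * nm (x k m n) <= d * (s + d) by rewrite ler_pM ?nm_ge0.
have : s * u <= s * d by rewrite ler_wpM2l.
nra.
Qed.

End SquareSummable.

#[global] Opaque l2dot.

(** * Evaluation and multiplication on coefficients *)

Section Evaluation.
Variable R : realType.
Local Notation C := R[i].
Local Notation ucT := (ucont (@d2 R) (@circ R `*` @circ R)).
Implicit Types (a b c d : nat -> nat -> C) (N : nat) (z : C * C) (F G : C * C -> C).

Definition kz z m n : C := cj (mono m n z).

Definition ev a z : C := l2dot a (kz z).

Lemma evE a z : ev a z = l2dot a (kz z). Proof. by []. Qed.

Definition inD z := nm z.1 < 1 /\ nm z.2 < 1.

Lemma csum_kz N a z : csum N a (kz z) = pol N a z.
Proof. by apply: eq_bigr => m _; apply: eq_bigr => n _; rewrite conjcK. Qed.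

Lemma geo_le N (q : R) : 0 <= q -> q < 1 -> \sum_(m < N) q ^+ m <= (1 - q)^-1.
Proof.
move=> q0 q1; have q10 : 0 < 1 - q by rewrite subr_gt0.
rewrite -[X in _ <= X]mul1r ler_pdivlMr// mulrC.
have := subrX1 q N; set S := \sum_(_ < _) _ => h.
have -> : (1 - q) * S = 1 - q ^+ N by rewrite -opprB mulNr -h opprB.
by rewrite gerBl exprn_ge0.
Qed.

Lemma l2le_kz z (r s : R) : nm z.1 <= r -> r < 1 -> nm z.2 <= s -> s < 1 ->
  l2le (kz z) ((1 - r ^+ 2)^-1 * (1 - s ^+ 2)^-1).
Proof.
move=> zr r1 zs s1 N.
have r0 : 0 <= r := le_trans (nm_ge0 _) zr; have s0 : 0 <= s := le_trans (nm_ge0 _) zs.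
have -> : sq N (kz z) = (\sum_(m < N) (nm z.1 ^+ 2) ^+ m) * (\sum_(n < N) (nm z.2 ^+ 2) ^+ n).
  rewrite /sq mulr_suml; apply: eq_bigr => m _; rewrite mulr_sumr; apply: eq_bigr => n _.
  by rewrite nmJ nmM !nmX exprMn -!exprM ![(2 * _)%N]mulnC.
have g (x t : R) : 0 <= x -> x <= t -> t < 1 -> \sum_(m < N) (x ^+ 2) ^+ m <= (1 - t ^+ 2)^-1.
  move=> x0 xt t1; have t0 := le_trans x0 xt.
  have t21 : t ^+ 2 < 1 by rewrite expr_lt1.
  apply: le_trans (geo_le N (sqr_ge0 t) t21); apply: ler_sum => m _.
  by rewrite lerXn2r ?nnegrE ?sqr_ge0// lerXn2r.
by rewrite ler_pM ?g ?nm_ge0//; apply: sumr_ge0 => i _; rewrite exprn_ge0 ?sqr_ge0.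
Qed.

Lemma ell2_kz z : inD z -> ell2 (kz z).
Proof. by move=> [z1 z2]; eexists; exact: (l2le_kz (lexx _) z1 (lexx _) z2). Qed.

Lemma pol_cvg a z : ell2 a -> inD z -> clim (fun N => pol N a z) (ev a z).
Proof.
move=> ha hz; apply: clim_eq (csum_cvg ha (ell2_kz hz)) => N; exact: csum_kz.
Qed.

Lemma ev_trunc N a z : ev (trunc N a) z = pol N a z.
Proof. by rewrite /ev l2dot_trunc csum_kz. Qed.

Lemma ev_sub a b z : ell2 a -> ell2 b -> inD z -> ev (sub2 a b) z = ev a z - ev b z.
Proof. by move=> ha hb hz; rewrite /ev l2dotBl//; exact: ell2_kz. Qed.

Lemma pol_scale N a (r : C) x y :
  pol N a (r * x, r * y) = pol N (fun m n => a m n * r ^+ (m + n)) (x, y).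
Proof.
apply: eq_bigr => m _; apply: eq_bigr => n _.
by rewrite /mono/= !exprMn exprD; ring.
Qed.

(** On the torus of radius 1/2 a partial sum is minus the evaluation of the tail, hence uniformly
    small by Cauchy-Schwarz; its Fourier coefficients are the entries of [a] times powers of 1/2. *)
Lemma ev_eq0 a : ell2 a -> (forall z, inD z -> ev a z = 0) -> forall m n, a m n = 0.
Proof.
move=> ha h m n; pose r : R := 2^-1.
have r0 : 0 < r by rewrite invr_gt0.
have r1 : r < 1 by rewrite invf_lt1// ltr1n.
suff : a m n * (r%:C) ^+ (m + n) = 0.
  by move/eqP; rewrite mulf_eq0 => /orP[/eqP//|]; rewrite expf_eq0 eq_complex /= (gt_eqF r0) andbF.
apply: nm_small0 => e e0.
have hk z : nm z.1 <= r -> nm z.2 <= r -> l2le (kz z) ((1 - r ^+ 2)^-1 * (1 - r ^+ 2)^-1).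
  by move=> z1 z2; exact: l2le_kz.
have B0 : l2le (kz (0, 0)) ((1 - r ^+ 2)^-1 * (1 - r ^+ 2)^-1).
  by apply: hk; rewrite /= nm0 ltW.
pose B := (1 - r ^+ 2)^-1 * (1 - r ^+ 2)^-1; have Bge : 0 <= B := l2le_ge0 B0.
have dpos : 0 < e ^+ 2 / (B + 1) by rewrite divr_gt0 ?exprn_gt0//; lra.
have [N0 hN] := ell2_tail ha dpos; pose N := maxn N0 (maxn m n).+1.
have N0N : (N0 <= N)%N by rewrite leq_maxl.
have mN : (m < N)%N by rewrite (leq_trans _ (leq_maxr _ _))// ltnS leq_maxl.
have nN : (n < N)%N by rewrite (leq_trans _ (leq_maxr _ _))// ltnS leq_maxr.
have := cf_pol N (fun m n => a m n * r%:C ^+ (m + n)) m n; rewrite mN nN /= => <-.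
have uP := ucT_pol N (fun m n => a m n * r%:C ^+ (m + n)).
apply: mean2_bound => [|x y cx cy].
  by apply: ucontM => //; apply: ucontJ; exact: ucT_mono.
rewrite nmM nmJ nm_mono// mulr1 -pol_scale.
set z := (_, _); have nz (t : C) : circ t -> nm (r%:C * t) = r.
  by move=> ct; rewrite nmM ct mulr1 nm_real gtr0_norm.
have hz : inD z by rewrite /inD /= !nz.
have ht : ell2 (trunc N a) := ell2_trunc N a.
have -> : pol N a z = - ev (sub2 a (trunc N a)) z.
  by rewrite ev_sub// h// ev_trunc sub0r opprK.
rewrite nmN; have := l2_cauchy_schwarz (hN _ N0N) (hk z _ _); rewrite /= !nz// -/B.
move=> /(_ (lexx _) (lexx _)) CS.
have : e ^+ 2 / (B + 1) * B <= e ^+ 2.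
  rewrite -mulrA ler_piMr ?sqr_ge0// ler_pdivrMl; last by lra.
  by rewrite mulr1; lra.
by move=> /(le_trans CS); rewrite ler_sqr ?nnegrE ?nm_ge0 ?(ltW e0).
Qed.

Lemma l2le_cf F : ucT F -> l2le (cf F) (nm (ip F F)).
Proof.
move=> uF N; have h := bessel N uF.
have := nm_ge0_le (csum_ge0 N (cf F)) h; rewrite csum_sq nm_real.
exact/le_trans/ler_norm.
Qed.

Lemma ell2_cf F : ucT F -> ell2 (cf F).
Proof. by move=> uF; exists (nm (ip F F)); exact: l2le_cf. Qed.

Lemma ev_cf F z : hol2 F -> inD z -> ev (cf F) z = F z.
Proof.
move=> hF hz; apply: (clim_unique (pol_cvg (ell2_cf (hol2_ucT hF)) hz)).
by case: hz => z1 z2; exact: hol2_taylor.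
Qed.

Lemma l2dot_cf F G : hol2 F -> hol2 G -> l2dot (cf F) (cf G) = ip F G.
Proof. by move=> hF hG; apply: l2dot_lim; exact: parseval. Qed.

Lemma cfB F G m n : ucT F -> ucT G -> cf (fun p => F p - G p) m n = cf F m n - cf G m n.
Proof.
move=> uF uG; have uJ : ucT (fun p => cj (mono m n p)) by apply: ucontJ; exact: ucT_mono.
rewrite /cf -mean2B; [|exact: ucontM..].
by apply: eq_mean2 => x y _ _; rewrite mulrBl.
Qed.

End Evaluation.

(** * Multiplication by a function that is unimodular on the torus *)

Section Multiplier.
Variable R : realType.
Local Notation C := R[i].
Local Notation ucT := (ucont (@d2 R) (@circ R `*` @circ R)).
Implicit Types (a b c d : nat -> nat -> C) (N : nat) (z : C * C).
Variable G : C * C -> C.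
Hypotheses (hG : hol2 G) (G1 : forall x y, circ x -> circ y -> nm (G (x, y)) = 1).

Definition mcoef_ N a := cf (fun p => G p * pol N a p).

(** Coefficients of [G] times the function with coefficients [a]. Only polynomials can be multiplied
    by [G] on the torus, so the product is an entrywise limit along truncations. *)
Definition mcoef a m n : C := Clim (fun N => mcoef_ N a m n).

Let hol2_mulp N a : hol2 (fun p => G p * pol N a p).
Proof. by apply: hol2M => //; exact: hol2_pol. Qed.

Let ucT_mulp N a : ucT (fun p => G p * pol N a p). Proof. exact: hol2_ucT. Qed.

Lemma ip_mul F H : ip (fun p => G p * F p) (fun p => G p * H p) = ip F H.
Proof.
apply: eq_mean2 => x y cx cy; rewrite rmorphM /=.
transitivity ((G (x, y) * cj (G (x, y))) * (F (x, y) * cj (H (x, y)))); first by ring.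
by rewrite nm1_mulJ ?G1// mul1r.
Qed.

Lemma mcoef_dot N a b : l2dot (mcoef_ N a) (mcoef_ N b) = csum N a b.
Proof. by rewrite l2dot_cf// ip_mul ip_pol. Qed.

Lemma l2le_mcoef_ N a : l2le (mcoef_ N a) (sq N a).
Proof.
have := l2le_cf (ucT_mulp N a).
by rewrite ip_mul ip_pol csum_sq nm_real ger0_norm ?sq_ge0.
Qed.

Lemma pol_trunc N M a p : (N <= M)%N -> pol M (trunc N a) p = pol N a p.
Proof. by move=> NM; rewrite -!csum_kz csum_trunc. Qed.

Lemma mcoef_sub N M a : (N <= M)%N ->
  sub2 (mcoef_ M a) (mcoef_ N a) = mcoef_ M (sub2 a (trunc N a)).
Proof.
move=> NM; apply/funext => m; apply/funext => n; rewrite /sub2 /mcoef_ -cfB//.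
apply: eq_mean2 => x y _ _; rewrite -mulrBr; congr (_ * _ * _).
rewrite -(pol_trunc _ _ NM) /pol -sumrB; apply: eq_bigr => i _.
by rewrite -sumrB; apply: eq_bigr => j _; rewrite mulrBl.
Qed.

Lemma l2le_mcoef_sub N M a (e : R) : (N <= M)%N -> l2le (sub2 a (trunc N a)) e ->
  l2le (sub2 (mcoef_ M a) (mcoef_ N a)) e.
Proof. by move=> NM h K; rewrite mcoef_sub//; exact: le_trans (l2le_mcoef_ _ _ _) (h M). Qed.

Section Fixed.
Variable a : nat -> nat -> C.
Hypothesis ha : ell2 a.

Lemma mcoef_cvg m n : clim (fun N => mcoef_ N a m n) (mcoef a m n).
Proof.
apply: clim_Clim => e e0; have e2 : 0 < e ^+ 2 by rewrite exprn_gt0.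
have [N0 hN] := ell2_tail ha e2; exists N0 => N hN0.
have := l2le_term m n (l2le_mcoef_sub hN0 (hN _ (leqnn N0))).
by rewrite /sub2 ler_sqr ?nnegrE ?nm_ge0 ?(ltW e0).
Qed.

(** Multiplication by [G] does not increase the norm of a polynomial, so the approximations are
    Cauchy in norm, and [l2le_lim] upgrades entrywise convergence to convergence in norm. *)
Lemma mcoef_tail (e : R) : 0 < e -> exists N0, forall N, (N0 <= N)%N ->
  l2le (sub2 (mcoef a) (mcoef_ N a)) e.
Proof.
move=> e0; have [N0 hN] := ell2_tail ha e0; exists N0 => N hN0.
apply: (@l2le_lim _ _ _ (fun k => sub2 (mcoef_ k a) (mcoef_ N a))).
  by move=> m n; apply: climB; [exact: mcoef_cvg|exact: clim_cst].
by exists N => k Nk; apply: l2le_mcoef_sub => //; exact: hN.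
Qed.

Lemma ell2_mcoef : ell2 (mcoef a).
Proof.
have [B hB] := ha; exists B; apply: (@l2le_lim _ _ _ (fun k => mcoef_ k a)).
  exact: mcoef_cvg.
by exists 0%N => k _ K; exact: le_trans (l2le_mcoef_ _ _ _) (hB k).
Qed.

Lemma ev_mcoef z : inD z -> ev (mcoef a) z = G z * ev a z.
Proof.
move=> hz; have [B hB] := ell2_kz hz.
apply: (@clim_unique _ (fun N => ev (mcoef_ N a) z)).
  move=> e e0; have [d d0 hd] := l2dot_small hB e0.
  have [N0 hN] := mcoef_tail d0; exists N0 => N /hN/hd.
  have eN : ell2 (mcoef_ N a) by exact: ell2_cf.
  by rewrite -/(ev _ _) (ev_sub ell2_mcoef eN hz) nm_sym.
apply: clim_eq (climMl (G z) (pol_cvg ha hz)) => N.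
by rewrite /mcoef_ ev_cf.
Qed.

End Fixed.

Lemma l2dot_mcoef a b : ell2 a -> ell2 b -> l2dot (mcoef a) (mcoef b) = l2dot a b.
Proof.
move=> ha hb; apply: (@clim_unique _ (fun N => l2dot (mcoef_ N a) (mcoef_ N b))); last first.
  by apply: clim_eq (csum_cvg ha hb) => N; rewrite mcoef_dot.
move=> e e0; have e2 : 0 < e / 2 by rewrite divr_gt0.
have [A hA] := ha; have [B hB] := ell2_mcoef hb.
have hA' N : l2le (mcoef_ N a) A by move=> K; exact: le_trans (l2le_mcoef_ _ _ _) (hA N).
have [d1 d10 hd1] := l2dot_small hB e2.
have [N1 h1] := mcoef_tail ha d10.
have A0 : 0 <= A := l2le_ge0 hA.
have [d2 d20 hd2] : exists2 d : R, 0 < d & forall c N, l2le c d -> nm (l2dot c (mcoef_ N a)) <= e / 2.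
  have [d d0 hd] : exists2 d : R, 0 < d & d * A <= (e / 2) ^+ 2.
    exists ((e / 2) ^+ 2 / (A + 1)); first by rewrite divr_gt0 ?exprn_gt0//; lra.
    rewrite -mulrA ler_piMr ?sqr_ge0// ler_pdivrMl; last by lra.
    by rewrite mulr1; lra.
  exists d => // c N hc; have := l2_cauchy_schwarz hc (hA' N) => /le_trans/(_ hd).
  by rewrite ler_sqr ?nnegrE ?nm_ge0 ?(ltW e2).
have [N2 h2] := mcoef_tail hb d20.
exists (maxn N1 N2) => N; rewrite geq_max => /andP[/h1 k1 /h2 k2].
have ea := ell2_mcoef ha; have eb := ell2_mcoef hb.
have eaN : ell2 (mcoef_ N a) by exact: ell2_cf.
have ebN : ell2 (mcoef_ N b) by exact: ell2_cf.
rewrite (l2dot_diff ea eaN eb ebN) nmN (le_trans (nmD _ _))// nmJ.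
rewrite [e]splitr; exact: lerD (hd1 _ k1) (hd2 _ N k2).
Qed.

End Multiplier.

#[global] Opaque ev mcoef mcoef_.

(** * The Hardy space in coefficients *)

Section HardyCoefficients.
Variable R : realType.
Local Notation C := R[i].
Implicit Types (a b : nat -> nat -> C) (f g h : hardyType R).

Definition square (N : nat) : seq (nat * nat) := [seq (m, n) | m <- iota 0 N, n <- iota 0 N].

Lemma mem_square N p : (p \in square N) = (p.1 < N)%N && (p.2 < N)%N.
Proof.
case: p => m n; apply/allpairsP/andP => [[[i j] [/= hi hj [-> ->]]]|[/= hm hn]].
  by rewrite !mem_iota in hi hj.
by exists (m, n); rewrite !mem_iota.
Qed.

Lemma uniq_square N : uniq (square N).
Proof. by rewrite allpairs_uniq ?iota_uniq// => -[? ?] [? ?] _ _ [-> ->]. Qed.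

Lemma fsum_square N a :
  (\sum_(p \in [set` square N]) (nm (a p.1 p.2) ^+ 2)%:E = (sq N a)%:E)%E.
Proof.
rewrite -fsbig_seq ?uniq_square// sumEFin /square big_allpairs /sq /index_iota; congr EFin.
rewrite -(big_mkord predT (fun m => \sum_(n < N) nm (a m n) ^+ 2)) /index_iota subn0.
apply: eq_bigr => m _.
by rewrite -(big_mkord predT (fun n => nm (a m n) ^+ 2)) /index_iota subn0.
Qed.

(** Every finite set of indices lies in a square, so the supremum over finite sets and the one over
    squares agree. *)
Lemma square_summableP (a : nat * nat -> C) :
  square_summable a <-> ell2 (fun m n => a (m, n)).
Proof.
rewrite /square_summable; set S := esum _ _; split=> [S1|[B hB]].
  have S0 : (0 <= S)%E by apply: esum_ge0 => p _; rewrite lee_fin sqr_ge0.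
  exists (fine S) => N; rewrite -lee_fin fineK ?ge0_fin_numE//.
  apply: esum_ge; exists [set` square N]; first by split=> //; exact: finite_seq.
  rewrite -fsum_square le_eqVlt; apply/orP; left; apply/eqP; apply: eq_fsbigr => -[] //.
apply: (@le_lt_trans _ _ B%:E); last exact: ltry.
apply: ge_ereal_sup => _ [A [fA _] <-]; have /finite_seqP[s As] := fA.
pose N := (\max_(p <- s) maxn p.1 p.2).+1.
apply: (@le_trans _ _ (sq N (fun m n => a (m, n)))%:E); last by rewrite lee_fin.
rewrite -fsum_square (_ : (\sum_(p \in [set` square N]) _)%R =
  (\sum_(p \in [set` square N]) (nm (a p) ^+ 2)%:E)%R); last by apply: eq_fsbigr => -[].
apply: lee_fsum_nneg_subset => //; first exact: finite_seq.
  move=> p /set_mem Ap; apply/mem_set; rewrite /= mem_square.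
  have {}Ap : p \in s by move: Ap; rewrite As.
  have : (maxn p.1 p.2 <= \max_(p <- s) maxn p.1 p.2)%N by exact: leq_bigmax_seq.
  by rewrite geq_max !ltnS.
by move=> p _; rewrite lee_fin sqr_ge0.
Qed.

Lemma bidiscP (z : C * C) : bidisc R z <-> inD z.
Proof. by rewrite /bidisc /inD /= !normE !ltcR; split. Qed.

Lemma inD_val (z : bidisc R) : inD (val z).
Proof. by apply/bidiscP; have := valP z; rewrite inE. Qed.

Definition toD z (hz : inD z) : bidisc R := SigSub (mem_set (iffRL (bidiscP z) hz)).

Lemma taylor_expansionP (f : bidisc R -> C) (a : nat * nat -> C) :
  ell2 (fun m n => a (m, n)) ->
  taylor_expansion f a <-> forall z, f z = ev (fun m n => a (m, n)) (val z).
Proof.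
move=> ha; have E (z : bidisc R) : (fun N : nat => \sum_(m < N) \sum_(n < N)
    a (val m, val n) * (val z).1 ^+ m * (val z).2 ^+ n) =
    (fun N => pol N (fun m n => a (m, n)) (val z)).
  apply/funext => N; apply: eq_bigr => m _; apply: eq_bigr => n _.
  by rewrite /mono mulrA.
split=> [h z|h z].
  by have := h z; rewrite E => /climE/clim_unique; apply; exact: pol_cvg (inD_val z).
by rewrite E; apply/climE; rewrite h; exact: pol_cvg (inD_val z).
Qed.

(* Sealed, so that the unifier never compares the coefficients of two functions
   by unfolding [xget]; likewise for [mulh] and [adjh] below. *)
Fact tay_sig : {t : hardyType R -> nat -> nat -> C |
  forall f, t f = fun m n => taylor f (m, n)}.
Proof. by exists (fun f m n => taylor f (m, n)). Qed.

Definition tay := sval tay_sig.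

Lemma tayE f : tay f = fun m n => taylor f (m, n).
Proof. exact: (svalP tay_sig). Qed.

Lemma taylorP f : square_summable (taylor f) /\ taylor_expansion f (taylor f).
Proof.
have := hardy_valP f => /asboolP hf.
exact: (xgetPex (fun=> 0) hf).
Qed.

Lemma ell2_tay f : ell2 (tay f).
Proof. by rewrite tayE; have [/square_summableP h _] := taylorP f. Qed.

Lemma hardyE f z : f z = ev (tay f) (val z).
Proof.
by rewrite tayE; have [/square_summableP h /(taylor_expansionP f h) h2] := taylorP f; exact: h2.
Qed.

Lemma tay_unique f a : ell2 a -> (forall z, f z = ev a (val z)) -> tay f = a.
Proof.
move=> ha h; apply/funext => m; apply/funext => n; apply/eqP; rewrite -subr_eq0; apply/eqP.
apply: (ev_eq0 (ell2_sub (ell2_tay f) ha)) => z hz.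
rewrite (ev_sub (ell2_tay f) ha hz).
have <- : f (toD hz) = ev (tay f) z by exact: hardyE.
have -> : f (toD hz) = ev a z by exact: h.
by rewrite subrr.
Qed.

Lemma hardy_ex a : ell2 a -> exists f : hardyType R, tay f = a.
Proof.
move=> ha; have hf : (fun z : bidisc R => ev a (val z)) \in @hardy R.
  apply/asboolP; exists (fun p => a p.1 p.2); split; first exact/square_summableP.
  exact/taylor_expansionP.
by exists (HardyFun hf); apply: tay_unique.
Qed.

Lemma hardy_eq f g : (forall z, f z = g z) -> f = g.
Proof. by move=> h; apply: val_inj; apply/funext. Qed.

Lemma hardy_inj f g : tay f = tay g -> f = g.
Proof. by move=> h; apply: hardy_eq => z; rewrite (hardyE f) (hardyE g) h. Qed.

Lemma tayB f g : tay (f - g) = sub2 (tay f) (tay g).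
Proof.
apply: tay_unique => [|z]; first by apply: ell2_sub; exact: ell2_tay.
have E := ev_sub (ell2_tay f) (ell2_tay g) (inD_val z).
apply: etrans (esym E).
apply: etrans (hardy_valB f g z) _.
by congr (_ - _); exact: hardyE.
Qed.

Lemma hardy_dotE f g : hardy_dot f g = l2dot (tay f) (tay g).
Proof.
apply: cvg_lim => //; apply/climE.
by have := csum_cvg (ell2_tay f) (ell2_tay g); rewrite !tayE.
Qed.

Lemma hdotBl f g h : hardy_dot (f - g) h = hardy_dot f h - hardy_dot g h.
Proof. by rewrite !hardy_dotE tayB l2dotBl//; exact: ell2_tay. Qed.

Lemma hdotJ f g : cj (hardy_dot f g) = hardy_dot g f.
Proof. by rewrite !hardy_dotE l2dotJ//; exact: ell2_tay. Qed.

Lemma hdotBr f g h : hardy_dot h (f - g) = hardy_dot h f - hardy_dot h g.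
Proof. rewrite -(hdotJ (f - g) h) hdotBl -(hdotJ f h) -(hdotJ g h); exact: rmorphB. Qed.

Lemma hdot_eq0 f : hardy_dot f f = 0 -> f = 0.
Proof.
rewrite hardy_dotE => h; apply: hardy_inj; apply/funext => m; apply/funext => n.
rewrite (l2dot_eq0 (ell2_tay f) h) -[in RHS](subrr f) tayB /sub2 subrr//.
Qed.

Lemma hdot0 f : hardy_dot 0 f = 0.
Proof. by rewrite -(subrr f) hdotBl subrr. Qed.

Fact hfun_sig : {F : (C * C -> C) -> hardyType R | forall G, hol2 G -> tay (F G) = cf G}.
Proof.
exists (fun G => xget 0 [set f | tay f = cf G]) => G hG.
have [f hf] := hardy_ex (ell2_cf (hol2_ucT hG)).
exact: (xgetI 0 (P := [set f | tay f = cf G]) hf).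
Qed.

Definition hfun := sval hfun_sig.

Lemma tay_hfun F : hol2 F -> tay (hfun F) = cf F.
Proof. exact: (svalP hfun_sig F). Qed.

Definition kw (w : C * C) := hfun (kern w).

Lemma cf_kern (w : C * C) : inD w -> cf (kern w) = kz w.
Proof.
move=> hw; have [w1 w2] := hw; have hk := hol2_kern w1 w2.
apply/funext => m; apply/funext => n.
have hm := hol2_mono R m n.
rewrite /cf /kz -[LHS]conjcK -mean2J; last first.
  by apply: ucontM; [exact: hol2_ucT|exact/ucontJ/hol2_ucT].
rewrite [mono m n w](cauchy2 hm w1 w2) /ext2; congr cj; apply: eq_mean2 => x y _ _.
rewrite rmorphM /= conjcK mulrC /kern -!szegoJ; congr (_ * _).
by rewrite rmorphM /= !conjcK.
Qed.

Lemma tay_kw (w : C * C) : inD w -> tay (kw w) = kz w.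
Proof. by move=> hw; have [w1 w2] := hw; rewrite tay_hfun ?cf_kern//; exact: hol2_kern. Qed.

Lemma reproducing f (z : bidisc R) : hardy_dot f (kw (val z)) = f z.
Proof. by rewrite hardy_dotE hardyE tay_kw//; exact: inD_val. Qed.

End HardyCoefficients.

#[global] Opaque tay hfun.

(** * The orthogonal projections *)

Section Adjoint.
Variable R : realType.
Local Notation C := R[i].
Local Notation ucT := (ucont (@d2 R) (@circ R `*` @circ R)).
Implicit Types (a b x : nat -> nat -> C) (N : nat) (z w : C * C).

Lemma clim_sum n (X : nat -> nat -> C) (l : nat -> C) : (forall i, clim (X^~ i) (l i)) ->
  clim (fun k => \sum_(i < n) X k i) (\sum_(i < n) l i).
Proof.
move=> h; elim: n => [|n IH].
  by rewrite big_ord0; apply: clim_eq (clim_cst 0) => k; rewrite big_ord0.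
by rewrite big_ord_recr /=; apply: clim_eq (climD IH (h n)) => k; rewrite big_ord_recr.
Qed.

Lemma climMr (c : C) (X : nat -> C) l : clim X l -> clim (fun n => X n * c) (l * c).
Proof.
move=> /(climMl c) h; rewrite (mulrC l); apply: clim_eq h => n.
by rewrite mulrC.
Qed.

Lemma clim_csum N (X : nat -> nat -> nat -> C) b a :
  (forall m n, clim (fun k => X k m n) (b m n)) ->
  clim (fun k => csum N (X k) a) (csum N b a).
Proof.
move=> h; apply: (@clim_sum N (fun k m => \sum_(n < N) X k m n * cj (a m n))
  (fun m => \sum_(n < N) b m n * cj (a m n))) => m.
apply: (@clim_sum N (fun k n => X k m n * cj (a m n)) (fun n => b m n * cj (a m n))) => n.
exact: climMr.
Qed.

Lemma nm_conjB (p q : C) : nm (cj p - cj q) = nm (p - q).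
Proof. by rewrite -rmorphB nmJ. Qed.

Lemma nm_l2dot_swap x a b : ell2 x -> ell2 a -> ell2 b ->
  nm (l2dot x b - l2dot x a) = nm (l2dot a x - l2dot b x).
Proof. by move=> hx ha hb; rewrite -(l2dotJ hx ha) -(l2dotJ hx hb) nm_conjB nm_sym. Qed.

Variable G : C * C -> C.
Hypotheses (hG : hol2 G) (G1 : forall s t : C, circ s -> circ t -> nm (G (s, t)) = 1).

(** Coefficients of the adjoint of multiplication by [G], obtained by testing against the
    monomials. *)
Definition adjc x m n : C := l2dot x (cf (fun p => G p * mono m n p)).

Lemma mcoef_trunc N a : mcoef G (trunc N a) = cf (fun p => G p * pol N a p).
Proof.
apply/funext => m; apply/funext => n.
apply: (clim_unique (mcoef_cvg hG G1 (ell2_trunc N a) m n)) => e e0.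
exists N => M NM; set u := mcoef_ _ _ _ _ _; set v := cf _ _ _.
suff -> : u = v by rewrite subrr nm0 ltW.
apply: eq_mean2 => p q _ _; congr (_ * _ * _); exact: pol_trunc.
Qed.

Let hol2_mulp N a : hol2 (fun p => G p * pol N a p).
Proof. by apply: hol2M => //; exact: hol2_pol. Qed.

(** When [x] is replaced by a polynomial, both sides are torus means in which [G] can be moved to
    the other factor as its conjugate; then the degree of this polynomial tends to infinity. *)
Lemma l2dot_mcoef_trunc x N a : ell2 x -> l2dot x (mcoef G (trunc N a)) = csum N (adjc x) a.
Proof.
move=> hx; rewrite mcoef_trunc.
have uGp := hol2_ucT (hol2_mulp N a).
have uGJ : ucT (fun p => cj (G p)) by apply: ucontJ; exact: hol2_ucT.
pose X K := cf (fun p => cj (G p) * pol K x p).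
have uX K : ucT (fun p => cj (G p) * pol K x p) by apply: ucontM => //; exact: ucT_pol.
have XE K m n : X K m n = csum K x (cf (fun p => G p * mono m n p)).
  rewrite -ip_poll; last by apply: ucontM; [exact: hol2_ucT|exact: ucT_mono].
  apply: eq_mean2 => s t _ _; rewrite [cj (G (s, t) * _)]rmorphM /=; ring.
apply: (clim_unique (csum_cvg hx (ell2_cf uGp))).
apply: (@clim_eq _ (fun K => csum N (X K) a)).
  move=> K; rewrite -ip_poll// -ip_polr//.
  apply: eq_mean2 => s t _ _; rewrite [cj (G (s, t) * _)]rmorphM /=; ring.
apply: clim_csum => m n; apply: clim_eq (csum_cvg hx _) => [K|]; first by rewrite XE.
by apply: ell2_cf; apply: ucontM; [exact: hol2_ucT|exact: ucT_mono].
Qed.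

(** Testing against the truncation of [adjc x] itself: Cauchy-Schwarz bounds the square of its
    squared norm by [B] times this squared norm. *)
Lemma ell2_adjc x : ell2 x -> ell2 (adjc x).
Proof.
move=> hx; have [B hB] := hx; exists B => N.
have hm : l2le (mcoef G (trunc N (adjc x))) (sq N (adjc x)).
  by rewrite mcoef_trunc; exact: l2le_mcoef_.
have := l2_cauchy_schwarz hB hm; rewrite (l2dot_mcoef_trunc N _ hx) csum_sq nm_real.
rewrite ger0_norm ?sq_ge0// expr2.
have := sq_ge0 N (adjc x); rewrite le_eqVlt => /orP[/eqP <- _|s0]; first exact: l2le_ge0 hB.
by rewrite ler_pM2r.
Qed.

Lemma l2dot_adjc x a : ell2 x -> ell2 a -> l2dot x (mcoef G a) = l2dot (adjc x) a.
Proof.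
move=> hx ha; have [B hB] := hx; have hm := ell2_mcoef hG G1 ha.
apply: (@clim_unique _ (fun N => l2dot x (mcoef G (trunc N a)))); last first.
  apply: clim_eq (csum_cvg (ell2_adjc hx) ha) => N; by rewrite l2dot_mcoef_trunc.
move=> e e0; have [d d0 hd] := l2dot_small hB e0.
have [N0 hN] := mcoef_tail hG G1 ha d0; exists N0 => N /hN; rewrite -(mcoef_trunc N a : _ = mcoef_ G N a) => /hd.
have ht := ell2_mcoef hG G1 (ell2_trunc N a).
rewrite (l2dotBl hm ht hx) => h.
exact: etrans (congr1 (fun t => t <= e) (nm_l2dot_swap hx hm ht)) h.
Qed.

Lemma adjc_kz w : inD w -> adjc (kz w) = fun m n => cj (G w) * kz w m n.
Proof.
move=> hw; apply/funext => m; apply/funext => n; rewrite /adjc.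
have hm : hol2 (fun p => G p * mono m n p) by apply: hol2M => //; exact: hol2_mono.
rewrite -l2dotJ; [|exact: ell2_cf (hol2_ucT hm)|exact: ell2_kz].
by rewrite -evE (ev_cf hm hw) rmorphM.
Qed.

End Adjoint.

Section Projection.
Variable R : realType.
Local Notation C := R[i].
Implicit Types (f g h : hardyType R) (z w : C * C).
Variables (phi : CC R * CC R -> CC R) (G : C * C -> C).
Hypotheses (hG : hol2 G) (G1 : forall s t : C, circ s -> circ t -> nm (G (s, t)) = 1).
Hypothesis phiG : forall z, inD z -> phi z = G z.

Fact mulh_sig : {M : hardyType R -> hardyType R | forall f, tay (M f) = mcoef G (tay f)}.
Proof.
exists (fun f => xget 0 [set g | tay g = mcoef G (tay f)]) => f.
have [g hg] := hardy_ex (ell2_mcoef hG G1 (ell2_tay f)).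
exact: (xgetI 0 (P := [set g | tay g = mcoef G (tay f)]) hg).
Qed.

Definition mulh := sval mulh_sig.

Lemma tay_mulh f : tay (mulh f) = mcoef G (tay f).
Proof. exact: (svalP mulh_sig f). Qed.

Fact adjh_sig : {M : hardyType R -> hardyType R | forall f, tay (M f) = adjc G (tay f)}.
Proof.
exists (fun f => xget 0 [set g | tay g = adjc G (tay f)]) => f.
have [g hg] := hardy_ex (ell2_adjc hG G1 (ell2_tay f)).
exact: (xgetI 0 (P := [set g | tay g = adjc G (tay f)]) hg).
Qed.

Definition adjh := sval adjh_sig.

Lemma tay_adjh f : tay (adjh f) = adjc G (tay f).
Proof. exact: (svalP adjh_sig f). Qed.

Lemma mulhE f (z : bidisc R) : mulh f z = G (val z) * f z.
Proof.
apply: etrans (hardyE _ _) _; rewrite tay_mulh.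
apply: etrans (ev_mcoef hG G1 (ell2_tay f) (inD_val z)) _.
by congr (_ * _); rewrite -hardyE.
Qed.

Lemma hdot_adjh f g : hardy_dot f (mulh g) = hardy_dot (adjh f) g.
Proof.
apply: etrans (hardy_dotE _ _) _; rewrite tay_mulh.
apply: etrans (l2dot_adjc hG G1 (ell2_tay f) (ell2_tay g)) _.
by rewrite -tay_adjh; apply/esym; exact: hardy_dotE.
Qed.

Lemma hdot_mulh f g : hardy_dot (mulh f) (mulh g) = hardy_dot f g.
Proof.
rewrite (hardy_dotE (mulh f) (mulh g)).
rewrite (hardy_dotE f g).
rewrite (tay_mulh f).
rewrite (tay_mulh g).
have ef := ell2_tay f.
have eg := ell2_tay g.
exact: (l2dot_mcoef hG G1 ef eg).
Qed.

Lemma mul_hardyE g : mul_hardy phi g <-> exists h, g = mulh h.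
Proof.
split=> [[h hh]|[h ->]]; exists h.
  by apply: hardy_eq => z; rewrite hh phiG ?mulhE//; exact: inD_val.
by move=> z; rewrite mulhE phiG//; exact: inD_val.
Qed.

(** [mulh] is isometric, so f - M M^* f is orthogonal to the range of M = [mulh]. If M h is another
    such element, testing with M (h - M^* f) gives a vector of norm zero, so that h = M^* f. *)
Lemma P_E f : P_ phi f = mulh (adjh f).
Proof.
apply: xget_unique => [|g [/mul_hardyE[h ->] hh]].
  split=> [|h /mul_hardyE[k ->]]; first by apply/mul_hardyE; exists (adjh f).
  by rewrite hdotBl hdot_mulh hdot_adjh subrr.
congr mulh; apply/eqP; rewrite -subr_eq0; apply/eqP; apply: hdot_eq0.
have := hh (mulh (h - adjh f)); rewrite hdotBl hdot_mulh hdot_adjh -hdotBl => hz.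
have {}hz := hz (iffRL (mul_hardyE _) (ex_intro _ _ erefl)).
apply/eqP; rewrite -oppr_eq0; apply/eqP; apply: etrans hz.
by rewrite !hdotBl opprB.
Qed.

Lemma hdot_P f g : hardy_dot (P_ phi f) g = hardy_dot (adjh f) (adjh g).
Proof. by rewrite P_E -hdotJ hdot_adjh hdotJ. Qed.

Lemma hdot_P_sym f g : hardy_dot (P_ phi f) g = hardy_dot f (P_ phi g).
Proof. by rewrite hdot_P -[RHS]hdotJ hdot_P hdotJ. Qed.

Lemma P_kw w : inD w -> tay (P_ phi (kw w)) = fun m n => cj (G w) * cf (fun p => G p * kern w p) m n.
Proof.
move=> hw; have [w1 w2] := hw; have hk := hol2_kern w1 w2.
have hGk : hol2 (fun p => G p * kern w p) by exact: hol2M.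
have e1 := ell2_cf (hol2_ucT hGk).
apply: tay_unique => [|z]; first exact: ell2Z.
rewrite P_E mulhE hardyE tay_adjh (tay_kw hw) (adjc_kz hG hw) !evE.
rewrite (l2dotZl _ (ell2_kz hw) (ell2_kz (inD_val z))) (l2dotZl _ e1 (ell2_kz (inD_val z))).
rewrite -!evE (ev_cf hGk (inD_val z)) -(cf_kern hw) (ev_cf hk (inD_val z)).
by ring.
Qed.

End Projection.

(** * The kernel of the commutator *)

Section Kernel.
Variable R : realType.
Local Notation C := R[i].
Implicit Types (f h : hardyType R) (z w : C * C) (g : C * C -> C).

(** K k_w evaluated at [z]. The two [ip] factors are U(z,w) and conj(U(w,z)). *)
Definition comker (g1 g2 : C * C -> C) z w : C :=
  g1 z * cj (g2 w) * ip (fun p => g2 p * kern w p) (fun p => g1 p * kern z p) -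
  g2 z * cj (g1 w) * ip (fun p => g1 p * kern w p) (fun p => g2 p * kern z p).

Lemma hol2_mulkern g w : hol2 g -> inD w -> hol2 (fun p => g p * kern w p).
Proof. by move=> hg [w1 w2]; apply: hol2M => //; exact: hol2_kern. Qed.

Lemma comkerJ g1 g2 z w : hol2 g1 -> hol2 g2 -> inD z -> inD w ->
  cj (comker g1 g2 w z) = - comker g1 g2 z w.
Proof.
move=> h1 h2 hz hw.
have u g v (hg : hol2 g) (hv : inD v) := hol2_ucT (hol2_mulkern hg hv).
rewrite /comker rmorphB /= !rmorphM /= (ipJ (u g2 z h2 hz) (u g1 w h1 hw)).
rewrite (ipJ (u g1 z h1 hz) (u g2 w h2 hw)) !conjcK opprB.
by congr (_ - _); congr (_ * _); rewrite mulrC.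
Qed.

Lemma l2dotZr (l : C) (a c : nat -> nat -> C) : ell2 a -> ell2 c ->
  l2dot c (fun m n => l * a m n) = cj l * l2dot c a.
Proof.
move=> ha hc; rewrite -(l2dotJ (ell2Z l ha) hc) (l2dotZl l ha hc) rmorphM /=.
by rewrite (l2dotJ ha hc).
Qed.

Variables (phi1 phi2 : CC R * CC R -> CC R) (g1 g2 : C * C -> C).
Hypotheses (h1 : hol2 g1) (h2 : hol2 g2).
Hypothesis u1 : forall s t : C, circ s -> circ t -> nm (g1 (s, t)) = 1.
Hypothesis u2 : forall s t : C, circ s -> circ t -> nm (g2 (s, t)) = 1.
Hypothesis e1 : forall z, inD z -> phi1 z = g1 z.
Hypothesis e2 : forall z, inD z -> phi2 z = g2 z.

Local Notation K := (commutator (P_ phi1) (P_ phi2)).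

Lemma hdot_symC (S T : hardyType R -> hardyType R) :
  (forall f h, hardy_dot (S f) h = hardy_dot f (S h)) ->
  (forall f h, hardy_dot (T f) h = hardy_dot f (T h)) ->
  forall f h, hardy_dot (commutator S T f) h = - hardy_dot f (commutator S T h).
Proof.
move=> hS hT f h; have E k : commutator S T k = S (T k) - T (S k) by [].
by rewrite !E hdotBl hdotBr opprB (hS (T f) h) (hT (S f) h) (hT f) (hS f).
Qed.

Lemma hdot_symC2 (S T : hardyType R -> hardyType R) f h :
  (forall f h, hardy_dot (S f) h = hardy_dot f (S h)) ->
  (forall f h, hardy_dot (T f) h = hardy_dot f (T h)) ->
  hardy_dot (commutator S T f) h = hardy_dot (T f) (S h) - hardy_dot (S f) (T h).
Proof.
move=> hS hT; have E k : commutator S T k = S (T k) - T (S k) by [].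
by rewrite E hdotBl (hS (T f) h) (hT (S f) h).
Qed.

Lemma hdot_commutator f h : hardy_dot (K f) h = - hardy_dot f (K h).
Proof.
exact: hdot_symC (hdot_P_sym h1 u1 e1) (hdot_P_sym h2 u2 e2) f h.
Qed.

Lemma hdot_PP z w : inD z -> inD w ->
  hardy_dot (P_ phi2 (kw w)) (P_ phi1 (kw z)) =
  g1 z * cj (g2 w) * ip (fun p => g2 p * kern w p) (fun p => g1 p * kern z p).
Proof.
move=> hz hw; have k1 := hol2_mulkern h1 hz; have k2 := hol2_mulkern h2 hw.
have c1 := ell2_cf (hol2_ucT k1); have c2 := ell2_cf (hol2_ucT k2).
rewrite hardy_dotE (P_kw h1 u1 e1 hz) (P_kw h2 u2 e2 hw).
rewrite (l2dotZr _ c1 (ell2Z _ c2)) (l2dotZl _ c2 c1) (l2dot_cf k2 k1) conjcK.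
by rewrite mulrA.
Qed.

End Kernel.

Section Commutator.
Variable R : realType.
Local Notation C := R[i].
Implicit Types (f h : hardyType R) (z w : C * C) (g : C * C -> C).
Variables (phi1 phi2 : CC R * CC R -> CC R) (g1 g2 : C * C -> C).
Hypotheses (h1 : hol2 g1) (h2 : hol2 g2).
Hypothesis u1 : forall s t : C, circ s -> circ t -> nm (g1 (s, t)) = 1.
Hypothesis u2 : forall s t : C, circ s -> circ t -> nm (g2 (s, t)) = 1.
Hypothesis e1 : forall z, inD z -> phi1 z = g1 z.
Hypothesis e2 : forall z, inD z -> phi2 z = g2 z.
Local Notation K := (commutator (P_ phi1) (P_ phi2)).

Lemma commutator_kw z w (hz : inD z) : inD w -> K (kw w) (toD hz) = comker g1 g2 z w.
Proof.
move=> hw; rewrite -reproducing.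
apply: etrans (hdot_symC2 _ _ (hdot_P_sym h1 u1 e1) (hdot_P_sym h2 u2 e2)) _.
by congr (_ - _); [exact: (hdot_PP h1 h2 u1 u2 e1 e2 hz hw)|exact: (hdot_PP h2 h1 u2 u1 e2 e1 hz hw)].
Qed.

(** A commutator of symmetric operators is antisymmetric, so the value of K f at [z] is minus the
    pairing of [f] with K k_z. *)
Lemma commutator_eq0 : (forall z w, inD z -> inD w -> comker g1 g2 z w = 0) -> K = fun=> 0.
Proof.
move=> h; apply/funext => f; apply: hardy_eq => z.
rewrite -reproducing (hdot_commutator h1 h2 u1 u2 e1 e2).
have -> : K (kw (val z)) = 0.
  apply: hardy_eq => y; have hy := inD_val y.
  have -> : y = toD hy by apply: val_inj.
  rewrite (commutator_kw hy (inD_val z)) (h _ _ hy (inD_val z)).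
  by rewrite -(subrr (0 : hardyType R)) hardy_valB subrr.
by rewrite -(reproducing 0) hdot0 -hdotJ hdot0 conjc0 oppr0.
Qed.

Lemma finite_rank_comker : finite_rank K ->
  exists (n : nat) (e : 'I_n -> nat -> nat -> C), (forall i, ell2 (e i)) /\
  forall w, inD w -> exists c : 'I_n -> C, forall z, inD z ->
    comker g1 g2 z w = \sum_(i < n) c i * ev (e i) z.
Proof.
move=> [n [e he]]; exists n, (fun i => tay (e i)); split=> [i|w hw]; first exact: ell2_tay.
have : range K (K (kw w)) by exists (kw w).
rewrite he => -[c _ hc]; exists c => z hz.
rewrite -(commutator_kw hz hw) -hc hardy_val_sum; apply: eq_bigr => i _.
by rewrite hardyE.
Qed.

End Commutator.

Lemma finite_rank0 (R : realType) : finite_rank (fun _ : hardyType R => 0).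
Proof.
exists 0%N, (fun _ => 0); apply/seteqP; split=> [_ [f _ <-]|_ [c _ <-]].
  by exists (fun=> 0) => //; rewrite big_ord0.
by exists 0 => //; rewrite big_ord0.
Qed.

(** * Uniform continuity on the closed bidisc *)

Section Heine.
Variable R : realType.
Local Notation C := R[i].
Local Notation ucB := (ucont (@d2 R) (@cdisc R `*` @cdisc R)).
Local Notation B2 := (@cdisc R `*` @cdisc R).
Implicit Types (g : C * C -> C) (p q : C * C).

Definition polar2 (k : (R * R) * (R * R)) : C * C :=
  (k.1.1%:C * pt k.1.2, k.2.1%:C * pt k.2.2).

Lemma polar_dist (r r' s s' c : R) : 0 <= r' <= 1 -> `|r' - r| <= c -> `|s' - s| <= c ->
  dC (r%:C * pt s) (r'%:C * pt s') <= (1 + 4 * pi) * c.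
Proof.
move=> /andP[r0 r1] hr hs; rewrite /dC (le_trans (nm_tri (r'%:C * pt s) _ _))// mulrDl mul1r.
rewrite -mulrBl -mulrBr !nmM -rmorphB !nm_real /pt nm_ci mulr1 distrC lerD// ger0_norm//.
have := pt_lip s s'; rewrite /dC /dR /pt => h.
have p0 : 0 <= 4 * pi :> R by rewrite mulr_ge0 ?pi_ge0.
rewrite (le_trans (ler_piMl (nm_ge0 _) r1))// (le_trans h)// ler_wpM2l// distrC//.
Qed.

Lemma polar_surj (z : C) : cdisc z -> exists r s : R, [/\ 0 <= r <= 1, 0 <= s <= 1 & z = r%:C * pt s].
Proof.
move=> z1; have [->|z0] := eqVneq z 0.
  by exists 0, 0; rewrite lexx ler01 mul0r.
have n0 : nm z != 0 by rewrite nm_eq0.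
have : nm (z / (nm z)%:C) = 1 by rewrite nmM nmV nm_real ger0_norm ?nm_ge0// divff.
move=> /ci_surj[s s01 hs]; exists (nm z), s; split=> //; first by rewrite nm_ge0.
rewrite /pt -hs mulrC divfK//.
by apply/eqP => -[h]; rewrite h eqxx in n0.
Qed.

(** The closed bidisc is covered in polar coordinates by a cube, whose compactness makes the local
    moduli uniform. The constant [1 + 4 * pi] is the Lipschitz constant of polar coordinates: 1 for
    the radius, [4 * pi] for the angle. *)
Lemma heine g : (forall p, B2 p -> forall e : R, 0 < e ->
    exists2 d : R, 0 < d & forall q, B2 q -> d2 p q <= d -> nm (g p - g q) <= e) ->
  forall e : R, 0 < e -> exists2 d : R, 0 < d & forall p q, B2 p ->
    B2 q -> d2 p q <= d -> nm (g p - g q) <= e.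
Proof.
move=> hg e e0; pose I : set R := `[0, 1]%classic.
have cK : compact ((I `*` I) `*` (I `*` I)) by do !apply: compact_setX; exact: segment_compact.
pose P (d : R) k := B2 (polar2 k) -> forall q, B2 q -> d2 (polar2 k) q <= d ->
  nm (g (polar2 k) - g q) <= e.
have /compact_near_coveringP nc := cK.
have : \forall d \near (0:R)^'+, ((I `*` I) `*` (I `*` I)) `<=` P d.
  apply: nc => k0 [[/= kr1 ks1] [/= kr2 ks2]].
  rewrite /I /= in_itv /= in kr1; rewrite /I /= in_itv /= in kr2.
  have e2 : 0 < e / 2 by rewrite divr_gt0.
  have B0 : B2 (polar2 k0).
    have [/andP[a0 a1] /andP[b0 b1]] := (kr1, kr2).
    by split; rewrite /cdisc /= nmM nm_real ger0_norm// /pt nm_ci mulr1.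
  have [d d0 hd] := hg _ B0 _ e2; have d2 : 0 < d / 2 by rewrite divr_gt0.
  have p0 : 0 < 1 + 4 * pi :> R by rewrite ltr_pwDl// mulr_ge0 ?pi_ge0.
  pose c := d / 2 / (1 + 4 * pi); have c0 : 0 < c by rewrite divr_gt0.
  exists (ball k0 c, [set x | x <= d / 2]); first split.
  - exact: nbhsx_ballx.
  - by near=> x; rewrite /=; near: x; exact: nbhs_right_le.
  case=> k x [/= [[/= k1 k2] [/= k3 k4]] xd] Bk q Bq dq.
  have cE : (1 + 4 * pi) * c = d / 2 by rewrite mulrC divfK ?gt_eqF.
  have D1 := polar_dist kr1 (ltW k1) (ltW k2).
  have D2 := polar_dist kr2 (ltW k3) (ltW k4).
  rewrite cE in D1 D2.
  have T (u v w : C) : dC u w <= dC u v + dC v w by exact: nm_tri.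
  have S (u v : C) : dC u v = dC v u by exact: nm_sym.
  have n1 : nm (g (polar2 k0) - g (polar2 k)) <= e / 2.
    apply: hd => //; rewrite /d2 ge_max.
    by apply/andP; split; rewrite S; [apply: le_trans D1 _|apply: le_trans D2 _]; rewrite ler_piMr ?(ltW d0)// invf_le1 ?ler1n.
  have n2 : nm (g (polar2 k0) - g q) <= e / 2.
    apply: hd => //; move: dq; rewrite /d2 !ge_max => /andP[q1 q2].
    apply/andP; split; rewrite [d]splitr.
      by apply: le_trans (T _ (polar2 k).1 _) _; rewrite lerD ?(le_trans q1 xd)// S.
    by apply: le_trans (T _ (polar2 k).2 _) _; rewrite lerD ?(le_trans q2 xd)// S.
  rewrite (le_trans (nm_tri (g (polar2 k0)) _ _))// nm_sym [e]splitr; exact: lerD.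
move=> hn; have hp : \forall d \near (0:R)^'+, 0 < d by exact: nbhs_right_gt.
near (0:R)^'+ => d.
have hd : ((I `*` I) `*` (I `*` I)) `<=` P d by near: d.
have d0 : 0 < d by near: d.
exists d => // p q [p1 p2] Bq dpq; have [r1 [s1 [r1' s1' z1]]] := polar_surj p1.
have [r2 [s2 [r2' s2' z2]]] := polar_surj p2.
have pE : p = polar2 ((r1, s1), (r2, s2)).
  by rewrite /polar2 /= -z1 -z2 -surjective_pairing.
rewrite pE; apply: hd.
- by split; split; rewrite /I /= in_itv.
- exact: (eq_ind p (fun t => B2 t) (conj p1 p2 : B2 p) _ pE).
- exact: Bq.
- by rewrite -pE.
Unshelve. all: by end_near.
Qed.

(** Boundedness follows from uniform continuity: the segment from the origin to [p] is walked in [N]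
    steps of length at most [d], each changing [g] by at most 1. *)
Lemma ucB_of_cont g : (forall p, B2 p -> forall e : R, 0 < e ->
    exists2 d : R, 0 < d & forall q, B2 q -> d2 p q <= d -> nm (g p - g q) <= e) ->
  ucB g.
Proof.
move=> /heine hg; split=> //; have [d d0 hd] := hg 1 ltr01.
have [N hN] : exists N, 1 / d < N%:R by exists (Num.trunc (1 / d)).+1; exact: truncnS_gt.
have N0 : 0 < N%:R :> R by rewrite (le_lt_trans _ hN)// divr_ge0// ltW.
pose sc (p : C * C) (k : nat) : C * C := ((k%:R / N%:R)%:C * p.1, (k%:R / N%:R)%:C * p.2).
have sB p k : B2 p -> (k <= N)%N -> B2 (sc p k).
  have st (z : C) : nm z <= 1 -> (k <= N)%N -> nm ((k%:R / N%:R)%:C * z) <= 1.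
    move=> z1 kN; rewrite nmM nm_real ger0_norm ?divr_ge0// mulr_ile1 ?divr_ge0 ?nm_ge0//.
    by rewrite ler_pdivrMr// mul1r ler_nat.
  by move=> [p1 p2] kN; split; exact: st.
have key p k : B2 p -> (k <= N)%N -> nm (g (sc p k)) <= nm (g (0, 0)) + k%:R.
  move=> Bp; elim: k => [|k IH] kN.
    by rewrite /sc mul0r !mul0r addr0.
  have kN' := ltnW kN; have := IH kN'.
  have : nm (g (sc p k.+1) - g (sc p k)) <= 1.
    have st (z : C) : nm z <= 1 -> dC ((k.+1%:R / N%:R)%:C * z) ((k%:R / N%:R)%:C * z) <= d.
      move=> z1; rewrite /dC -mulrBl -rmorphB -mulrBl -natrB// subSnn nmM nm_real.
      rewrite ger0_norm ?divr_ge0// (le_trans (ler_piMr _ z1)) ?divr_ge0//.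
      by rewrite ler_pdivrMr// mulrC -ler_pdivrMr// ltW.
    case: (Bp) => p1 p2; apply: hd; [exact: sB|exact: sB|].
    by rewrite /d2 ge_max !st.
  move=> h1 h2; have := nmD (g (sc p k.+1) - g (sc p k)) (g (sc p k)).
  rewrite subrK -natr1; move: h1 h2; lra.
exists (nm (g (0, 0)) + N%:R) => p Bp.
have -> : p = sc p N by rewrite /sc divff ?gt_eqF// !mul1r -surjective_pairing.
exact: key.
Qed.

End Heine.

(** * Boundary values of inner functions *)

Section BoundaryData.
Variable R : realType.
Local Notation C := R[i].
Local Notation B2 := (@cdisc R `*` @cdisc R).
Implicit Types (g : C * C -> C) (phi : CC R * CC R -> CC R).

Lemma realC_gt0 (e : C) : 0 < e -> exists2 r : R, 0 < r & e = r%:C.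
Proof. by case: e => a b; rewrite ltcE /= => /andP[/eqP -> a0]; exists a. Qed.

Lemma closed_bidiscP (z : C * C) : closed_bidisc z <-> B2 z.
Proof. by rewrite /closed_bidisc /= !normE !lecR; split. Qed.

Lemma within_continuous_eps (g : CC R * CC R -> CC R) :
  {within @closed_bidisc R, continuous g} -> forall p, B2 p -> forall e : R, 0 < e ->
    exists2 d : R, 0 < d & forall q, B2 q -> d2 p q <= d -> nm (g p - g q) <= e.
Proof.
move=> /subspace_continuousP hg p /closed_bidiscP Bp e e0.
have := hg p Bp => /cvgrPdist_le/(_ e%:C); rewrite ltcR => /(_ e0).
rewrite near_withinE => /nbhs_ballP[d /realC_gt0[r r0 ->]] hr.
exists (r / 2); first by rewrite divr_gt0.
move=> q /closed_bidiscP Bq dq.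
have : `|g p - g q| <= e%:C.
  apply: hr => //; move: dq; rewrite /d2 ge_max /dC => /andP[q1 q2].
  have r2 : r / 2 < r by rewrite ltr_pdivrMr// ltr_pMr// ltr1n.
  by split; rewrite -ball_normE /= normE ltcR; exact: le_lt_trans r2.
by rewrite normE lecR.
Qed.

Lemma quotient_identity (a b A d : C) : d != 0 ->
  a - (b + A * d) = - (d * (A - d^-1 * (a - b))).
Proof. by move=> h; field. Qed.

Lemma derivable_cdiff (f : CC R -> CC R) (z : C) : derivable f z 1 -> cdiff f z.
Proof.
move=> /cvg_ex[/= A /cvgrPdist_le hA]; exists A => e e0.
have := hA e%:C; rewrite ltcR => /(_ e0).
rewrite near_withinE => /nbhs_ballP[d /realC_gt0[r r0 ->]] hr.
exists (r / 2); first by rewrite divr_gt0.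
move=> y yz; have [->|nyz] := eqVneq y z.
  by rewrite subrr mulr0 addr0 subrr nm0 mulr0.
have h0 : y - z != 0 by rewrite subr_eq0.
have r2 : r / 2 < r by rewrite ltr_pdivrMr// ltr_pMr// ltr1n.
have : `|A - ((y - z)^-1 *: (f ((y - z) *: 1 + z) - f z))| <= e%:C.
  apply: hr => //; rewrite -ball_normE /= sub0r normrN normE ltcR; exact: le_lt_trans r2.
have E : (y - z) *: (1 : CC R) + z = y.
  by rewrite -[(y - z) *: _]/((y - z) * 1) mulr1 subrK.
rewrite E normE lecR => h.
rewrite (quotient_identity (f y) (f z) A h0).
rewrite nmN nmM mulrC ler_wpM2r ?nm_ge0//.
Qed.

Lemma differentiable_slices (phi : CC R * CC R -> CC R) (x y : C) :
  differentiable phi ((x, y) : CC R * CC R) ->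
  cdiff (fun t => phi (t, y)) x /\ cdiff (fun t => phi (x, t)) y.
Proof.
move=> h; split; apply: derivable_cdiff; apply/derivable1_diffP.
  have dp := @differentiable_pair R[i] (CC R) (CC R) (CC R) (fun t => t) (cst (y : CC R)) (x : CC R)
    (@ex_diff _ _ _ _ _ _ _ (is_diff_id (x : CC R))) (differentiable_cst (y : CC R) (x : CC R)).
  exact: (@differentiable_comp R[i] (CC R) _ (CC R) (fun t : CC R => (t, y : CC R)) phi _ dp h).
have dp := @differentiable_pair R[i] (CC R) (CC R) (CC R) (cst (x : CC R)) (fun t => t) (y : CC R)
    (differentiable_cst (x : CC R) (y : CC R)) (@ex_diff _ _ _ _ _ _ _ (is_diff_id (y : CC R))).
exact: (@differentiable_comp R[i] (CC R) _ (CC R) (fun t : CC R => (x : CC R, t)) phi _ dp h).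
Qed.

Lemma bidisc_algebra_hol2 phi : bidisc_algebra phi ->
  exists g, hol2 g /\ forall z, inD z -> phi z = g z.
Proof.
move=> [hphi [g [cg gphi]]]; exists g.
have E z : inD z -> phi z = g z by move=> /bidiscP hz; rewrite gphi// inE.
split=> //; split; first exact: ucB_of_cont (within_continuous_eps cg).
move=> x y x1 y1; have /bidiscP hz : inD (x, y) by [].
have [c1 c2] := differentiable_slices (hphi _ hz).
have near (t s : C) : nm t < 1 -> nm (s - t) <= (1 - nm t) / 2 -> nm s < 1.
  by move=> t1 st; have := nmD (s - t) t; rewrite subrK; move: st t1; lra.
split.
  apply: (cdiff_near (d := (1 - nm x) / 2)) c1; first by rewrite divr_gt0// subr_gt0.
  by move=> t /(near _ _ x1) t1; apply: E.
apply: (cdiff_near (d := (1 - nm y) / 2)) c2; first by rewrite divr_gt0// subr_gt0.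
by move=> t /(near _ _ y1) t1; apply: E.
Qed.

End BoundaryData.

Section Rectangles.
Variable R : realType.

Lemma null_rectangle (a b a' b' : R) (N : set (measurableTypeR R * measurableTypeR R)) : a < b -> a' < b' ->
  measurable N -> (@lebesgue_measure R \x @lebesgue_measure R)%E N = 0%E ->
  `]a, b[%classic `*` `]a', b'[%classic `<=` N -> False.
Proof.
move=> ab ab' mN N0 sub.
have mA : measurable (`]a, b[%classic : set (measurableTypeR R)) by exact: measurable_itv.
have mB : measurable (`]a', b'[%classic : set (measurableTypeR R)) by exact: measurable_itv.
have h := subset_measure0 (measurableX mA mB) mN sub N0.
have E := product_measure1E (@lebesgue_measure R) (@lebesgue_measure R) mA mB.
have L (c d : R) : c < d -> @lebesgue_measure R `]c, d[%classic = (d - c)%:E.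
  by move=> cd; rewrite lebesgue_measure_itv /= lte_fin cd EFinB.
have := etrans (esym (congr2 (@mule R) (L _ _ ab) (L _ _ ab'))) (etrans (esym E) h).
rewrite -EFinM => -[] /eqP.
rewrite gt_eqF// mulr_gt0// subr_gt0//.
Qed.
(** Otherwise the exceptional null set would contain a rectangle of positive area. *)
Lemma ae_rectangle (a b a' b' : R) (P : R * R -> Prop) : a < b -> a' < b' ->
  {ae (lebesgue_measure \x lebesgue_measure)%E, forall t : R * R, P t} ->
   exists x y, [/\ x \in `]a, b[, y \in `]a', b'[ & P (x, y)].
Proof.
move=> ab ab' [N [mN N0 sub]]. apply: contrapT => ne.
apply: (@null_rectangle a b a' b' N ab ab' mN N0).
move=> [p q] [/= hp hq]; apply: sub => h; apply: ne; exists p, q; split=> //.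
Qed.

End Rectangles.

Section InnerUnimodular.
Variable R : realType.
Local Notation C := R[i].
Local Notation B2 := (@cdisc R `*` @cdisc R).
Local Notation ucB := (ucont (@d2 R) B2).
Variables (phi : CC R * CC R -> CC R) (g : C * C -> C).
Hypotheses (ug : ucB g) (phig : forall z, inD z -> phi z = g z).

Lemma radial_limit (s t : R) (l : C) :
  phi (r%:C * cis s, r%:C * cis t) @[r --> (1 : R)^'-] --> (l : CC R) ->
  l = g (ci s, ci t).
Proof.
move=> /cvgrPdist_le hl; apply/eqP; rewrite -subr_eq0; apply/eqP; apply: nm_small0 => e e0.
have e2 : 0 < e / 2 by rewrite divr_gt0.
have [d d0 hd] := (proj2 ug) _ e2.
have {}hl : \forall r \near (1 : R)^'-, `|l - phi (r%:C * cis s, r%:C * cis t)| <= (e / 2)%:C.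
  by apply: hl; rewrite ltcR.
near (1 : R)^'- => r.
have r1 : r < 1 by near: r; exact: nbhs_left_lt.
have r0 : 0 <= r by near: r; exact: nbhs_left_ge.
have rd : 1 - d <= r by near: r; apply: nbhs_left_ge; rewrite ltrBlDr ltrDl.
have rl : `|l - phi (r%:C * cis s, r%:C * cis t)| <= (e / 2)%:C by near: r.
have nr (u : R) : nm (r%:C * ci u) = r by rewrite nmM nm_real nm_ci mulr1 ger0_norm.
have hz : inD (r%:C * ci s, r%:C * ci t) by split; rewrite /= nr.
rewrite normE lecR (phig hz) in rl.
rewrite (le_trans (nm_tri (g (r%:C * ci s, r%:C * ci t)) _ _))// [e]splitr lerD//.
have nd (u : R) : dC (r%:C * ci u) (ci u) <= d.
  rewrite /dC -{2}[ci u]mul1r -mulrBl nmM nm_ci mulr1 nm_sym -[1 : C]/(1%:C) -rmorphB nm_real ger0_norm.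
    by move: rd; lra.
  by rewrite subr_ge0 ltW.
apply: hd.
- by split; rewrite /cdisc /= nr ltW.
- by split; rewrite /cdisc /= nm_ci.
- by rewrite /d2 ge_max !nd.
Unshelve. all: by end_near.
Qed.

(** The interval lies on one side of [x], towards the middle, because [x] may be an end point of
    [0, 2 pi]; the length is capped by [pi] to stay inside. *)
Lemma interval_near (x c : R) : 0 <= x <= 2 * pi -> 0 < c -> exists a b : R, a < b /\
  forall y, y \in `]a, b[ -> y \in `[0, 2 * pi] /\ `|y - x| <= c.
Proof.
move=> /andP[x0 x1] c0; have p0 : 0 < pi :> R := pi_gt0 R.
generalize (pi : R) p0 x1 => p p0' x1'; pose m := Num.min c p.
have m0 : 0 < m by rewrite lt_min c0.
have mc : m <= c by rewrite ge_min lexx.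
have mp : m <= p by rewrite ge_min lexx orbT.
have [xp|xp] := leP x p.
  exists x, (x + m); split; first by rewrite ltrDl.
  move=> y; rewrite !in_itv /= => /andP[y1 y2]; split; first by apply/andP; split; lra.
  by rewrite ger0_norm; lra.
exists (x - m), x; split; first by rewrite ltrBlDr ltrDl.
move=> y; rewrite !in_itv /= => /andP[y1 y2]; split; first by apply/andP; split; lra.
by rewrite ler0_norm; lra.
Qed.

Hypothesis hphi : inner phi.

(** Every small rectangle of angles contains a point with unimodular radial limit, which is the
    value of [g] there; uniform continuity rules out a value of another modulus nearby. *)
Lemma inner_unimodular (s t : C) : circ s -> circ t -> nm (g (s, t)) = 1.
Proof.
move=> cs ct; apply/eqP; rewrite -subr_eq0; apply/negPn/negP => ne.
have e0 : 0 < `|nm (g (s, t)) - 1| / 2 by rewrite divr_gt0// normr_gt0.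
have [d d0 hd] := (proj2 ug) _ e0; have d20 : 0 < d / 2 by rewrite divr_gt0.
have angle (z : C) : circ z -> exists x : R, 0 <= x <= 2 * pi /\ z = ci x.
  move=> /ci_surj[x /andP[x0 x1] ->]; exists (2 * pi * x); split=> //.
  have p0 : 0 <= 2 * pi :> R by rewrite mulr_ge0 ?pi_ge0.
  by rewrite mulr_ge0//= ler_piMr.
have [x [hx sx]] := angle _ cs; have [y [hy ty]] := angle _ ct.
have [a [b [ab hab]]] := interval_near hx d20.
have [a' [b' [ab' hab']]] := interval_near hy d20.
have [p [q [hp hq hpq]]] : exists p q, [/\ p \in `]a, b[, q \in `]a', b'[ &
    (p \in `[0, 2 * pi] /\ q \in `[0, 2 * pi]) ->
    exists l : CC R, phi (r%:C * cis p, r%:C * cis q) @[r --> (1 : R)^'-] --> l /\ `|l| = 1].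
  case: hphi => _ _ h; exact: ae_rectangle ab ab' h.
have [p1 p2] := hab p hp; have [q1 q2] := hab' q hq.
have [l [lim l1]] := hpq (conj p1 q1).
have ll := radial_limit lim.
have nl : nm l = 1 by move: l1; rewrite normE => -[].
have lip (u v : R) : `|u - v| <= d / 2 -> dC (ci v) (ci u) <= d.
  move=> uv; apply: le_trans (ci_lip _ _) _; rewrite distrC.
  by rewrite mulrC -ler_pdivlMr.
have : nm (g (s, t) - g (ci p, ci q)) <= `|nm (g (s, t)) - 1| / 2.
  apply: hd.
  - by split; exact: circ_cdisc.
  - by split; rewrite /cdisc /= nm_ci.
  - by rewrite /d2 ge_max /= sx ty !lip.
rewrite -ll => h.
have h1 : `|nm (g (s, t)) - 1| <= nm (g (s, t) - l).
  rewrite ler_norml -nl; apply/andP; split; last exact: nm_triB.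
  by rewrite lerNl opprB nm_sym; exact: nm_triB.
by move: (le_trans h1 h) e0; generalize `|nm (g (s, t)) - 1| => w; lra.
Qed.

End InnerUnimodular.

Lemma inner_boundary (R : realType) (phi : CC R * CC R -> CC R) :
  bidisc_algebra phi -> inner phi -> exists g : R[i] * R[i] -> R[i],
  [/\ hol2 g, forall s t : R[i], circ s -> circ t -> nm (g (s, t)) = 1 &
      forall z, inD z -> phi z = g z].
Proof.
move=> /bidisc_algebra_hol2[g [hg e]] hi; exists g; split=> // s t cs ct.
by apply: inner_unimodular cs ct; [exact: proj1 hg|exact: e|].
Qed.

(** * Radial limits and kernels of finite rank *)

Section RadialLimits.
Variable R : realType.
Local Notation C := R[i].
Implicit Types (f g : R -> C) (l m : C).

Definition rlim f l : Prop := forall e : R, 0 < e -> exists2 d : R, 0 < d &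
  forall r : R, 0 <= r < 1 -> 1 - r <= d -> nm (f r - l) <= e.

Lemma rlim_eq f g l : (forall r, 0 <= r < 1 -> f r = g r) -> rlim f l -> rlim g l.
Proof.
by move=> fg hf e /hf[d d0 hd]; exists d => // r r01 rd; rewrite -fg// hd.
Qed.

Lemma rlim_cst l : rlim (fun=> l) l.
Proof. by move=> e e0; exists 1 => // r _ _; rewrite subrr nm0 ltW. Qed.

Lemma rlimD f g l m : rlim f l -> rlim g m -> rlim (fun r => f r + g r) (l + m).
Proof.
move=> hf hg e e0; have e2 : 0 < e / 2 by rewrite divr_gt0.
have [a a0 ha] := hf _ e2; have [b b0 hb] := hg _ e2.
exists (Num.min a b) => [|r r01]; first by rewrite lt_min a0.
rewrite le_min => /andP[ra rb]; rewrite opprD addrACA (le_trans (nmD _ _))// [e]splitr.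
by apply: lerD; [exact: ha|exact: hb].
Qed.

Lemma rlimZ c f l : rlim f l -> rlim (fun r => c * f r) (c * l).
Proof.
move=> hf e e0; have c0 : 0 < nm c + 1 by rewrite ltr_wpDl ?nm_ge0.
have [a a0 ha] := hf _ (divr_gt0 e0 c0); exists a => // r r01 ra.
rewrite -mulrBr nmM; have := ha r r01 ra; rewrite ler_pdivlMr// => h.
rewrite (le_trans _ h)// mulrC ler_wpM2l ?nm_ge0// lerDl//.
Qed.

Lemma rlimB f g l m : rlim f l -> rlim g m -> rlim (fun r => f r - g r) (l - m).
Proof.
move=> hf hg; rewrite -mulN1r; apply: rlim_eq (rlimD hf (rlimZ (-1) hg)) => r _.
by rewrite mulN1r.
Qed.

Lemma rlimJ f l : rlim f l -> rlim (fun r => cj (f r)) (cj l).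
Proof. by move=> hf e /hf[d d0 hd]; exists d => // r r01 rd; rewrite nm_conjB hd. Qed.

Lemma rlimM f g l m : rlim f l -> rlim g m -> rlim (fun r => f r * g r) (l * m).
Proof.
move=> hf hg.
suff h0 : rlim (fun r => (f r - l) * (g r - m)) 0.
  have := rlimD (rlimD h0 (rlimZ m hf)) (rlimZ l (rlimB hg (rlim_cst m))).
  rewrite subrr mulr0 addr0 add0r mulrC; apply: rlim_eq => r _; ring.
move=> e e0; pose e1 := Num.min 1 e; have e10 : 0 < e1 by rewrite lt_min ltr01.
have [a a0 ha] := hf _ e10; have [b b0 hb] := hg _ e10.
exists (Num.min a b) => [|r r01]; first by rewrite lt_min a0.
rewrite le_min => /andP[ra rb]; rewrite subr0 nmM.
have := ha r r01 ra; have := hb r r01 rb.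
have h1 : e1 <= 1 by rewrite ge_min lexx.
have h2 : e1 <= e by rewrite ge_min lexx orbT.
move=> k1 k2; rewrite (le_trans (ler_pM _ _ k2 k1)) ?nm_ge0//.
by rewrite (le_trans _ h2)// ler_piMr// ltW.
Qed.

Lemma rlim_sum (I : Type) (s : seq I) (F : I -> R -> C) (l : I -> C) :
  (forall i, rlim (F i) (l i)) -> rlim (fun r => \sum_(i <- s) F i r) (\sum_(i <- s) l i).
Proof.
move=> h; elim: s => [|i s IH].
  by rewrite big_nil; apply: rlim_eq (rlim_cst 0) => r _; rewrite big_nil.
by rewrite big_cons; apply: rlim_eq (rlimD (h i) IH) => r _; rewrite big_cons.
Qed.

Lemma rlim_unique f l m : rlim f l -> rlim f m -> l = m.
Proof.
move=> hl hm; apply/eqP; rewrite -subr_eq0; apply/eqP; apply: nm_small0 => e e0.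
have e2 : 0 < e / 2 by rewrite divr_gt0.
have [a a0 ha] := hl _ e2; have [b b0 hb] := hm _ e2.
have ab : 0 < Num.min a b by rewrite lt_min a0.
have [r [r0 r1]] := near1 ab; rewrite le_min => /andP[ra rb].
have r01 : 0 <= r < 1 by rewrite r0.
rewrite (le_trans (nm_tri (f r) _ _))// nm_sym [e]splitr.
by apply: lerD; [exact: ha|exact: hb].
Qed.

Lemma rlim_scale (h : C -> C) (x : C) : ucont (@dC R) (@cdisc R) h -> circ x ->
  rlim (fun r => h (r%:C * x)) (h x).
Proof.
move=> uh cx e e0; have [a a0 ha] := ucont_scale uh e0; exists a => // r /andP[r0 r1] ra.
by apply: ha => //; rewrite r0 ltW.
Qed.

Lemma rlim_ext (h : C -> C) (x : C) : anT h -> circ x ->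
  rlim (fun r => ext h (r%:C * x)) (h x).
Proof.
by move=> ah cx e e0; have [a a0 ha] := ext_unif ah e0; exists a => // r r01 ra; exact: ha.
Qed.

(** The array splits into a polynomial, bounded up to the boundary, and a tail of small norm;
    against the tail the factor 1 - r^2 just compensates the squared norm of the kernel at height r
    z. *)
Lemma decay_sq (a : nat -> nat -> C) (b z : C) (e : R) : ell2 a -> nm b < 1 -> circ z -> 0 < e ->
  exists2 d : R, 0 < d & forall r : R, 0 <= r < 1 -> 1 - r <= d ->
    (1 - r ^+ 2) * nm (ev a (b, r%:C * z)) ^+ 2 <= e.
Proof.
move=> ha b1 cz e0; have b2 : 0 < 1 - nm b ^+ 2 by rewrite subr_gt0 expr_lt1 ?nm_ge0.
have e40 : 0 < e / 4 * (1 - nm b ^+ 2) by rewrite mulr_gt0// divr_gt0.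
have [N hN] := ell2_tail ha e40; have {hN} := hN N (leqnn N) => hN.
have [M M0 hM] := ucont_pos (ucB_pol N a).
(* From 1 - r^2 <= 2 (1 - r) <= 2 d, the polynomial part contributes at most 2 d M^2 = e / 4. *)
pose d := e / (8 * M ^+ 2); have d0 : 0 < d by rewrite divr_gt0// mulr_gt0// exprn_gt0.
exists d => // r r01 rd; have /andP[r0 r1] := r01.
set w := (b, r%:C * z); have nr : nm (r%:C * z) = r by rewrite nmM cz mulr1 nm_real ger0_norm.
have hw : inD w by split => //=; rewrite nr.
have r2 : 0 < 1 - r ^+ 2 by rewrite subr_gt0 expr_lt1.
have hk : l2le (kz w) ((1 - nm b ^+ 2)^-1 * (1 - r ^+ 2)^-1) by apply: l2le_kz => //=; rewrite nr.
have := l2_cauchy_schwarz hN hk; rewrite -evE (ev_sub ha (ell2_trunc N a) hw) ev_trunc.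
set x := ev a w; set y := pol N a w => h1.
have h2 : nm y <= M by apply: hM; split; rewrite /cdisc /= ?nr ltW.
have h3 : (1 - r ^+ 2) * nm (x - y) ^+ 2 <= e / 4.
  rewrite -ler_pdivlMl// (le_trans h1)// le_eqVlt; apply/orP; left; apply/eqP.
  by field; rewrite !gt_eqF.
have h4 : (1 - r ^+ 2) * nm y ^+ 2 <= e / 4.
  have k1 : nm y ^+ 2 <= M ^+ 2 by rewrite ler_sqr ?nnegrE ?nm_ge0// ltW.
  have k2 : 1 - r ^+ 2 <= 2 * d by move: r0 r1 rd; nra.
  apply: (le_trans (ler_pM (ltW r2) (sqr_ge0 _) k2 k1)).
  rewrite le_eqVlt; apply/orP; left; apply/eqP; rewrite /d.
  by field; rewrite gt_eqF.
have h5 : nm x ^+ 2 <= 2 * (nm (x - y) ^+ 2 + nm y ^+ 2).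
  have := nmD (x - y) y; rewrite subrK; have := nm_ge0 x; have := nm_ge0 (x - y); have := nm_ge0 y.
  move: (nm x) (nm y) (nm (x - y)) => p q s q0 s0 p0 pq.
  have : p ^+ 2 <= (s + q) ^+ 2 by rewrite ler_sqr ?nnegrE// addr_ge0.
  by have := sqr_ge0 (s - q); nra.
apply: (le_trans (ler_wpM2l (ltW r2) h5)).
rewrite mulrCA mulrDr; apply: (le_trans (ler_wpM2l (ler0n _ 2) (lerD h3 h4))).
by clear; lra.
Qed.

Lemma rlim_decay (a a' : nat -> nat -> C) (b b' z : C) : ell2 a -> ell2 a' ->
  nm b < 1 -> nm b' < 1 -> circ z ->
  rlim (fun r => (1 - r ^+ 2)%:C * (ev a (b, r%:C * z) * cj (ev a' (b', r%:C * z)))) 0.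
Proof.
move=> ha ha' b1 b1' cz e e0.
have [d d0 hd] := decay_sq ha b1 cz e0; have [d' d0' hd'] := decay_sq ha' b1' cz e0.
exists (Num.min d d') => [|r r01]; first by rewrite lt_min d0.
rewrite le_min => /andP[/(hd r r01) h /(hd' r r01) h']; rewrite subr0 nmM nm_real.
have /andP[r0 r1] := r01; have r2 : 0 <= 1 - r ^+ 2 by rewrite subr_ge0 expr_le1// ltW.
rewrite ger0_norm//; apply: (le_trans (ler_wpM2l r2 (nm_sq_sum _ _))).
rewrite (nmJ (ev a' _)) mulrCA mulrDr; exact: (half_le h h').
Qed.

End RadialLimits.

Section FiniteRankKernel.
Variable R : realType.
Local Notation C := R[i].
Implicit Types (z w : C * C).
Variables (D : set (C * C)) (K : C * C -> C * C -> C) (n : nat) (E : 'I_n -> C * C -> C).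
Hypothesis KJ : forall z w, D z -> D w -> K z w = - cj (K w z).
Hypothesis KE : forall w, D w -> exists c : 'I_n -> C, forall z, D z ->
  K z w = \sum_(i < n) c i * E i z.

Let Ev z : 'rV[C]_n := \row_i E i z.
Let P (r : nat) := `[< exists m (p : 'I_m -> C * C), (forall i, D (p i)) /\
  \rank (\matrix_(i < m) Ev (p i)) = r >].

(* A family of points [p i] with [E] of maximal rank determines the whole kernel. *)
Lemma finite_rank_form : exists A : 'I_n -> 'I_n -> C, forall z w, D z -> D w ->
  K z w = \sum_(k < n) \sum_(l < n) A k l * (E k z * cj (E l w)).
Proof.
have Pex : exists r, P r.
  pose p0 (_ : 'I_0) : C * C := (0, 0).
  exists (\rank (\matrix_(i < 0) Ev (p0 i))).
  by apply/asboolP; exists 0%N, p0; split=> // -[].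
have Pb r : P r -> (r <= n)%N by move=> /asboolP[m [p [_ <-]]]; exact: rank_leq_col.
case: (ex_maxnP Pex Pb) => r /asboolP[m [p [Dp Mr]]] rmax.
set M := \matrix_(i < m) _ in Mr.
have sub z : D z -> (Ev z <= M)%MS.
  move=> Dz; pose p' (i : 'I_(m + 1)) := match fintype.split i with inl j => p j | inr _ => z end.
  have ME : \matrix_(i < m + 1) Ev (p' i) = col_mx M (Ev z).
    apply/matrixP => i j; rewrite !mxE /p'; case: (fintype.split i) => k; by rewrite !mxE.
  have := rmax (\rank (\matrix_(i < m + 1) Ev (p' i))).
  have -> : P (\rank (\matrix_(i < m + 1) Ev (p' i))).
    by apply/asboolP; exists (m + 1)%N, p'; split=> // i; rewrite /p'; case: (fintype.split i).
  rewrite ME -Mr => /(_ isT) h; have : (M <= col_mx M (Ev z))%MS by rewrite -addsmxE addsmxSl.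
  move=> /mxrank_leqif_sup[_ hs]; have : (col_mx M (Ev z) <= M)%MS.
    rewrite -hs eqn_leq h andbT mxrankS// -addsmxE; exact: addsmxSl.
  by rewrite col_mx_sub => /andP[].
pose L := pinvmx M.
(* For fixed [w] the kernel is a linear function of [Ev z], and [L] recovers the coordinates of
   [Ev z] in the rows of [M], again linearly. *)
have repr z w : D z -> D w -> K z w = \sum_(i < m) (Ev z *m L) 0 i * K (p i) w.
  move=> Dz Dw; have [c hc] := KE Dw; pose cc : 'cV[C]_n := \col_i c i.
  have EK y : D y -> (Ev y *m cc) 0 0 = K y w.
    by move=> Dy; rewrite hc// mxE; apply: eq_bigr => i _; rewrite !mxE mulrC.
  rewrite -(EK _ Dz) -{1}(mulmxKpV (sub _ Dz)) -(mulmxA (Ev z *m L) M cc) mxE.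
  apply: eq_bigr => i _.
  congr (_ * _); rewrite -(EK _ (Dp i)) !mxE; apply: eq_bigr => j _; by rewrite !mxE.
(* Antisymmetry turns the expansion in the first argument into one in the second; this gives the
   dependence on [w], about which [KE] says nothing. *)
have cfs i : exists d : 'I_n -> C, forall w, D w -> K (p i) w = \sum_(l < n) d l * cj (E l w).
  have [c hc] := KE (Dp i); exists (fun l => - cj (c l)) => w Dw.
  rewrite (KJ (Dp i) Dw) hc// rmorph_sum -sumrN; apply: eq_bigr => l _.
  by rewrite rmorphM mulNr.
have [d hd] := choice cfs.
exists (fun k l => \sum_(i < m) L k i * d i l) => z w Dz Dw.
rewrite (repr _ _ Dz Dw).
transitivity (\sum_(i < m) \sum_(k < n) \sum_(l < n) L k i * d i l * (E k z * cj (E l w))).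
  apply: eq_bigr => i _; rewrite hd// mxE mulr_suml; apply: eq_bigr => k _.
  by rewrite mulr_sumr; apply: eq_bigr => l _; rewrite !mxE; ring.
rewrite exchange_big; apply: eq_bigr => k _; rewrite exchange_big; apply: eq_bigr => l _.
by rewrite mulr_suml.
Qed.

(** The n + 1 columns are combinations of n functions, so their coefficient rows are linearly
    dependent. *)
Lemma dependent_columns (w : 'I_n.+1 -> C * C) : (forall j, D (w j)) ->
  exists c : 'I_n.+1 -> C, (exists j, c j != 0) /\
  forall z, D z -> \sum_j c j * K z (w j) = 0.
Proof.
move=> Dw; have [d hd] := choice (fun j => KE (Dw j)).
pose A : 'M[C]_(n.+1, n) := \matrix_(j, i) d j i.
have : kermx A != 0.
  rewrite -mxrank_eq0 mxrank_ker subn_eq0 -ltnNge ltnS; exact: rank_leq_col.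
move=> /rowV0Pn[v /sub_kermxP vA v0]; exists (fun j => v 0 j); split.
  apply: contrapT => h; move: v0; apply/negP/negPn/eqP/rowP => j; rewrite mxE.
  by apply/eqP/negPn/negP => vj; apply: h; exists j.
move=> z Dz; transitivity (\sum_(i < n) (v *m A) 0 i * E i z); last first.
  by rewrite vA big1// => i _; rewrite mxE mul0r.
under [RHS]eq_bigr => i _ do rewrite mxE mulr_suml.
rewrite exchange_big; apply: eq_bigr => j _; rewrite hd// mulr_sumr.
by apply: eq_bigr => i _; rewrite mxE mulrA.
Qed.

End FiniteRankKernel.

(** * Slices of the symbol *)

Section SliceDichotomy.
Variable R : realType.
Local Notation C := R[i].
Local Notation uc := (ucont (@dC R) (@circ R)).
Local Notation ucD := (ucont (@dC R) (@cdisc R)).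
Implicit Types (f h : C -> C).

Definition runif (F : R -> C -> C) (v : C -> C) : Prop := forall e : R, 0 < e ->
  exists2 d : R, 0 < d & forall (r : R) (x : C), 0 <= r < 1 -> 1 - r <= d -> circ x ->
    nm (F r x - v x) <= e.

Lemma radial_anT f v : uc f -> uc v -> runif (fun r x => ext f (r%:C * x)) v -> anT v.
Proof.
move=> uf uv hv; split=> // k k0; apply: nm_small0 => e e0.
have [d d0 hd] := hv e e0; have [r [r0 r1 rd]] := near1 d0.
have r01 : 0 <= r < 1 by rewrite r0.
have aX := anT_X R k; have uX := proj1 aX; have ue := uc_ext r01 uf.
have h0 : mean (fun x => ext f (r%:C * x) * x ^+ k) = 0.
  by rewrite (mean_ext_mul r01 uf aX) meanX// mulr0.
rewrite -[X in nm X]subr0 -h0 -meanB; [|exact: ucontM..].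
apply: mean_bound => [|x cx]; first by apply: ucontB; exact: ucontM.
by rewrite -mulrBl nmM nmX cx expr1n mulr1 nm_sym; exact: hd.
Qed.

(** [F] is the quotient of [G] by [b], stated as a product because [b] may have zeros inside the
    disc; on the circle the inverse of [b] is its conjugate. *)
Lemma div_runif b G (F : C -> C) : ucD b -> (forall x, circ x -> nm (b x) = 1) -> ucD G ->
  (forall z, nm z < 1 -> F z * b z = G z) ->
  runif (fun r x => F (r%:C * x)) (fun x => G x * cj (b x)).
Proof.
move=> ub b1 uG hF e e0; have [M M0 hM] := ucont_pos uG.
(* The error X obeys X <= e1 + (X + M) e1. The bound 1/2 on e1 absorbs X into the left side, and
   what remains is at most e / 2. *)
pose e1 := Num.min (2^-1) (e / (2 * (M + 1))).
have M1 : 0 < 2 * (M + 1) by rewrite mulr_gt0// ltr_wpDl// ltW.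
have e10 : 0 < e1 by rewrite lt_min invr_gt0 ltr0n divr_gt0.
have e1h : e1 <= 2^-1 by rewrite ge_min lexx.
have e1e : e1 * (2 * (M + 1)) <= e by rewrite -ler_pdivlMr// ge_min lexx orbT.
have [d d0 hd] := ucont_scale ub e10; have [d' d0' hd'] := ucont_scale uG e10.
exists (Num.min d d') => [|r x r01]; first by rewrite lt_min d0.
rewrite le_min => /andP[rd rd'] cx; have /andP[r0 r1] := r01.
have r01' : 0 <= r <= 1 by rewrite r0 ltW.
have hb := hd r x r01' rd cx; have hG := hd' r x r01' rd' cx.
set y := r%:C * x in hb hG *; have ny : nm y < 1 by rewrite nmM cx mulr1 nm_real ger0_norm.
have Fy := hF y ny; have Gx := hM x (circ_cdisc cx).
have E : F y - G x * cj (b x) = (F y * b x - G x) * cj (b x).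
  by rewrite mulrBl -mulrA (nm1_mulJ (b1 x cx)) mulr1.
rewrite E nmM nmJ b1// mulr1.
have E2 : F y * b x - G x = (G y - G x) - F y * (b y - b x) by rewrite -Fy; ring.
have h1 : nm (F y * b x - G x) <= e1 + nm (F y) * e1.
  rewrite E2 (le_trans (nmB _ _))// lerD// nmM ler_wpM2l ?nm_ge0//.
have h2 : nm (F y) <= nm (F y * b x - G x) + M.
  have := nmD (F y * b x - G x) (G x); rewrite subrK nmM b1// mulr1 => /le_trans; apply.
  by rewrite lerD2l.
move: h1 h2 e1e e1h e10; move: (nm (F y * b x - G x)) (nm (F y)) => X Y h1 h2 e1e e1h e10.
have : Y * e1 <= (X + M) * e1 by rewrite ler_wpM2r// ltW.
have : 0 <= Y * e1 -> X * e1 <= X * 2^-1 \/ X < 0.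
  by move=> _; have [X0|X0] := leP 0 X; [left; rewrite ler_wpM2l|right].
have [X0|X0] := leP 0 X; last by move: M0; nra.
have : X * e1 <= X * 2^-1 by rewrite ler_wpM2l.
by move: e1e h1; lra.
Qed.

Lemma cross_elim (B1 B2 ez fz x1 x2 y1 y2 K1 K2 L1 L2 : C) :
  B1 * (ez * x1 + K1) = B2 * (fz * y1 + L1) -> B1 * (ez * x2 + K2) = B2 * (fz * y2 + L2) ->
  (x1 * y2 - x2 * y1) * (ez * B1) = (L1 * y2 - L2 * y1) * B2 - (K1 * y2 - K2 * y1) * B1.
Proof.
move=> e1 e2; apply/eqP; rewrite -subr_eq0; apply/eqP.
transitivity (y2 * (B1 * (ez * x1 + K1) - B2 * (fz * y1 + L1)) -
  y1 * (B1 * (ez * x2 + K2) - B2 * (fz * y2 + L2))); first by ring.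
by rewrite e1 e2 !subrr !mulr0 subrr.
Qed.

Section Slice.
Variables b1 b2 : C -> C.
Hypotheses (d1 : dalg b1) (d2 : dalg b2).
Hypothesis n1 : forall x, circ x -> nm (b1 x) = 1.
Let u x := b2 x * cj (b1 x).
Let uu : uc u.
Proof. by apply: ucontM; [exact: uc_D (proj1 d2)|apply: ucontJ; exact: uc_D (proj1 d1)]. Qed.
Let uJ : uc (fun x => cj (u x)). Proof. exact: ucontJ. Qed.

(** The analogue of U(be, al) in one variable, for the symbol [v]. By partial fractions
    ([szego_prod]) it splits into a function of [be] and a function of [al], up to the factor 1 - be
    conj(al). *)
Definition sliceL (v : C -> C) (be al : C) : C := mean (fun x => v x * (szego be x * cj (szego al x))).

Lemma szego_prod (be al x : C) : nm be < 1 -> nm al < 1 -> circ x ->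
  (1 - be * cj al) * (szego be x * cj (szego al x)) = szego be x + cj (szego al x) - 1.
Proof.
move=> b1' a1 cx; rewrite szegoJ /szego.
have k1 : 1 - be * cj x != 0 by apply: nm_lt1_neq; rewrite nmJ cx mulr1.
have k2 : 1 - cj al * x != 0 by apply: nm_lt1_neq; rewrite nmJ cx mulr1.
have : x * cj x = 1 by rewrite mulJ cx expr1n.
move: (cj x) (cj al) k1 k2 => t a k1 k2 xt.
have -> : 1 - be * a = (1 - be * t) + (1 - a * x) - (1 - be * t) * (1 - a * x) +
   (be * a) * (x * t - 1) by ring.
by rewrite xt subrr mulr0 addr0; field; rewrite k1 k2.
Qed.

Lemma ext_conj v z : uc v -> nm z < 1 ->
  ext (fun x => cj (v x)) z = cj (mean (fun x => v x * cj (szego z x))).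
Proof.
move=> uv z1; rewrite /ext -meanJ; last by apply: ucontM => //; apply: ucontJ; exact: uc_szego.
by apply: eq_mean => x _; rewrite rmorphM /= conjcK.
Qed.

Lemma sliceLE (v : C -> C) be al : uc v -> nm be < 1 -> nm al < 1 ->
  (1 - be * cj al) * sliceL v be al = ext v be - mean v + cj (ext (fun x => cj (v x)) al).
Proof.
move=> uv hb ha; have us := uc_szego hb; have us' := ucontJ (uc_szego ha).
have up : uc (fun x => szego be x * cj (szego al x)) by exact: ucontM.
rewrite /sliceL -meanZ; last exact: ucontM.
have E x : circ x -> (1 - be * cj al) * (v x * (szego be x * cj (szego al x))) =
    (v x * szego be x - v x) + v x * cj (szego al x).
  by move=> cx; rewrite mulrCA szego_prod//; ring.
rewrite (eq_mean E) meanD; [|by apply: ucontB => //; exact: ucontM|exact: ucontM].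
rewrite meanB//; last exact: ucontM.
by rewrite (ext_conj uv ha) conjcK.
Qed.

Hypothesis I : forall be al, nm be < 1 -> nm al < 1 ->
  b1 be * cj (b2 al) * sliceL u be al = b2 be * cj (b1 al) * cj (sliceL u al be).

Let e z := ext u z.
Let f z := ext (fun x => cj (u x)) z.
Let m := mean u.

Let I' be al : nm be < 1 -> nm al < 1 ->
  b1 be * cj (b2 al) * (e be - m + cj (f al)) = b2 be * cj (b1 al) * (f be + cj (e al) - cj m).
Proof.
move=> hb ha; rewrite -(sliceLE uu hb ha) mulrCA (I hb ha) mulrCA; congr (_ * _).
have -> : (1 - be * cj al) * cj (sliceL u al be) = cj ((1 - al * cj be) * sliceL u al be).
  by rewrite rmorphM rmorphB rmorph1 rmorphM /= conjcK (mulrC be).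
rewrite (sliceLE uu ha hb) rmorphD rmorphB /= conjcK -/(f be) -/(e al) -/m.
by rewrite addrC addrA.
Qed.

(* Two values of [al] allow to eliminate [f] from [I'], which expresses [e * b1] by
   [b2] and [b1]. If [b2] occurs, [u] is the radial limit of a combination of [e] and
   a constant; otherwise [e] is constant on the circle and, by Poisson's formula,
   [cj u] is the radial limit of [f] up to a constant. *)
Lemma slice_case (a1 a2 : C) : nm a1 < 1 -> nm a2 < 1 -> b2 a1 * b1 a2 != b2 a2 * b1 a1 ->
  anT u \/ anT (fun x => cj (u x)).
Proof.
(* Up to sign, the determinant of the two instances of [I'], viewed as linear equations in
   [e z * b1 z] and [f z * b2 z]. *)
move=> h1 h2 ne; pose D := cj (b2 a1) * cj (b1 a2) - cj (b2 a2) * cj (b1 a1).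
have D0 : D != 0.
  rewrite /D -!rmorphM -rmorphB /= -nm_eq0 nmJ nm_eq0 subr_eq0 //.
pose k1 := cj (b2 a1) * (cj (f a1) - m); pose k2 := cj (b2 a2) * (cj (f a2) - m).
pose l1 := cj (b1 a1) * (cj (e a1) - cj m); pose l2 := cj (b1 a2) * (cj (e a2) - cj m).
pose ka := (k1 * cj (b1 a2) - k2 * cj (b1 a1)) / D.
pose mu := (l1 * cj (b1 a2) - l2 * cj (b1 a1)) / D.
have E z : nm z < 1 -> e z * b1 z = mu * b2 z - ka * b1 z.
  move=> hz; have i1 := I' hz h1; have i2 := I' hz h2.
  have j1 : b1 z * (e z * cj (b2 a1) + k1) = b2 z * (f z * cj (b1 a1) + l1).
    by transitivity (b1 z * cj (b2 a1) * (e z - m + cj (f a1))); [rewrite /k1; ring|rewrite i1 /l1; ring].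
  have j2 : b1 z * (e z * cj (b2 a2) + k2) = b2 z * (f z * cj (b1 a2) + l2).
    by transitivity (b1 z * cj (b2 a2) * (e z - m + cj (f a2))); [rewrite /k2; ring|rewrite i2 /l2; ring].
  apply: (mulfI D0); rewrite [LHS](cross_elim j1 j2) mulrBr /mu /ka.
  by field.
have uG : ucD (fun z => mu * b2 z - ka * b1 z).
  by apply: ucontB; (apply: ucontM; first exact: ucont_cst); [exact: proj1 d2|exact: proj1 d1].
have ru := div_runif (proj1 d1) n1 uG E.
pose v x := mu * u x - ka.
have {}ru : runif (fun r x => ext u (r%:C * x)) v.
  move=> ep /ru[d d0 hd]; exists d => // r x r01 rd cx.
  have -> : v x = (mu * b2 x - ka * b1 x) * cj (b1 x).
    by rewrite mulrBl -mulrA -(mulrA ka) (nm1_mulJ (n1 cx)) mulr1.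
  exact: hd.
have uv : uc v by apply: ucontB; [apply: ucontM => //; exact: ucont_cst|exact: ucont_cst].
have [mu0|mu0] := eqVneq mu 0; [right|left].
  pose w x := cj (u x) + cj (m + ka).
  have uw : uc w by apply: ucontD => //; exact: ucont_cst.
  have aw : anT w.
    apply: (radial_anT uJ uw) => ep ep0; have ep2 : 0 < ep / 2 by rewrite divr_gt0.
    have [d d0 hd] := ru _ ep2; have [d' d0' hd'] := poisson_unif uu ep2.
    exists (Num.min d d') => [|r x r01]; first by rewrite lt_min d0.
    rewrite le_min => /andP[rd rd'] cx; have /andP[r0 r1] := r01.
    have ny : nm (r%:C * x) < 1 by rewrite nmM cx mulr1 nm_real ger0_norm.
    have := hd' r x r01 rd' cx; rewrite (mean_mul_pk uu ny) => p1.
    have := hd r x r01 rd cx; rewrite /v mu0 mul0r add0r => p2.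
    have E3 : ext (fun t => cj (u t)) (r%:C * x) = cj (mean (fun t => u t * cj (szego (r%:C * x) t))).
      exact: ext_conj uu ny.
    rewrite /w E3 -rmorphD nm_conjB.
    set A := ext u _ in p1 p2; set B := mean _ in p1 *.
    have -> : B - (u x + (m + ka)) = (A + B - m - u x) - (A - - ka) by ring.
    by rewrite (le_trans (nmB _ _))// [ep]splitr lerD.
  apply: eq_anT (anTD aw (anT_cst (- cj (m + ka)))) => x _; rewrite /w addrK//.
have av : anT v := radial_anT uu uv ru.
apply: eq_anT (anTZ mu^-1 (anTD av (anT_cst ka))) => x _.
by rewrite /v subrK mulKf.
Qed.

(** If all the determinants vanish, then [b2] is proportional to [b1] on the circle, by radial
    limits, and [u] is constant; otherwise [slice_case] applies. *)
Lemma slice_dichotomy : anT u \/ anT (fun x => cj (u x)).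
Proof.
have [[[a1 a2] [/= h1 h2 ne]]|h] := pselect (exists a : C * C,
  [/\ nm a.1 < 1, nm a.2 < 1 & b2 a.1 * b1 a.2 != b2 a.2 * b1 a.1]).
  exact: slice_case ne.
left; apply: (eq_anT _ (anT_cst (b2 1 * cj (b1 1)))) => x cx.
have c1 : circ (1 : C) by exact: nm1.
have : b2 x * b1 1 = b2 1 * b1 x.
  have lim (p q : C -> C) y z : dalg p -> dalg q -> circ y -> circ z ->
      rlim (fun r => p (r%:C * y) * q (r%:C * z)) (p y * q z).
    by move=> dp dq cy cz; apply: rlimM; apply: rlim_scale => //; [exact: proj1 dp|exact: proj1 dq].
  apply: (rlim_unique (lim b2 b1 x 1 d2 d1 cx c1)).
  apply: rlim_eq (lim b2 b1 1 x d2 d1 c1 cx) => r /andP[r0 r1].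
  have nr (y : C) : circ y -> nm (r%:C * y) < 1 by move=> cy; rewrite nmM cy mulr1 nm_real ger0_norm.
  apply/eqP/negPn/negP => ne; apply: h; exists (r%:C * 1, r%:C * x).
  by split; [exact: nr|exact: nr|].
rewrite /u => E; have := congr1 (fun t => t * (cj (b1 1) * cj (b1 x))) E.
have -> : b2 x * b1 1 * (cj (b1 1) * cj (b1 x)) = b2 x * cj (b1 x) * (b1 1 * cj (b1 1)) by ring.
have -> : b2 1 * b1 x * (cj (b1 1) * cj (b1 x)) = b2 1 * cj (b1 1) * (b1 x * cj (b1 x)) by ring.
by rewrite !nm1_mulJ ?n1// !mulr1.
Qed.

End Slice.
End SliceDichotomy.

(** * Boundary behaviour of the kernel *)

Section KernelLimit.
Variable R : realType.
Local Notation C := R[i].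
Local Notation uc := (ucont (@dC R) (@circ R)).
Local Notation ucT := (ucont (@d2 R) (@circ R `*` @circ R)).
Implicit Types (F H : C * C -> C) (z w : C * C).

Lemma poisson_unif2 F (e : R) : ucT F -> 0 < e -> exists2 a : R, 0 < a &
  forall (r : R) (x eta : C), 0 <= r < 1 -> 1 - r <= a -> circ x -> circ eta ->
  nm (mean (fun y => F (x, y) * (pk (r%:C * eta) y)%:C) - F (x, eta)) <= e.
Proof.
move=> uF e0; have [M M0 hM] := ucont_pos uF.
have e2 : 0 < e / 2 by rewrite divr_gt0.
have [d d0 hd] := proj2 uF _ e2.
pose K := 2 * M / d ^+ 2; have K0 : 0 < K by apply: divr_gt0; [rewrite mulr_gt0|rewrite exprn_gt0].
exists (e / (4 * K)) => [|r x eta r01 ra cx ce]; first by rewrite divr_gt0// mulr_gt0.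
have ra' : (1 - r) * (4 * K) <= e.
  have p4 : 0 < 4 * K by rewrite mulr_gt0.
  by rewrite -ler_pdivlMr.
have ux : uc (fun y => F (x, y)) by exact: ucont_slice2 cx uF.
have b y : circ y -> nm (F (x, y)) <= M by move=> cy; apply: hM.
have l y t : circ y -> circ t -> nm (y - t) <= d -> nm (F (x, y) - F (x, t)) <= e / 2.
  move=> cy ct yt; apply: hd => //.
  by rewrite /d2 ge_max /dC /= subrr nm0 (ltW d0) yt.
rewrite (le_trans (poisson_near ux d0 (ltW e2) b l ce r01))// -/K; lra.
Qed.

Lemma kernE z x y : kern z (x, y) = cj (szego z.1 x) * cj (szego z.2 y).
Proof. by rewrite !szegoJ. Qed.

(** Both kernels have the same second coordinate [r%:C * ze], so in [y] they multiply to the square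
    of a modulus, which the prefactor turns into the Poisson kernel. The mean in [y] then
    concentrates at [ze], uniformly in [x]. *)
Lemma ip_kern_lim F H (be al ze : C) : hol2 F -> hol2 H -> nm be < 1 -> nm al < 1 -> circ ze ->
  rlim (fun r => (1 - r ^+ 2)%:C * ip (fun p => H p * kern (al, r%:C * ze) p)
                                      (fun p => F p * kern (be, r%:C * ze) p))
       (sliceL (fun x => H (x, ze) * cj (F (x, ze))) be al).
Proof.
move=> hF hH hb ha cz; pose u p := H p * cj (F p).
have uu : ucT u by apply: ucontM; [exact: hol2_ucT|apply: ucontJ; exact: hol2_ucT].
pose W x := szego be x * cj (szego al x).
have uW : uc W by apply: ucontM; [exact: uc_szego|apply: ucontJ; exact: uc_szego].
have [M M0 hM] := ucont_pos uW.
pose mr (r : R) x := mean (fun y => u (x, y) * (pk (r%:C * ze) y)%:C).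
have nr (r : R) : 0 <= r < 1 -> nm (r%:C * ze) = r.
  by case/andP=> r0 r1; rewrite nmM cz mulr1 nm_real ger0_norm.
have umr (r : R) : 0 <= r < 1 -> uc (mr r).
  move=> r01; apply: (@uc_mean2 _ (fun p => u p * (pk (r%:C * ze) p.2)%:C)).
  apply: ucontM => //; apply: (@ucont_snd _ _ _ (fun y => (pk (r%:C * ze) y)%:C)).
  by apply: uc_pk; rewrite nr//; case/andP: r01.
have uz : uc (fun x => u (x, ze)) by exact: ucont_slice1 cz uu.
apply: (@rlim_eq _ (fun r => mean (fun x => W x * mr r x))) => [r r01|e e0].
  have nz := nr r r01; have /andP[_ r1] := r01; have nz1 : nm (r%:C * ze) < 1 by rewrite nz.
  have hw : inD (al, r%:C * ze) by [].
  have hz : inD (be, r%:C * ze) by [].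
  have uG : ucT (fun p => H p * kern (al, r%:C * ze) p * cj (F p * kern (be, r%:C * ze) p)).
    by apply: ucontM; [|apply: ucontJ]; apply: hol2_ucT; exact: hol2_mulkern.
  rewrite /ip -mean2Z// mean2E; apply: eq_mean => x cx; rewrite /mr -meanZ.
    apply: eq_mean => y cy; rewrite !kernE /= pkM nz /W /u.
    move: (1 - r ^+ 2)%:C => q0; rewrite !rmorphM /= !conjcK; move: q0 (szego be x) (szego al x) (szego _ y) (cj (szego al x)) => q s t v t'.
    move: (cj v) (H (x, y)) (cj (F (x, y))) => v' h f; ring.
  apply: ucontM; first exact: (ucont_slice2 cx uu).
  by apply: uc_pk.
have eM : 0 < e / M by rewrite divr_gt0.
have [a a0 hE] := poisson_unif2 uu eM; exists a => // r r01 ra.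
have -> : sliceL (fun x => H (x, ze) * cj (F (x, ze))) be al = mean (fun x => W x * u (x, ze)).
  by apply: eq_mean => x _; rewrite mulrC.
have um := umr r r01.
rewrite -meanB; [|exact: ucontM..].
apply: mean_bound => [|x cx]; first by apply: ucontB; exact: ucontM.
rewrite -mulrBr nmM (le_trans (ler_pM (nm_ge0 _) (nm_ge0 _) (hM x cx) (hE r x ze r01 ra cx cz)))//.
by rewrite mulrC divfK// gt_eqF.
Qed.

Variables g1 g2 : C * C -> C.
Hypotheses (h1 : hol2 g1) (h2 : hol2 g2).
Hypothesis u1 : forall s t : C, circ s -> circ t -> nm (g1 (s, t)) = 1.

(** The trace of finite rank on kernels: the coefficients may depend on [w] in any way, and
    [finite_rank_form] supplies their structure. *)
Definition fr_kernel (K : C * C -> C * C -> C) := exists (n : nat) (e : 'I_n -> nat -> nat -> C),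
  (forall i, ell2 (e i)) /\ forall w, inD w -> exists c : 'I_n -> C, forall z, inD z ->
    K z w = \sum_(i < n) c i * ev (e i) z.

Lemma fr_kernel_slice (ze : C) : fr_kernel (comker g1 g2) -> circ ze ->
  let u x := g2 (x, ze) * cj (g1 (x, ze)) in anT u \/ anT (fun x => cj (u x)).
Proof.
move=> [n [e [he hK]]] cz u.
have KJ z w : inD z -> inD w -> comker g1 g2 z w = - cj (comker g1 g2 w z).
  by move=> hz hw; rewrite comkerJ// opprK.
have [A hA] := @finite_rank_form R (@inD R) _ n (fun i z => ev (e i) z) KJ hK.
have nz : nm ze <= 1 by rewrite cz.
apply: slice_dichotomy => [||x cx|be al hb ha].
- exact: hol2_dalg2.
- exact: hol2_dalg2.
- exact: u1.
have nr (r : R) : 0 <= r < 1 -> nm (r%:C * ze) < 1.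
  by case/andP=> r0 r1; rewrite nmM cz mulr1 nm_real ger0_norm.
(* This has two limits: 0, by the finite expansion, and a combination of slice means, by the formula
   of the kernel. Their equality is the hypothesis of [slice_dichotomy]. *)
pose Kr (r : R) := (1 - r ^+ 2)%:C * comker g1 g2 (be, r%:C * ze) (al, r%:C * ze).
have K0 : rlim Kr 0.
  have := @rlim_sum R _ (index_enum 'I_n) (fun k r => \sum_l A k l *
    ((1 - r ^+ 2)%:C * (ev (e k) (be, r%:C * ze) * cj (ev (e l) (al, r%:C * ze)))))
    (fun k => \sum_(l < n) A k l * 0).
  rewrite big1 => [h|k _]; last by rewrite big1// => l _; rewrite mulr0.
  apply: rlim_eq (h _) => [r r01|k].
    have hz : inD (be, r%:C * ze) by split => //=; exact: nr.
    have hw : inD (al, r%:C * ze) by split => //=; exact: nr.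
    rewrite /Kr (hA _ _ hz hw) mulr_sumr; apply: eq_bigr => k _.
    by rewrite mulr_sumr; apply: eq_bigr => l _; rewrite mulrCA.
  by apply: rlim_sum => l; apply: rlimZ; exact: rlim_decay.
have d1 := hol2_dalg2 h1 nz; have d2' := hol2_dalg2 h2 nz.
have lim G p : hol2 G -> nm p < 1 -> rlim (fun r => G (p, r%:C * ze)) (G (p, ze)).
  move=> hG hp; have := hol2_dalg1 hG (ltW hp) => -[uG _].
  exact: (@rlim_scale _ (fun y => G (p, y))).
have L1 := ip_kern_lim h1 h2 hb ha cz.
have L2 := ip_kern_lim h2 h1 hb ha cz.
have LK := rlimB (rlimM (rlimM (lim _ _ h1 hb) (rlimJ (lim _ _ h2 ha))) L1)
  (rlimM (rlimM (lim _ _ h2 hb) (rlimJ (lim _ _ h1 ha))) L2).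
have {}LK : rlim Kr _ := rlim_eq _ LK.
have E := rlim_unique K0 (LK _).
have J : cj (sliceL u al be) = sliceL (fun x => g1 (x, ze) * cj (g2 (x, ze))) be al.
  rewrite /sliceL -meanJ; last first.
    have uu : uc u.
      by apply: ucontM; [exact: uc_D (proj1 d2')|apply: ucontJ; exact: uc_D (proj1 d1)].
    apply: ucontM => //; apply: ucontM; [exact: uc_szego|apply: ucontJ; exact: uc_szego].
  apply: eq_mean => x _; rewrite /u; move: (szego be x) (szego al x) => s t.
  by rewrite !rmorphM /= !conjcK (mulrC (g1 _)) (mulrC s).
rewrite J; apply/eqP; rewrite -subr_eq0; apply/eqP; rewrite [RHS]E//.
move=> r r01; rewrite /Kr /comker.
move: (g1 (be, _)) (g2 (be, _)) (cj (g1 (al, _))) (cj (g2 (al, _))) => x1 x2 x3 x4.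
by move: (ip _ _) (ip _ _) (_%:C) => p q s; ring.
Qed.

End KernelLimit.

(** * Analytic and coanalytic slices *)

Section Dichotomy.
Variable R : realType.
Local Notation C := R[i].
Local Notation ucT := (ucont (@d2 R) (@circ R `*` @circ R)).
Implicit Types (F H u : C * C -> C) (z w : C * C).

(** Connectedness of the circle in finite form: two points are joined by an arc cut into steps no
    longer than [d]. *)
Lemma circ_chain (P : C -> Prop) (d : R) : 0 < d ->
  (forall x y, circ x -> circ y -> nm (x - y) <= d -> P x -> P y) ->
  forall x y, circ x -> circ y -> P x -> P y.
Proof.
move=> d0 hd x y /ci_surj[s _ ->] /ci_surj[t _ ->] hs; rewrite -/(pt s) -/(pt t) in hs *.
pose L := 4 * pi * `|t - s|; have L0 : 0 <= L by rewrite mulr_ge0// mulr_ge0// pi_ge0.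
have [N hN] : exists N, L / d < N%:R by exists (Num.trunc (L / d)).+1; exact: truncnS_gt.
have N0 : 0 < N%:R :> R by rewrite (le_lt_trans _ hN)// divr_ge0// ltW.
pose q (k : nat) : R := s + (t - s) * (k%:R / N%:R).
have cq k : circ (pt (q k)) by exact: nm_ci.
have : forall k, P (pt (q k)).
  elim=> [|k IH]; first by rewrite /q mul0r mulr0 addr0.
  apply: hd IH => //; apply: le_trans (pt_lip _ _) _.
  have -> : dR (q k) (q k.+1) = `|t - s| / N%:R.
    rewrite /dR distrC /q -natr1 (_ : _ - _ = (t - s) / N%:R); last by field; rewrite gt_eqF.
    by rewrite normrM normfV (ger0_norm (ltW N0)).
  by rewrite mulrA -/L ler_pdivrMr// mulrC -ler_pdivrMr// ltW.
move=> /(_ N); rewrite /q divff ?gt_eqF// mulr1; congr (P (pt _)); ring.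
Qed.

(* An analytic slice and a nearby antianalytic one have an analytic quotient close
   to 1, hence differ by a constant factor only. *)
Lemma slices_dichotomy u : ucT u -> (forall x y, circ x -> circ y -> nm (u (x, y)) = 1) ->
  (forall y, circ y -> anT (fun x => u (x, y)) \/ anT (fun x => cj (u (x, y)))) ->
  (forall y, circ y -> anT (fun x => u (x, y))) \/
  (forall y, circ y -> anT (fun x => cj (u (x, y)))).
Proof.
move=> uu u1 hu; have [[y0 [c0 a0]]|no] := pselect (exists y, circ y /\ anT (fun x => u (x, y))).
  left=> y cy; have h0 : 0 < 2^-1 :> R by rewrite invr_gt0.
  have [d d0 hd] := proj2 uu _ h0.
  apply: (circ_chain (P := fun y => anT (fun x => u (x, y))) d0 _ c0 cy a0) => s t cs ct st as_.
  have [//|at_] := hu t ct.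
  have q1 : 2^-1 < 1 :> R by rewrite invf_lt1// ltr1n.
  have uJ x : circ x -> u (x, t) * cj (u (x, t)) = 1 by move=> cx; rewrite nm1_mulJ// u1.
  have h1 x : circ x -> nm (u (x, s) * cj (u (x, t))) = 1.
    by move=> cx; rewrite nmM nmJ !u1// mulr1.
  have h2 x : circ x -> nm (1 - u (x, s) * cj (u (x, t))) <= 2^-1.
    move=> cx; rewrite -(uJ x cx) -mulrBl nmM nmJ u1// mulr1 nm_sym.
    by apply: hd => //; rewrite /d2 ge_max /dC /= subrr nm0 (ltW d0).
  have cst := anT_near_const (anTM as_ at_) q1 h1 h2.
  set c := mean _ in cst; have c1 : c != 0.
    by rewrite -(cst 1 (@nm1 R)); apply: nm1_neq0; exact: h1 (@nm1 R).
  apply: eq_anT (anTZ c^-1 as_) => x cx.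
  have -> : u (x, s) = c * u (x, t).
    by rewrite -(cst x cx) -mulrA (mulrC (cj _)) uJ// mulr1.
  by rewrite mulKf.
right=> y cy; have [a|//] := hu y cy; case: no; by exists y.
Qed.

Definition anT2 F := [/\ ucT F, forall y, circ y -> anT (fun x => F (x, y)) &
  forall x, circ x -> anT (fun y => F (x, y))].

Lemma hol2_anT2 F : hol2 F -> anT2 F.
Proof.
move=> hF; split=> [|y cy|x cx]; first exact: hol2_ucT.
  by apply: dalg_anT; apply: hol2_dalg2 => //; rewrite cy.
by apply: dalg_anT; apply: hol2_dalg1 => //; rewrite cx.
Qed.

Lemma ext2E F z : ucT F -> nm z.1 < 1 -> nm z.2 < 1 ->
  ext2 F z = ext (fun x => ext (fun y => F (x, y)) z.2) z.1.
Proof.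
move=> uF z1 z2; rewrite /ext2 mean2E; apply: eq_mean => x cx.
rewrite mulrC /ext -meanZ; last first.
  by apply: ucontM; [exact: ucont_slice2 cx uF|exact: uc_szego].
by apply: eq_mean => y cy; rewrite /szego2 /= mulrCA.
Qed.

Lemma anT_mean F : ucT F -> (forall y, circ y -> anT (fun x => F (x, y))) ->
  anT (fun x => mean (fun y => F (x, y))).
Proof.
move=> uF aF; split=> [|k k0]; first exact: uc_mean2.
have uX : ucT (fun p => p.1 ^+ k) by apply: (@ucont_fst _ _ _ (fun x => x ^+ k)); exact: uc_X.
transitivity (mean (fun x => mean (fun y => x ^+ k * F (x, y)))).
  by apply: eq_mean => x cx; rewrite mulrC -meanZ//; exact: ucont_slice2 cx uF.
rewrite (@mean_swap _ (fun p => p.1 ^+ k * F p)); last exact: ucontM.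
rewrite -[RHS](mean_cst 0); apply: eq_mean => y cy /=; have [uy hy] := aF y cy.
by rewrite -[RHS](hy k k0); apply: eq_mean => x _; rewrite mulrC.
Qed.

Lemma anT_ext_slice F (w : C) : ucT F -> (forall y, circ y -> anT (fun x => F (x, y))) ->
  nm w < 1 -> anT (fun x => ext (fun y => F (x, y)) w).
Proof.
move=> uF aF w1; have us := uc_szego w1.
apply: (@anT_mean (fun p => F p * szego w p.2)) => [|y cy].
  by apply: ucontM => //; exact: (@ucont_snd _ _ _ (szego w)).
by apply: eq_anT (anTZ (szego w y) (aF y cy)) => x _; rewrite mulrC.
Qed.

Lemma ext2_mul F H z : anT2 F -> anT2 H -> nm z.1 < 1 -> nm z.2 < 1 ->
  ext2 (fun p => F p * H p) z = ext2 F z * ext2 H z.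
Proof.
move=> [uF aF bF] [uH aH bH] z1 z2.
rewrite !ext2E//; last exact: ucontM.
rewrite -ext_mul//; [|exact: anT_ext_slice..].
by apply: eq_mean => x cx; rewrite -ext_mul//; [exact: bF|exact: bH].
Qed.

Lemma kernJ z w : cj (kern z w) = kern w z.
Proof.
by rewrite [w in LHS]surjective_pairing kernE rmorphM /= !conjcK /kern /szego (mulrC z.1) (mulrC z.2).
Qed.

Section Analytic.
Variables g1 g2 : C * C -> C.
Hypotheses (h1 : hol2 g1) (h2 : hol2 g2).
Hypothesis u1 : forall s t : C, circ s -> circ t -> nm (g1 (s, t)) = 1.

Lemma ip_ext2 z w : inD z -> inD w ->
  ip (fun p => g2 p * kern w p) (fun p => g1 p * kern z p) =
  ext2 (fun p => g2 p * cj (g1 p) * kern w p) z.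
Proof.
move=> hz hw; apply: eq_mean2 => x y _ _.
rewrite [cj (g1 _ * _)]rmorphM /= (kernE z) [cj (cj _ * _)]rmorphM /= !conjcK /szego2 /=.
by ring.
Qed.

Lemma ip_swap_conj z w : inD z -> inD w ->
  ip (fun p => g1 p * kern w p) (fun p => g2 p * kern z p) =
  cj (ip (fun p => g2 p * kern z p) (fun p => g1 p * kern w p)).
Proof. by move=> hz hw; rewrite ipJ//; apply: hol2_ucT; exact: hol2_mulkern. Qed.

(** Since [ext2] is multiplicative on analytic functions, U(z,w) is the extension of u at [z] times
    k_w(z), and g2 is g1 times this extension. Both terms of the kernel become g2(z) conj(g2(w))
    k_w(z). *)
Lemma comker_eq0_anT2 z w : anT2 (fun p => g2 p * cj (g1 p)) -> inD z -> inD w ->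
  comker g1 g2 z w = 0.
Proof.
move=> au hz hw; pose u p := g2 p * cj (g1 p).
have E v y : inD v -> inD y -> ip (fun p => g2 p * kern y p) (fun p => g1 p * kern v p) =
    ext2 u v * kern y v.
  move=> hv hy; have [v1 v2] := hv; have [y1 y2] := hy; have hk := hol2_kern y1 y2.
  by rewrite ip_ext2// ext2_mul//; [rewrite -(cauchy2 hk)|exact: hol2_anT2].
have G v : inD v -> g2 v = g1 v * ext2 u v.
  move=> [v1 v2]; rewrite (cauchy2 h2 v1 v2) (cauchy2 h1 v1 v2) -ext2_mul//; last exact: hol2_anT2.
  apply: eq_mean2 => x y cx cy; rewrite /u; congr (_ * _).
  by rewrite mulrCA nm1_mulJ ?mulr1//; exact: u1.
rewrite /comker (ip_swap_conj hz hw) (E z w hz hw) (E w z hw hz) (G z hz) (G w hw).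
rewrite [cj (ext2 u w * _)]rmorphM [cj (g1 w * _)]rmorphM /= kernJ.
by ring.
Qed.

End Analytic.

Lemma comker_swap g1 g2 z w : comker g2 g1 z w = - comker g1 g2 z w.
Proof. by rewrite /comker opprB. Qed.

Definition flip (p : C * C) : C * C := (p.2, p.1).

Lemma ip_flip F H : ucT F -> ucT H -> ip (F \o flip) (H \o flip) = ip F H.
Proof.
by move=> uF uH; rewrite /ip [RHS]mean2_swap//; apply: ucontM => //; exact: ucontJ.
Qed.

Lemma comker_flip g1 g2 z w : hol2 g1 -> hol2 g2 -> inD z -> inD w ->
  comker (g1 \o flip) (g2 \o flip) z w = comker g1 g2 (flip z) (flip w).
Proof.
move=> h1 h2 hz hw; have fD v : inD v -> inD (flip v) by case.
have k g v : (fun p => (g \o flip) p * kern v p) = (fun p => g p * kern (flip v) p) \o flip.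
  by apply/funext => p /=; congr (_ * _); rewrite /kern /= mulrC.
have u g v : hol2 g -> inD v -> ucT (fun p => g p * kern (flip v) p).
  by move=> hg hv; apply: hol2_ucT; apply: hol2_mulkern => //; exact: fD.
by rewrite /comker !k !ip_flip//; exact: u.
Qed.

(** Exchanging the variables transposes the coefficient arrays, so results on slices in the first
    variable also apply to the second. *)
Lemma fr_kernel_flip g1 g2 : hol2 g1 -> hol2 g2 -> fr_kernel (comker g1 g2) ->
  fr_kernel (comker (g1 \o flip) (g2 \o flip)).
Proof.
move=> h1 h2 [n [e [he hK]]]; have fD v : inD v -> inD (flip v) by case.
have el i : ell2 (fun k l => e i l k).
  by have [B hB] := he i; exists B => N; rewrite /sq exchange_big; exact: hB.
exists n, (fun i k l => e i l k); split=> // w hw; have [c hc] := hK _ (fD _ hw); exists c => z hz.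
have E i : ev (e i) (flip z) = ev (fun k l => e i l k) z.
  apply: (clim_unique (pol_cvg (he i) (fD _ hz))).
  apply: clim_eq (pol_cvg (el i) hz) => N; rewrite /pol exchange_big.
  by apply: eq_bigr => k _; apply: eq_bigr => l _; rewrite /mono /= (mulrC (z.1 ^+ _)).
apply: etrans (comker_flip h1 h2 hz hw) _; apply: etrans (hc _ (fD _ hz)) _.
by apply: eq_bigr => i _; rewrite E.
Qed.

End Dichotomy.

(** * The mixed case *)

Section MixedKernel.
Variable R : realType.
Local Notation C := R[i].
Local Notation uc := (ucont (@dC R) (@circ R)).
Local Notation ucT := (ucont (@d2 R) (@circ R `*` @circ R)).
Implicit Types (F H : C * C -> C) (z w : C * C).

Lemma sliceL_anT v (be al : C) : anT v -> nm be < 1 -> nm al < 1 ->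
  (1 - be * cj al) * sliceL v be al = ext v be.
Proof.
move=> av hb ha; have uv := proj1 av.
by rewrite sliceLE// ext_conj// conjcK mean_anT_szegoJ// subrK.
Qed.

Lemma sliceLJ v (be al : C) : uc v -> nm be < 1 -> nm al < 1 ->
  sliceL v be al = cj (sliceL (fun x => cj (v x)) al be).
Proof.
move=> uv hb ha; rewrite /sliceL -meanJ; last first.
  apply: ucontM; [exact: ucontJ|apply: ucontM; [exact: uc_szego|apply: ucontJ; exact: uc_szego]].
apply: eq_mean => x _; move: (v x) (szego be x) (szego al x) => p q t.
by rewrite !rmorphM /= !conjcK (mulrC q).
Qed.

Lemma sliceL_anTJ v (be al : C) : uc v -> anT (fun x => cj (v x)) -> nm be < 1 -> nm al < 1 ->
  (1 - be * cj al) * sliceL v be al = mean (fun x => v x * cj (szego al x)).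
Proof.
move=> uv av hb ha; rewrite (sliceLJ uv hb ha).
rewrite -[RHS]conjcK -(ext_conj uv ha) -(sliceL_anT av ha hb) [in RHS]rmorphM rmorphB rmorph1 /=.
by rewrite rmorphM /= conjcK (mulrC be).
Qed.

Lemma den_neq0 (a b : C) : nm a < 1 -> nm b < 1 -> 1 - a * cj b != 0.
Proof.
move=> ha hb; apply: nm_lt1_neq; rewrite nmJ; move: ha hb (nm_ge0 a) (nm_ge0 b).
by move: (nm a) (nm b) => p q; nra.
Qed.

Variables g1 g2 : C * C -> C.
Hypotheses (h1 : hol2 g1) (h2 : hol2 g2).
Hypothesis u1 : forall s t : C, circ s -> circ t -> nm (g1 (s, t)) = 1.
Local Notation u := (fun p => g2 p * cj (g1 p)).
Hypothesis aX : forall y, circ y -> anT (fun x => u (x, y)).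
Hypothesis aY : forall x, circ x -> anT (fun y => cj (u (x, y))).

Let uu : ucT u.
Proof. by apply: ucontM; [exact: hol2_ucT|apply: ucontJ; exact: hol2_ucT]. Qed.

(** Extensions of u into the disc: [mixQ] antianalytically in the second variable, [mixS]
    analytically in the first, [mixV] in both. *)
Definition mixQ x b : C := mean (fun y => g2 (x, y) * cj (g1 (x, y)) * cj (szego b y)).
Definition mixS y a : C := mean (fun x => g2 (x, y) * cj (g1 (x, y)) * szego a x).
Definition mixV a b : C := ext (fun x => mixQ x b) a.

Lemma mixQ_anT b : nm b < 1 -> anT (fun x => mixQ x b).
Proof.
move=> hb; apply: (@anT_mean R (fun p => u p * cj (szego b p.2))) => [|y cy].
  apply: ucontM => //; apply: ucontJ; apply: (@ucont_snd _ _ _ (szego b)); exact: uc_szego.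
by apply: eq_anT (anTZ (cj (szego b y)) (aX cy)) => x _; rewrite mulrC.
Qed.

Lemma mixS_anT a : nm a < 1 -> anT (fun y => cj (mixS y a)).
Proof.
move=> ha; have us := uc_szego ha.
have uF : ucT (fun p => cj (u (p.2, p.1)) * cj (szego a p.2)).
  apply: ucontM; apply: ucontJ; first exact: (ucont_swap uu).
  exact: (@ucont_snd _ _ _ (szego a)).
have aF y : circ y -> anT (fun x => cj (u (y, x)) * cj (szego a y)).
  by move=> cy; apply: eq_anT (anTZ (cj (szego a y)) (aY cy)) => x _; rewrite mulrC.
apply: eq_anT (anT_mean uF aF) => y cy /=.
rewrite /mixS -meanJ; last by apply: ucontM => //; exact: ucont_slice1 cy uu.
by apply: eq_mean => x _; rewrite [RHS]rmorphM.
Qed.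

Lemma mixVJ a b : nm a < 1 -> nm b < 1 -> cj (mixV a b) = ext (fun y => cj (mixS y a)) b.
Proof.
move=> ha hb; have us := uc_szego ha; have uJ := ucontJ (uc_szego hb).
have uS : uc (fun y => mixS y a).
  by apply: ucont_eq (ucontJ (proj1 (mixS_anT ha))) => y _; rewrite conjcK.
rewrite (ext_conj uS hb); congr cj.
have ua : ucT (fun p => szego a p.1) by exact: (@ucont_fst _ _ _ (szego a)).
have ub : ucT (fun p => cj (szego b p.2)) by exact: (@ucont_snd _ _ _ (fun y => cj (szego b y))).
transitivity (mean (fun x => mean (fun y => u (x, y) * cj (szego b y) * szego a x))).
  apply: eq_mean => x cx; rewrite mulrC -meanZ; last by apply: ucontM => //; exact: ucont_slice2 cx uu.
  by apply: eq_mean => y _; rewrite mulrC.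
rewrite (@mean_swap _ (fun p => u p * cj (szego b p.2) * szego a p.1)); last first.
  by apply: ucontM => //; exact: ucontM.
apply: eq_mean => y cy; rewrite mulrC -meanZ; last by apply: ucontM => //; exact: ucont_slice1 cy uu.
by apply: eq_mean => x _ /=; ring.
Qed.

(** The mean in [y] sees an antianalytic function and depends on [w.2] alone, up to the kernel
    factor; the mean in [x] then sees an analytic one and depends on [z.1] alone. *)
Lemma ip_mix z w : inD z -> inD w ->
  ip (fun p => g2 p * kern w p) (fun p => g1 p * kern z p) = mixV z.1 w.2 * kern w z.
Proof.
move=> hz hw; have [z1 z2] := hz; have [w1 w2] := hw.
have n1 := den_neq0 z1 w1; have n2 := den_neq0 z2 w2.
have aQ := mixQ_anT w2; have uQ := proj1 aQ.
have uk : uc (fun x => szego z.1 x * cj (szego w.1 x)).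
  by apply: ucontM; [exact: uc_szego|apply: ucontJ; exact: uc_szego].
have uk2 : uc (fun x => szego z.2 x * cj (szego w.2 x)).
  by apply: ucontM; [exact: uc_szego|apply: ucontJ; exact: uc_szego].
have E2 : (1 - z.2 * cj w.2) * ip (fun p => g2 p * kern w p) (fun p => g1 p * kern z p) =
    sliceL (fun x => mixQ x w.2) z.1 w.1.
  rewrite (ip_ext2 g1 g2 hz hw) /ext2.
  have uG : ucT (fun p => u p * kern w p * szego2 z p).
    by apply: ucontM; [apply: ucontM => //; exact: hol2_ucT (hol2_kern w1 w2)|exact: ucT_szego2].
  rewrite -mean2Z// mean2E; apply: eq_mean => x cx.
  have ux : uc (fun y => u (x, y)) by exact: ucont_slice2 cx uu.
  have E3 : mixQ x w.2 = (1 - z.2 * cj w.2) * sliceL (fun y => u (x, y)) z.2 w.2.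
    by rewrite sliceL_anTJ//; exact: aY.
  rewrite E3 mulrAC -meanZ; last exact: ucontM.
  apply: eq_mean => y _; rewrite kernE /szego2 /=.
  move: (szego z.1 x) (szego z.2 y) (cj (szego w.1 x)) (cj (szego w.2 y)) => p q s t.
  by ring.
have E1 := sliceL_anT aQ z1 w1; rewrite -E2 in E1.
rewrite /mixV -E1 /kern (mulrC (cj w.1)) (mulrC (cj w.2)).
move: (ip _ _) (1 - z.1 * _) (1 - z.2 * _) n1 n2 => I p q p0 q0.
by field; rewrite p0 q0.
Qed.

Lemma comker_mix z w : inD z -> inD w -> comker g1 g2 z w =
  (g1 z * cj (g2 w) * mixV z.1 w.2 - g2 z * cj (g1 w) * cj (mixV w.1 z.2)) * kern w z.
Proof.
move=> hz hw; rewrite /comker (ip_swap_conj h1 h2 hz hw) (ip_mix hz hw) (ip_mix hw hz).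
by rewrite [cj (mixV _ _ * _)]rmorphM /= kernJ; ring.
Qed.

Lemma rlim_hol2 (G : C * C -> C) (x y : C) : hol2 G -> circ x -> circ y ->
  rlim (fun r => G (r%:C * x, r%:C * y)) (G (x, y)).
Proof.
move=> [[_ uG] _] cx cy e e0; have [d d0 hd] := uG e e0; exists d => // r /andP[r0 r1] rd.
have st (t : C) : circ t -> cdisc (r%:C * t) /\ dC (r%:C * t) t <= d.
  move=> ct; split; first by rewrite /cdisc /= nmM ct mulr1 nm_real ger0_norm// ltW.
  rewrite /dC -{2}[t]mul1r -mulrBl nmM ct mulr1 -[1 : C]/(1%:C) -rmorphB nm_real distrC ger0_norm//.
  by rewrite subr_ge0 ltW.
have [x1 x2] := st x cx; have [y1 y2] := st y cy.
apply: hd; [by []|by split; exact: circ_cdisc|].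
by rewrite /d2 ge_max x2 y2.
Qed.

(** The columns share their second coordinate [la], so the kernel factor in that variable divides
    out of the relation. The rest has radial limits at (x, y), where g1 is cleared by its
    conjugate. *)
Lemma columns_boundary (J : finType) (c : J -> C) (al : J -> C) (la : C) :
  nm la < 1 -> (forall j, nm (al j) < 1) ->
  (forall z, inD z -> \sum_j c j * comker g1 g2 z (al j, la) = 0) ->
  forall x y, circ x -> circ y ->
  mixQ x la * (\sum_j c j * cj (g2 (al j, la)) * (1 - cj (al j) * x)^-1) =
  u (x, y) * (\sum_j c j * cj (g1 (al j, la)) * cj (mixS y (al j)) * (1 - cj (al j) * x)^-1).
Proof.
move=> l1 a1 hz x y cx cy.
have nr (r : R) (t : C) : 0 <= r < 1 -> circ t -> nm (r%:C * t) < 1.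
  by case/andP=> r0 r1 ct; rewrite nmM ct mulr1 nm_real ger0_norm.
pose T j r := c j * (g1 (r%:C * x, r%:C * y) * cj (g2 (al j, la)) * ext (fun t => mixQ t la) (r%:C * x) -
   g2 (r%:C * x, r%:C * y) * cj (g1 (al j, la)) * ext (fun t => cj (mixS t (al j))) (r%:C * y)) *
   (1 - cj (al j) * (r%:C * x))^-1.
pose T1 j := c j * (g1 (x, y) * cj (g2 (al j, la)) * mixQ x la -
   g2 (x, y) * cj (g1 (al j, la)) * cj (mixS y (al j))) * (1 - cj (al j) * x)^-1.
have lT j : rlim (T j) (T1 j).
  apply: rlimM; last first.
    apply: (@rlim_scale _ (fun t => (1 - cj (al j) * t)^-1)) => //.
    by apply: ucont_geo; [rewrite nmJ|by []|exact: ucont_idC].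
  apply: rlimZ; apply: rlimB; apply: rlimM.
  - by apply: rlimM; [exact: rlim_hol2|exact: rlim_cst].
  - by apply: rlim_ext => //; exact: mixQ_anT.
  - by apply: rlimM; [exact: rlim_hol2|exact: rlim_cst].
  - by apply: (rlim_ext (h := fun t => cj (mixS t (al j)))) => //; exact: mixS_anT.
have T0 r : 0 <= r < 1 -> \sum_j T j r = 0.
  move=> r01; have hz' : inD (r%:C * x, r%:C * y) by split; exact: nr.
  have n0 : 1 - cj la * (r%:C * y) != 0 by rewrite mulrC; apply: den_neq0 => //; exact: nr.
  apply: (mulIf (invr_neq0 n0)); rewrite mul0r -[RHS](hz _ hz') mulr_suml.
  apply: eq_bigr => j _; have hw : inD (al j, la) := conj (a1 j) l1.
  rewrite (comker_mix hz' hw) (mixVJ (a1 j) (nr r y r01 cy)) /T /mixV /kern /=.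
  move: (_ - _) ((1 - cj (al j) * _)^-1) ((1 - cj la * _)^-1) => p q s; ring.
have := rlim_unique (rlim_sum (index_enum J) lT) (rlim_eq _ (rlim_cst 0)).
move=> /(_ (fun r r01 => esym (T0 r r01))) E.
have {}E : cj (g1 (x, y)) * \sum_j T1 j = 0 by rewrite E mulr0.
apply/eqP; rewrite -subr_eq0; apply/eqP; rewrite -[RHS]E !mulr_sumr -sumrB.
apply: eq_bigr => j _; rewrite /T1.
have : g1 (x, y) * cj (g1 (x, y)) = 1 by rewrite nm1_mulJ// u1.
move: (g1 (x, y)) (g2 (x, y)) (cj (g1 (x, y))) => p q s ps.
move: (c j) (cj (g2 _)) (cj (g1 _)) (mixQ x la) (cj (mixS _ _)) (_^-1) => a b d e f h.
transitivity (a * ((p * s) * b * e - q * s * d * f) * h); last by ring.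
by rewrite ps; ring.
Qed.

End MixedKernel.

(** * Polynomials of prescribed modulus on the circle *)

Section UnimodularPolynomials.
Variable R : realType.
Local Notation C := R[i].
Local Notation uc := (ucont (@dC R) (@circ R)).
Implicit Types (p q : {poly C}) (x y : C).

(** A rational parametrization of the circle, used as an explicit source of infinitely many distinct
    points near 1. *)
Definition cayley (s : R) : C := (1 +i* s) / (1 -i* s).

Lemma cayley_den_ge (s : R) : 1 <= nm (1 -i* s : C).
Proof.
have := nm_Re (1 -i* s : C); rewrite /= normr1; exact.
Qed.

Lemma circ_cayley s : circ (cayley s).
Proof.
rewrite /circ /= /cayley nmM nmV -[1 -i* s]/(cj (1 +i* s)) nmJ divff//.
by rewrite gt_eqF// -nmJ; exact: lt_le_trans ltr01 (cayley_den_ge s).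
Qed.

Lemma cayley_dist (s : R) : 0 <= s -> nm (1 - cayley s) <= 2 * s.
Proof.
move=> s0; have d1 := cayley_den_ge s; set z := 1 -i* s in d1.
have z0 : z != 0 by rewrite -nm_gt0 (lt_le_trans ltr01).
have -> : 1 - cayley s = (z - (1 +i* s)) / z by rewrite mulrBl divff.
rewrite nmM nmV ler_pdivrMr ?nm_gt0//.
have -> : z - (1 +i* s) = - ((2 * s)%:C * 'i).
  by rewrite /z; simpc; congr (_ +i* _); ring.
rewrite nmN nmM nm_i nm_real mulr1 ger0_norm ?mulr_ge0// ler_peMr// mulr_ge0//.
Qed.

Lemma cayley_inj : injective cayley.
Proof.
move=> s t; rewrite /cayley => h.
have den0 (r : R) : (1 -i* r : C) != 0 by rewrite -nm_gt0 (lt_le_trans ltr01) ?cayley_den_ge.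
have : (1 +i* s) * (1 -i* t) = (1 +i* t) * (1 -i* s) :> C.
  have := congr1 (fun z => z * ((1 -i* s) * (1 -i* t))) h.
  by rewrite mulrA divfK// [RHS]mulrCA divfK// mulrC [RHS]mulrC => ->; rewrite mulrC.
by simpc => -[_]; lra.
Qed.

(** The points [x * cayley (sk k)] are distinct and within [d] of [x]; [size p] of them exceed the
    possible number of roots. *)
Lemma poly_nonroot p x (d : R) : p != 0 -> circ x -> 0 < d ->
  exists y, [/\ circ y, nm (x - y) <= d & p.[y] != 0].
Proof.
move=> p0 cx d0; apply: contrapT => no.
pose sk (k : nat) : R := d / 2 / k.+1%:R.
have sk0 k : 0 < sk k by rewrite !divr_gt0.
pose pts := [seq x * cayley (sk k) | k <- iota 0 (size p)].
have x0 : x != 0 by apply: circ_neq0.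
have : (size pts < size p)%N.
  apply: max_poly_roots p0 _ _.
    apply/allP => _ /mapP[k _ ->]; apply/rootP/eqP/negPn/negP => nz; apply: no.
    exists (x * cayley (sk k)); split=> //; first by rewrite /circ /= nmM cx circ_cayley mulr1.
    rewrite -{1}[x]mulr1 -mulrBr nmM cx mul1r (le_trans (cayley_dist (ltW (sk0 k))))//.
    by rewrite /sk mulrA mulrCA divff// mulr1 ler_pdivrMr// ler_peMr ?(ltW d0)// ler1n.
  rewrite map_inj_uniq ?iota_uniq// => k l /(mulfI x0)/cayley_inj/(mulfI (lt0r_neq0 (divr_gt0 d0 _))).
  by move=> /(_ (ltr0Sn _ _))/invr_inj/eqP; rewrite eqr_nat eqSS => /eqP.
by rewrite size_map size_iota ltnn.
Qed.

Lemma poly_eq_circ p q : (forall x, circ x -> p.[x] = q.[x]) -> p = q.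
Proof.
move=> h; apply/eqP; rewrite -subr_eq0; apply/negPn/negP => pq.
have [y [cy _]] := poly_nonroot pq (@nm1 R : circ 1) ltr01.
by rewrite hornerD hornerN h// subrr eqxx.
Qed.

(** The reciprocal polynomial: on the circle, [p * revp n p] takes the value x^n |p(x)|^2, which
    depends on the modulus of p only. *)
Definition revp n p : {poly C} := \poly_(i < n.+1) cj p`_(n - i).

Lemma horner_revp n p x : (size p <= n.+1)%N -> circ x -> (revp n p).[x] = x ^+ n * cj p.[x].
Proof.
move=> sp cx; rewrite /revp horner_poly (horner_coef_wide x sp) rmorph_sum mulr_sumr.
rewrite (reindex_inj rev_ord_inj); apply: eq_bigr => i _ /=; rewrite subSS.
have le_in : (i <= n)%N by rewrite -ltnS.
rewrite subKn// rmorphM rmorphXn /= mulrCA; congr (_ * _).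
have -> : x ^+ n = x ^+ (n - i) * x ^+ i by rewrite -exprD subnK.
by rewrite -mulrA -exprMn (circ_mulJ cx) expr1n mulr1.
Qed.

Lemma seq_gap (s : seq C) : exists2 e : R, 0 < e & forall a, a \in s -> nm a <= e -> a = 0.
Proof.
elim: s => [|b s [e e0 IH]]; first by exists 1.
have [->|b0] := eqVneq b 0.
  by exists e => // a; rewrite inE => /orP[/eqP //|/IH]; exact.
have nb : 0 < nm b by rewrite nm_gt0.
exists (Num.min e (nm b / 2)) => [|a]; first by rewrite lt_min e0 divr_gt0.
rewrite inE le_min => /orP[/eqP ->|/IH h] /andP[a1 a2]; last exact: h.
by move: a2; rewrite leNgt ltr_pdivrMr// ltr_pMr// ltr1n.
Qed.

(** Distinct values differ by at least a fixed gap, which uniform continuity does not allow to cross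
    in small steps. *)
Lemma finite_valued_const (f : C -> C) (s : seq C) : uc f -> (forall x, circ x -> f x \in s) ->
  forall x y, circ x -> circ y -> f x = f y.
Proof.
move=> [_ uf] fs x y cx cy.
have [e e0 he] := seq_gap [seq a - b | a <- s, b <- s].
have [d d0 hd] := uf e e0.
apply: (circ_chain (P := fun y => f x = f y) d0 _ cx cy) => // t r ct cr tr ->.
apply/eqP; rewrite -subr_eq0; apply/eqP; apply: he; last exact: hd.
by apply/allpairsP; exists (f t, f r); rewrite /= !fs.
Qed.

(* Each [P y] divides the fixed polynomial [P y * revp n (P y)], hence is one of
   finitely many polynomials up to a scalar of prescribed modulus. *)
Lemma same_modulus_finite n (P : C -> {poly C}) (m : C -> R) (x0 x1 x2 : C) :
  (forall y, circ y -> (size (P y) <= n.+1)%N) ->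
  (forall x y, circ x -> circ y -> nm (P y).[x] = m x) ->
  circ x0 -> m x0 != 0 -> circ x1 -> circ x2 ->
  exists s : seq C, forall y, circ y -> (P y).[x1] * cj (P y).[x2] \in s.
Proof.
move=> sP mP c0 m0 c1 c2; have co : circ (1 : C) by exact: nm1.
pose W := P 1 * revp n (P 1).
have WE y : circ y -> P y * revp n (P y) = W.
  move=> cy; apply: poly_eq_circ => x cx; rewrite !hornerM !horner_revp ?sP//.
  by rewrite mulrCA mulJ [RHS]mulrCA mulJ !mP.
have W0 : W != 0.
  apply/eqP => h; have := congr1 (fun p => nm p.[x0]) h; rewrite horner0 nm0 hornerM horner_revp ?sP//.
  rewrite !nmM nmX nmJ c0 expr1n mul1r mP// => /eqP.
  by rewrite mulf_eq0 (negPf m0).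
have [r rE] := closed_field_poly_normal W.
pose D (b : bitseq) : {poly C} := \prod_(a <- mask b r) ('X - a%:P).
(* If [P y] is k times the divisor [D b], the scalar enters this product only through |k|^2, which
   the modulus at [x0] determines; the phase of k may vary with [y]. *)
pose val b : C := ((m x0) ^+ 2 / nm (D b).[x0] ^+ 2)%:C * ((D b).[x1] * cj (D b).[x2]).
exists [seq val (tval b) | b <- enum {: (size r).-tuple bool}] => y cy.
have : P y %| \prod_(a <- r) ('X - a%:P).
  have -> : (P y %| \prod_(a <- r) ('X - a%:P)) = (P y %| W).
    by rewrite rE dvdpZr// lead_coef_eq0.
  by rewrite -(WE y cy) dvdp_mulIl.
move=> /(dvdp_prod_XsubC (F := id))[b hb].
have [b' sb' bb'] := resize_mask b r; rewrite bb' in hb.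
move: hb => /eqpP[[k1 k2] /= /andP[k10 k20] hk].
have pE : P y = (k1^-1 * k2) *: D b'.
  by rewrite -scalerA -hk scalerA mulVf// scale1r.
set k := k1^-1 * k2 in pE.
apply/mapP; exists (Tuple (introT eqP sb')); first by rewrite mem_enum.
have mk : nm k * nm (D b').[x0] = m x0 by rewrite -nmM -hornerZ -pE mP.
have D0 : nm (D b').[x0] != 0 by apply/eqP => h; rewrite -mk h mulr0 eqxx in m0.
rewrite /val /= -mk exprMn mulfK ?expf_neq0// pE !hornerZ rmorphM /= -mulJ.
by ring.
Qed.

End UnimodularPolynomials.

Section MixedCase.
Variable R : realType.
Local Notation C := R[i].
Local Notation uc := (ucont (@dC R) (@circ R)).
Local Notation ucT := (ucont (@d2 R) (@circ R `*` @circ R)).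

Lemma ucont_big (I : Type) (s : seq I) (F : I -> C -> C) : (forall i, uc (F i)) ->
  uc (fun y => \sum_(i <- s) F i y).
Proof.
move=> uF; elim: s => [|i s IH].
  by apply: (ucont_eq _ (ucont_cst _ _ 0)) => y _; rewrite big_nil.
by apply: (ucont_eq _ (ucontD (uF i) IH)) => y _; rewrite big_cons.
Qed.

Section Product.
Variables (n : nat) (al : 'I_n.+1 -> C).

(** The common denominator without its factor [j]: combinations of these are the numerators of sums
    of partial fractions, see [sum_coprod]. *)
Definition coprod (j : 'I_n.+1) : {poly C} := \prod_(i < n.+1 | i != j) (1 - cj (al i) *: 'X).

Lemma horner_fac (a x : C) : (1 - a *: 'X).[x] = 1 - a * x.
Proof. by rewrite hornerD hornerN hornerC hornerZ hornerX. Qed.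

Lemma horner_coprod j x : (coprod j).[x] = \prod_(i < n.+1 | i != j) (1 - cj (al i) * x).
Proof. by rewrite horner_prod; apply: eq_bigr => i _; rewrite horner_fac. Qed.

Hypothesis a1 : forall j, nm (al j) < 1.

Lemma fac_neq0 j x : circ x -> 1 - cj (al j) * x != 0.
Proof. by move=> cx; apply: nm_lt1_neq; rewrite nmJ cx mulr1. Qed.

Lemma sum_coprod (a : 'I_n.+1 -> C) x : circ x ->
  (\sum_j a j *: coprod j).[x] =
  (\prod_i (1 - cj (al i) * x)) * \sum_j a j * (1 - cj (al j) * x)^-1.
Proof.
move=> cx; rewrite horner_sum mulr_sumr; apply: eq_bigr => j _.
rewrite hornerZ horner_coprod [in RHS](bigD1 j)//=; have := fac_neq0 j cx.
by move: (\prod_(_ < _ | _) _) (1 - _) (a j) => p f b f0; field.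
Qed.

Hypothesis al0 : forall j, al j != 0.
Hypothesis al_inj : injective al.

(** At the pole [(cj (al j))^-1] every [coprod i] with i different from j vanishes and [coprod j]
    does not. *)
Lemma sum_coprod_neq0 (a : 'I_n.+1 -> C) j : a j != 0 -> \sum_j a j *: coprod j != 0.
Proof.
move=> aj; apply/eqP => h.
have cj0 i : cj (al i) != 0 by rewrite -nm_eq0 nmJ nm_eq0.
have := congr1 (fun p => p.[(cj (al j))^-1]) h; rewrite horner0 horner_sum (bigD1 j)//= big1 => [|i ij].
  rewrite addr0 hornerZ horner_coprod => /eqP; rewrite mulf_eq0 (negPf aj) /= => /prodf_eq0[i ij].
  rewrite subr_eq0 eq_sym => /eqP e; have {}e : cj (al i) = cj (al j).
    by rewrite -[LHS]mulr1 -(divff (cj0 j)) mulrCA e mulr1.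
  by move/(congr1 cj): e; rewrite !conjcK => /al_inj e; rewrite e eqxx in ij.
rewrite hornerZ horner_coprod (bigD1 j) 1?eq_sym//= divff// subrr mul0r mulr0//.
Qed.

End Product.

Variables g1 g2 : C * C -> C.
Hypotheses (h1 : hol2 g1) (h2 : hol2 g2).
Hypothesis u1 : forall s t : C, circ s -> circ t -> nm (g1 (s, t)) = 1.
Hypothesis u2 : forall s t : C, circ s -> circ t -> nm (g2 (s, t)) = 1.
Local Notation u := (fun p => g2 p * cj (g1 p)).
Hypothesis aX : forall y, circ y -> anT (fun x => u (x, y)).
Hypothesis aY : forall x, circ x -> anT (fun y => cj (u (x, y))).

Let uu : ucT u.
Proof. by apply: ucontM; [exact: hol2_ucT|apply: ucontJ; exact: hol2_ucT]. Qed.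

Let un x y : circ x -> circ y -> nm (g2 (x, y) * cj (g1 (x, y))) = 1.
Proof. by move=> cx cy; rewrite nmM nmJ u1// u2// mulr1. Qed.

(** All coordinates are reals 1 - d / (k + 1) close to 1. There g2 is within 1/2 of the unimodular
    number g2(1, 1), and [mixQ] within 1/2 of u(x, 1), uniformly in x by Poisson's formula; hence
    neither vanishes. *)
Lemma column_points n : exists (al : 'I_n.+1 -> C) (la : C),
  [/\ nm la < 1, forall j, nm (al j) < 1, forall j, al j != 0 & injective al] /\
  (forall j, g2 (al j, la) != 0) /\ (forall x, circ x -> mixQ g1 g2 x la != 0).
Proof.
have h0 : 0 < 2^-1 :> R by rewrite invr_gt0.
have hlt : 2^-1 < 1 :> R by rewrite invf_lt1// ltr1n.
have far (p q : C) : nm q = 1 -> nm (p - q) <= 2^-1 -> p != 0.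
  move=> q1 pq; apply/eqP => p0; move: pq; rewrite p0 sub0r nmN q1 leNgt hlt//.
have co : circ (1 : C) by exact: nm1.
have uJ : ucT (fun p => cj (u p)) by exact: ucontJ.
have [d1 d10 hd1] := poisson_unif2 uJ h0.
have [[_ uG] _] := h2; have [dG dG0 hdG] := uG _ h0.
pose d : R := Num.min (Num.min d1 dG) 2^-1.
have d0 : 0 < d by rewrite !lt_min d10 dG0.
have dd1 : d <= d1 by rewrite !ge_min lexx.
have dd2 : d <= dG by rewrite !ge_min lexx orbT.
have dh : d <= 2^-1 by rewrite ge_min lexx orbT.
pose s (k : nat) : R := 1 - d / k.+1%:R.
have sb k : 0 < s k < 1 /\ 1 - s k <= d.
  have k0 : 0 < k.+1%:R :> R by rewrite ltr0n.
  have q0 : 0 < d / k.+1%:R by rewrite divr_gt0.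
  have q1 : d / k.+1%:R <= d by rewrite ler_pdivrMr// ler_peMr ?(ltW d0)// ler1n.
  rewrite /s; move: q0 q1 dh hlt; move: (d / k.+1%:R) => q q0 q1 dh hlt.
  by split; [apply/andP; split|]; lra.
have ns k : nm (s k)%:C = s k.
  by rewrite nm_real ger0_norm//; have [/andP[/ltW]] := sb k.
have nd k : dC (s k)%:C 1 <= dG.
  have [/andP[_ s1] sd] := sb k; rewrite /dC -[1 : C]/(1%:C) -rmorphB nm_real distrC ger0_norm.
    exact: le_trans sd dd2.
  by rewrite subr_ge0 ltW.
exists (fun j => (s j)%:C), (s 0)%:C; split; last split.
- split=> [|j|j|i j].
  + by rewrite ns; have [/andP[]] := sb 0%N.
  + by rewrite ns; have [/andP[]] := sb j.
  + by rewrite -nm_gt0 ns; have [/andP[]] := sb j.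
  + move=> [] /(addrI _)/oppr_inj/(mulfI (lt0r_neq0 d0))/invr_inj/eqP.
    by rewrite eqr_nat eqSS => /eqP; exact: val_inj.
- move=> j; apply: (far _ (g2 (1, 1))); first exact: u2.
  apply: hdG; [|by split; exact: circ_cdisc|by rewrite /d2 ge_max !nd].
  by split; rewrite /cdisc /= ns; have [/andP[_ /ltW]] := sb 0%N => //; have [/andP[_ /ltW]] := sb j.
- move=> x cx; have [/andP[/ltW s0 s1] sd] := sb 0%N.
  have l1 : nm (s 0%N)%:C < 1 by rewrite ns.
  have uy : uc (fun y => u (x, y)) by exact: ucont_slice2 cx uu.
  rewrite -nm_eq0 -nmJ nm_eq0 /mixQ -(ext_conj uy l1).
  apply: (far _ (cj (u (x, 1)))); first by rewrite nmJ un.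
  rewrite -(mean_anT_pk (aY cx) l1).
  have := hd1 (s 0%N) x 1 _ (le_trans sd dd1) cx co; rewrite mulr1; apply.
  by rewrite s0.
Qed.

(** In [columns_boundary] cleared of denominators, the left side [q] does not depend on y, and [P y]
    is the N_y of the overview. Since u is unimodular, |P y| = |q| on the circle. *)
Lemma mixed_product : fr_kernel (comker g1 g2) -> exists x0, circ x0 /\
  forall x y, circ x -> circ y -> u (x, y) * cj (u (x0, y)) = u (x, 1) * cj (u (x0, 1)).
Proof.
move=> [n [e [he hK]]].
have [al [la [[l1 a1 al0 alI] [G0 Q0]]]] := column_points n.
have [c [[j0 c0] hc]] := @dependent_columns R (@inD R) _ n (fun i z => ev (e i) z) hK
  (fun j => (al j, la)) (fun j => conj (a1 j) l1).
have bd := columns_boundary h1 h2 u1 aX aY l1 a1 hc.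
pose N := \sum_j (c j * cj (g2 (al j, la))) *: coprod al j.
pose P y := \sum_j (c j * cj (g1 (al j, la)) * cj (mixS g1 g2 y (al j))) *: coprod al j.
have N0 : N != 0.
  apply: (sum_coprod_neq0 al0 alI (j := j0)); rewrite mulf_neq0//.
  by rewrite -nm_eq0 nmJ nm_eq0.
pose q x := mixQ g1 g2 x la * N.[x].
have qE x y : circ x -> circ y -> q x = u (x, y) * (P y).[x].
  by move=> cx cy; rewrite /q /N /P (sum_coprod a1 _ cx) (sum_coprod a1 _ cx) mulrCA (bd x y cx cy) mulrCA.
have co : circ (1 : C) by exact: nm1.
have q0 x : circ x -> N.[x] != 0 -> q x != 0 by move=> cx nx; rewrite mulf_neq0// Q0.
have [x0 [c0' _ nx0]] := poly_nonroot N0 co ltr01.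
exists x0; split=> //.
pose m x := nm (q x).
have mP x y : circ x -> circ y -> nm (P y).[x] = m x.
  by move=> cx cy; rewrite /m (qE x y cx cy) nmM un// mul1r.
pose M := (\max_j size (coprod al j))%N.
have sP y : circ y -> (size (P y) <= M.+1)%N.
  move=> _; apply: leqW; apply: leq_trans (size_sum _ _ _) _.
  apply/bigmax_leqP => j _; apply: leq_trans (size_scale_leq _ _) _.
  exact: (leq_bigmax (F := fun j => size (coprod al j))).
have uP x : circ x -> uc (fun y => (P y).[x]).
  move=> cx; rewrite /P.
  have -> : (fun y => (\sum_j (c j * cj (g1 (al j, la)) * cj (mixS g1 g2 y (al j))) *: coprod al j).[x]) =
     (fun y => \sum_j (c j * cj (g1 (al j, la)) * (coprod al j).[x]) * cj (mixS g1 g2 y (al j))).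
    apply/funext => y; rewrite horner_sum; apply: eq_bigr => j _; rewrite hornerZ.
    by rewrite mulrAC.
  apply: ucont_big => j.
  by apply: ucontM; [exact: ucont_cst|exact: (proj1 (mixS_anT h1 h2 aY (a1 j)))].
have m0 : m x0 != 0 by rewrite nm_eq0 q0.
(* Pairing with the value at [x0] removes the unknown phase, so that a continuous function of [y]
   with finitely many values remains. *)
have X1 x y : circ x -> circ y -> (P y).[x] * cj (P y).[x0] = (P 1).[x] * cj (P 1).[x0].
  move=> cx cy; have [s hs] := same_modulus_finite sP mP c0' m0 cx c0'.
  by apply: (finite_valued_const _ hs) => //; apply: ucontM; [exact: uP|apply: ucontJ; exact: uP].
have key x y : circ x -> circ y -> N.[x] != 0 ->
    u (x, y) * cj (u (x0, y)) = u (x, 1) * cj (u (x0, 1)).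
  move=> cx cy nx; have := X1 x y cx cy.
  have e1 := qE x y cx cy; have e2 := qE x 1 cx co.
  have e3 := qE x0 y c0' cy; have e4 := qE x0 1 c0' co.
  have t0 : (P 1).[x] * cj (P 1).[x0] != 0.
    by rewrite mulf_neq0 -?nm_eq0 ?nmJ ?mP// nm_eq0; exact: q0.
  move=> hX; apply: (mulIf t0); rewrite -{1}hX.
  move: e1 e2 e3 e4; move: (u (x, y)) (u (x, 1)) (u (x0, y)) (u (x0, 1)) => a b a' b'.
  move: (P y).[x] (P 1).[x] (P y).[x0] (P 1).[x0] => p r p' r' e1 e2 e3 e4.
  transitivity (a * p * cj (a' * p')); first by rewrite rmorphM /=; ring.
  by rewrite -e1 -e3 e2 e4 rmorphM /=; ring.
(* The roots of [N], where one cannot divide by [q], are reached by continuity from nearby points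
   that are not roots. *)
move=> x y cx cy; apply/eqP; rewrite -subr_eq0; apply/eqP; apply: nm_small0 => ep ep0.
have e2 : 0 < ep / 2 by rewrite divr_gt0.
have [d d0 hd] := proj2 uu _ e2; have [x' [cx' xx' nx']] := poly_nonroot N0 cx d0.
have near t : circ t -> nm (u (x, t) - u (x', t)) <= ep / 2.
  by move=> ct; apply: hd => //; rewrite /d2 ge_max /dC /= subrr nm0 xx' (ltW d0).
have n1 t : circ t -> nm (cj (u (x0, t))) = 1 by move=> ct; rewrite nmJ un.
have := key x' y cx' cy nx'; have := near y cy; have := near 1 co.
have := n1 y cy; have := n1 1 co.
move: (u (x, y)) (u (x, 1)) (u (x', y)) (u (x', 1)) => a b a' b'.
move: (cj (u (x0, y))) (cj (u (x0, 1))) => p r r1 p1 hb ha E.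
have -> : a * p - b * r = (a - a') * p - (b - b') * r by rewrite !mulrBl E; ring.
rewrite (le_trans (nmB _ _))// !nmM p1 r1 !mulr1 [ep]splitr; exact: lerD.
Qed.

(** From u = b(x) c(y) the extension [mixV] becomes B(s) conj(D(t)), and g2 conj(c) = b g1 on the
    torus extends to g2 D = B g1 inside ([GE]). Both terms of the kernel are then equal. *)
Lemma comker_eq0_mixed z w : fr_kernel (comker g1 g2) -> inD z -> inD w -> comker g1 g2 z w = 0.
Proof.
move=> fr hz hw; have [x0 [c0 hx0]] := mixed_product fr.
have co : circ (1 : C) by exact: nm1.
pose b x := u (x, 1) * cj (u (x0, 1)); pose c y := u (x0, y).
have uE x y : circ x -> circ y -> u (x, y) = b x * c y.
  by move=> cx cy; rewrite /b -(hx0 x y cx cy) -mulrA (mulrC (cj _)) nm1_mulJ ?mulr1//; exact: un.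
have ab : anT b by apply: eq_anT (anTZ (cj (u (x0, 1))) (aX co)) => x _; rewrite mulrC.
have ac : anT (fun y => cj (c y)) := aY c0.
have uc_c : uc c by exact: ucont_slice2 c0 uu.
pose B := ext b; pose D := ext (fun y => cj (c y)).
have QE x t : circ x -> nm t < 1 -> mixQ g1 g2 x t = cj (D t) * b x.
  move=> cx ht; rewrite /D (ext_conj uc_c ht) conjcK mulrC -meanZ; last first.
    by apply: ucontM => //; apply: ucontJ; exact: uc_szego.
  by apply: eq_mean => y cy; rewrite (uE x y cx cy) mulrA.
have VE s t : nm s < 1 -> nm t < 1 -> mixV g1 g2 s t = B s * cj (D t).
  move=> hs ht; rewrite mulrC /B /ext -meanZ; last by apply: ucontM; [exact: proj1 ab|exact: uc_szego].
  by apply: eq_mean => x cx; rewrite QE// mulrA.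
have GE v : inD v -> g2 v * D v.2 = B v.1 * g1 v.
  move=> [v1 v2].
  have aD : anT2 (fun p => cj (c p.2)).
    split=> [|y cy|x cx]; [|exact: (anT_cst (cj (c y)))|exact: ac].
    by apply: (@ucont_snd _ _ _ (fun y => cj (c y))); exact: proj1 ac.
  have aB : anT2 (fun p => b p.1).
    split=> [|y cy|x cx]; [|exact: ab|exact: (anT_cst (b x))].
    by apply: (@ucont_fst _ _ _ b); exact: proj1 ab.
  have ext1 t (k : C) : nm t < 1 -> ext (fun=> k) t = k.
    by move=> ht; rewrite /ext meanZ ?mean_szego ?mulr1//; exact: uc_szego.
  have eD : ext2 (fun p => cj (c p.2)) v = D v.2.
    by rewrite ext2E//; [rewrite /= ext1|case: aD].
  have eB : ext2 (fun p => b p.1) v = B v.1.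
    rewrite ext2E//; last by case: aB.
    by apply: eq_mean => x _; rewrite /= ext1.
  rewrite -eD -eB (cauchy2 h1 v1 v2) (cauchy2 h2 v1 v2).
  rewrite -(ext2_mul (hol2_anT2 h2) aD v1 v2) -(ext2_mul aB (hol2_anT2 h1) v1 v2).
  apply: eq_mean2 => x y cx cy /=; congr (_ * _).
  have := uE x y cx cy; have cc : c y * cj (c y) = 1 by rewrite nm1_mulJ//; exact: un.
  have gg : g1 (x, y) * cj (g1 (x, y)) = 1 by rewrite nm1_mulJ//; exact: u1.
  move: cc gg; move: (c y) (cj (c y)) (g1 (x, y)) (cj (g1 (x, y))) (g2 (x, y)) (b x) => k k' g g' h f kk gg E.
  transitivity (h * g' * g * k'); first by rewrite -(mulrA h) (mulrC g') gg mulr1.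
  by rewrite E -!mulrA (mulrC g) mulrA mulrA -(mulrA f) kk mulr1.
rewrite (comker_mix h1 h2 aX aY hz hw).
have [z1 z2] := hz; have [w1 w2] := hw.
rewrite (VE _ _ z1 w2) (VE _ _ w1 z2).
have -> : g1 z * cj (g2 w) * (B z.1 * cj (D w.2)) = (B z.1 * g1 z) * cj (g2 w * D w.2).
  by rewrite [cj (_ * D _)]rmorphM /=; ring.
have -> : g2 z * cj (g1 w) * cj (B w.1 * cj (D z.2)) = (g2 z * D z.2) * cj (B w.1 * g1 w).
  by rewrite [cj (_ * cj _)]rmorphM [cj (B _ * g1 _)]rmorphM /= conjcK; ring.
by rewrite (GE _ hz) (GE _ hw) subrr mul0r.
Qed.

End MixedCase.

(** * The commutator vanishes *)

Section Main.
Variable R : realType.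
Local Notation C := R[i].
Local Notation ucT := (ucont (@d2 R) (@circ R `*` @circ R)).

Section Vanishing.
Variables g1 g2 : C * C -> C.
Hypotheses (h1 : hol2 g1) (h2 : hol2 g2).
Hypothesis u1 : forall s t : C, circ s -> circ t -> nm (g1 (s, t)) = 1.
Hypothesis u2 : forall s t : C, circ s -> circ t -> nm (g2 (s, t)) = 1.
Hypothesis fr : fr_kernel (comker g1 g2).

Lemma fr_kernel_opp : fr_kernel (comker g2 g1).
Proof.
have [n [e [he hK]]] := fr; exists n, e; split=> // w hw; have [c hc] := hK w hw.
exists (fun i => - c i) => z hz; rewrite comker_swap (hc z hz) -sumrN.
by apply: eq_bigr => i _; rewrite mulNr.
Qed.

Lemma comker_eq0 z w : inD z -> inD w -> comker g1 g2 z w = 0.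
Proof.
move=> hz hw; pose u p := g2 p * cj (g1 p).
have uu : ucT u by apply: ucontM; [exact: hol2_ucT|apply: ucontJ; exact: hol2_ucT].
have un x y : circ x -> circ y -> nm (u (x, y)) = 1.
  by move=> cx cy; rewrite nmM nmJ u1// u2// mulr1.
have f1 : hol2 (g1 \o @flip R) := hol2_swap h1; have f2 : hol2 (g2 \o @flip R) := hol2_swap h2.
have s1 : (forall y, circ y -> anT (fun x => u (x, y))) \/
    (forall y, circ y -> anT (fun x => cj (u (x, y)))).
  by apply: slices_dichotomy => // y cy; exact: (fr_kernel_slice h1 h2 u1 fr cy).
have s2 : (forall x, circ x -> anT (fun y => u (x, y))) \/
    (forall x, circ x -> anT (fun y => cj (u (x, y)))).
  apply: (@slices_dichotomy R (u \o @flip R)) => [|x y cx cy|x cx].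
  - exact: (ucont_swap uu).
  - exact: un.
  - apply: (fr_kernel_slice f1 f2 _ (fr_kernel_flip h1 h2 fr) cx) => s t cs ct.
    exact: u1.
have vE p : g1 p * cj (g2 p) = cj (u p) by rewrite [RHS]rmorphM /= conjcK mulrC.
have uv : ucT (fun p => g1 p * cj (g2 p)).
  by apply: ucontM; [exact: hol2_ucT|apply: ucontJ; exact: hol2_ucT].
have swap0 : comker g2 g1 z w = 0 -> comker g1 g2 z w = 0.
  by rewrite comker_swap => /eqP; rewrite oppr_eq0 => /eqP.
(* In the last two cases g1 and g2 are exchanged: the symbol becomes the conjugate of [u], and the
   kernel changes sign. *)
case: s1 => aX; case: s2 => aY.
- exact: (comker_eq0_anT2 h1 h2 u1 (And3 uu aX aY) hz hw).
- exact: (comker_eq0_mixed h1 h2 u1 u2 aX aY fr hz hw).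
- apply: swap0; apply: (comker_eq0_mixed h2 h1 u2 u1 _ _ fr_kernel_opp hz hw) => [y cy|x cx].
    by apply: eq_anT (aX y cy) => x _; rewrite vE.
  by apply: eq_anT (aY x cx) => y _; rewrite vE conjcK.
- apply: swap0; apply: (comker_eq0_anT2 h2 h1 u2 _ hz hw); split=> // [y cy|x cx].
    by apply: eq_anT (aX y cy) => x _; rewrite vE.
  by apply: eq_anT (aY x cx) => y _; rewrite vE.
Qed.

End Vanishing.
End Main.

Theorem corollary6p3 (R : realType) (phi1 phi2 : CC R * CC R -> CC R) :
  bidisc_algebra phi1 -> inner phi1 ->
  bidisc_algebra phi2 -> inner phi2 ->
  finite_rank (commutator (P_ phi1) (P_ phi2)) <->
  commutator (P_ phi1) (P_ phi2) = (fun=> 0).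
Proof.
move=> A1 I1 A2 I2; split=> [fr|->]; last exact: finite_rank0.
have [g1 [h1 u1 e1]] := inner_boundary A1 I1.
have [g2 [h2 u2 e2]] := inner_boundary A2 I2.
apply: (commutator_eq0 h1 h2 u1 u2 e1 e2) => z w hz hw.
exact: (comker_eq0 h1 h2 u1 u2 (finite_rank_comker h1 h2 u1 u2 e1 e2 fr) hz hw).
Qed.
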